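(* Consider the problem $\min_{x\in\mathbb{R}^d} f(x)=\frac1n\sum_{i=1}^n f_i(x)$ and the algorithm PGTC described in the context. Assume: (i) each $f_i:\mathbb{R}^d\to\mathbb{R}$ is differentiable and $L_f$-smooth for some $L_f>0$, i.e. $\|\nabla f_i(x)-\nabla f_i(y)\|\le L_f\|x-y\|$ for all $x,y\in\mathbb{R}^d$; (ii) the minimum value $f^*$ of $f$ satisfies $f^*>-\infty$; (iii) (Polyak–Łojasiewicz condition) there is $\nu>0$ with $\frac12\|\nabla f(x)\|^2\ge\nu(f(x)-f^* )$ for all $x\in\mathbb{R}^d$; (iv) the undirected graph $\mathcal G$ is connected and its weight matrix $W$ is doubly stochastic; (v) for some $\varphi\in(0,1]$ and $r>0$ the stochastic compressor $C:\mathbb{R}^d\to\mathbb{R}^d$ satisfies $\mathbb{E}_C\big[\|C(x)/r-x\|^2\big]\le(1-\varphi)\|x\|^2$ for all $x\in\mathbb{R}^d$. Suppose $\alpha_x,\alpha_y\in(0,\frac1r)$, $\gamma=\zeta_\gamma\rho\varphi_1$ and $\eta=\zeta_\eta\gamma\rho^2/L_f$, where $0<\zeta_\gamma=\zeta_\eta\le\bar\zeta_2$ and $$\bar\zeta_2=\min\Big\{\tfrac{1}{8\bar\lambda_{W-I}\sqrt{r_0}},\ \tfrac{n}{2L_f(\frac{n\nu}{2L_f^2}+930)},\ \tfrac{1}{\frac{2\nu+18n}{L_f}+576},\ \tfrac{1}{\frac{2\nu+72nr_0}{L_f}+576+1024r_0},\ \tfrac{1}{\frac{2\nu}{L_f}+144r_0},\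 \tfrac{1}{2\varphi_1+176}\Big\}.$$ Then for every $k\ge0$, $$V_{k+1}\le\Big(1-\frac{\eta\nu}{2}\Big)V_k+b_1\bar q^{2k}\bar s_\xi^2+\frac{\eta}{n}\,\mathbb{E}\Big[\Big\|\sum_{t=0}^k\xi_{y,t}\Big\|^2\Big].$$
   Context: Network. $\mathcal G=(\mathcal V,\mathcal E)$, $\mathcal V=\{1,\dots,n\}$, is an undirected graph; $W=[w_{ij}]\in\mathbb{R}^{n\times n}$ is its symmetric weighted adjacency matrix: $w_{ij}>0$ if $(i,j)\in\mathcal E$, $w_{ij}=0$ otherwise, $w_{ii}=0$. $\bar\lambda_A$ denotes the spectral radius of a matrix $A$; $\bar\lambda_{W-I}$ is the spectral radius of $W-I_n$. Noise. $\mathrm{Lap}(\theta)$ has density $\frac1{2\theta}e^{-|x|/\theta}$; $\xi\sim\mathrm{Lap}_d(\theta)$ means that all $d$ components of $\xi$ are $\mathrm{Lap}(\theta)$. For $i\in\mathcal V$, $k\ge0$: $\xi_{x_i,k}\sim\mathrm{Lap}_d(s_{\xi_{x_i}}q_i^k)$ and $\xi_{y_i,k}\sim\mathrm{Lap}_d(s_{\xi_{y_i}}q_i^k)$ with $s_{\xi_{x_i}},s_{\xi_{y_i}}>0$, $0<q_i<1$. All noise components are mutually independent, and the internal randomness of the compressor is drawn afresh at each use, independently of everything else. $\mathbb{E}_C$ is expectation over the internal randomness of $C$. Algorithm PGTC, with positive parameters $\eta,\gamma,\alpha_x,\alpha_y$: choose $x_{i,0}\in\mathbb{R}^d$ arbitrarily,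 $x^c_{i,0}=y^c_{i,0}=\mathbf 0$, $y_{i,0}=\nabla f_i(x_{i,0})$. For $k\ge0$ and all $i\in\mathcal V$: $x^a_{i,k}=x_{i,k}+\xi_{x_i,k}$, $\ y^a_{i,k}=y_{i,k}+\xi_{y_i,k}$; $\hat x_{i,k}=x^c_{i,k}+C(x^a_{i,k}-x^c_{i,k})$, $\ \hat y_{i,k}=y^c_{i,k}+C(y^a_{i,k}-y^c_{i,k})$; $x^c_{i,k+1}=(1-\alpha_x)x^c_{i,k}+\alpha_x\hat x_{i,k}$, $\ y^c_{i,k+1}=(1-\alpha_y)y^c_{i,k}+\alpha_y\hat y_{i,k}$; $x_{i,k+1}=x^a_{i,k}+\gamma\sum_{j=1}^nw_{ij}(\hat x_{j,k}-\hat x_{i,k})-\eta y_{i,k}$; $y_{i,k+1}=y^a_{i,k}+\gamma\sum_{j=1}^nw_{ij}(\hat y_{j,k}-\hat y_{i,k})+\nabla f_i(x_{i,k+1})-\nabla f_i(x_{i,k})$. Stacked notation. $\mathbf x_k,\mathbf y_k,\xi_{x,k},\xi_{y,k}\in\mathbb{R}^{nd}$ stack the vectors $x_{i,k},y_{i,k},\xi_{x_i,k},\xi_{y_i,k}$ over $i$; $\bar x_k=\frac1n\sum_ix_{i,k}$, $\bar{\mathbf x}_k=\mathbf 1_n\otimes\bar x_k$, and similarly $\bar{\mathbf y}_k$. $\sigma_{x,k}$ and $\sigma_{y,k}$ stack $x^c_{i,k}-x^a_{i,k}$ and $y^c_{i,k}-y^a_{i,k}$. $\Theta_k=[\|\mathbf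 x_k-\bar{\mathbf x}_k\|^2,\|\mathbf y_k-\bar{\mathbf y}_k\|^2,\|\sigma_{x,k}\|^2,\|\sigma_{y,k}\|^2]^\top$. Constants. $r_0=2r^2(1-\varphi)+2(1-r)^2$; $\varphi_1=\min\{\alpha_xr\varphi,\alpha_yr\varphi\}$; $\rho=1-\bar\lambda_{W-\mathbf 1\mathbf 1^\top/n}$; $\hat\lambda=1-\gamma\rho$; $\bar q=\max_iq_i$; $\bar s_\xi=\max_i\{s_{\xi_{x_i}},s_{\xi_{y_i}}\}$; $\zeta_1=\frac{n}{2L_f}$, $\zeta_3=1$, $\zeta_2=\zeta_4=\zeta_\eta$; $\mathbf s=\big[\frac{\zeta_1L_f}{n},\frac{\zeta_2\rho^2}{nL_f},\frac{\zeta_3L_f}{n},\frac{\zeta_4\rho^2}{nL_f}\big]^\top$; $V_k=\mathbb{E}[f(\bar x_k)]-f^*+\mathbf s^\top\mathbb{E}[\Theta_k]$; $\vartheta_2=2nd\Big[\frac{9\hat\lambda^2}{\gamma\rho},\ \frac{36\hat\lambda^2L_f^2}{\gamma\rho}+\frac{9\hat\lambda^2}{\gamma\rho},\ \frac{16(\hat\lambda^2+1)}{\varphi_1},\ \frac{64\bar\lambda_{W-I}^2+16(\bar\lambda_{W-I}^2+1)}{\varphi_1}\Big]^\top$; $b_1=\mathbf s^\top\vartheta_2+(\frac1\eta+L_f)n$. A term with zero denominator in the minimum defining $\bar\zeta_2$ (which occurs when $r_0=0$) is read as $+\infty$. *)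

(* Defs.v *)
From HB Require Import structures.
From mathcomp Require Export all_boot all_order all_algebra.
From mathcomp Require Export complex.
From mathcomp Require Export all_classical all_reals all_analysis.

Set Implicit Arguments.
Unset Strict Implicit.
Unset Printing Implicit Defensive.

Export Order.TTheory GRing.Theory Num.Theory.
Export numFieldNormedType.Exports.

Local Open Scope classical_set_scope.
Local Open Scope ring_scope.

(* Euclidean norm of a vector (Frobenius norm of a matrix). The library's
   norm `|A| on matrices is the maximum norm. A stacked vector of R^(nd) is
   represented by the n x d matrix whose i-th row is the i-th block, so this is
   also the Euclidean norm on R^(nd). *)
Definition l2norm (R : realType) (m n : nat) (A : 'M[R]_(m, n)) : R :=
  Num.sqrt (\sum_(i < m) \sum_(j < n) A i j ^+ 2).

Definition stack (R : realType) (n d : nat) (v : 'I_n -> 'rV[R]_d)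
  : 'M[R]_(n, d) := \matrix_(i < n) v i.

Definition average (R : realType) (n d : nat) (v : 'I_n -> 'rV[R]_d)
  : 'rV[R]_d := n%:R^-1 *: \sum_(i < n) v i.

Definition grad (R : realType) (d : nat) (f : 'rV[R]_d -> R) (x : 'rV[R]_d)
  : 'rV[R]_d := \row_(j < d) 'D_(delta_mx 0 j) f x.

Definition smooth (R : realType) (d : nat) (L : R) (f : 'rV[R]_d -> R) : Prop :=
  (forall x, differentiable f x) /\
  (forall x y, l2norm (grad f x - grad f y) <= L * l2norm (x - y)).

(* Largest modulus of a complex eigenvalue. *)
Definition spectral_radius (R : realType) (n : nat) (A : 'M[R]_n) : R :=
  sup [set ComplexField.Normc.normc lam | lam in
        [set lam : R[i] | eigenvalue (map_mx (real_complex R) A) lam]].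

Definition weighted_adjacency (R : realType) (n : nat) (e : rel 'I_n)
    (W : 'M[R]_n) : Prop :=
  [/\ W^T = W,
      forall i j, e i j -> 0 < W i j,
      forall i j, ~~ e i j -> W i j = 0
    & forall i, W i i = 0].

Definition doubly_stochastic (R : realType) (n : nat) (W : 'M[R]_n) : Prop :=
  [/\ forall i j, 0 <= W i j,
      forall i, \sum_(j < n) W i j = 1
    & forall j, \sum_(i < n) W i j = 1].

Definition laplace_pdf (R : realType) (theta x : R) : R :=
  (2 * theta)^-1 * expR (- `|x| / theta).

Definition laplace_rv (disp : measure_display) (T : measurableType disp)
    (R : realType) (P : probability T R) (theta : R) (X : T -> R) : Prop :=
  measurable_fun setT X /\
  forall A : set R, measurable A ->
    P (X @^-1` A) =
    (\int[@lebesgue_measure R]_(x in A) (laplace_pdf theta x)%:E)%E.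

Definition has_law (disp disp' : measure_display) (T : measurableType disp)
    (Z : measurableType disp') (R : realType) (P : probability T R)
    (mu : probability Z R) (X : T -> Z) : Prop :=
  measurable_fun setT X /\
  forall A : set Z, measurable A -> P (X @^-1` A) = mu A.

Definition mutually_independent (disp : measure_display)
    (T : measurableType disp) (R : realType) (P : probability T R)
    (I : eqType) (F : I -> set (set T)) : Prop :=
  forall (J : seq I) (A : I -> set T), uniq J ->
    (forall a, a \in J -> F a (A a)) ->
    P (\bigcap_(a in [set` J]) A a) = (\prod_(a <- J) P (A a))%E.

(* The sigma-algebras generated by the elementary sources of randomness: the
   scalar noise components, indexed by (x or y, k, i, component), and the seeds
   of the compressor calls, indexed by (x or y, k, i). *)
Definition source_events (disp disp' : measure_display)
    (T : measurableType disp) (Z : measurableType disp') (R : realType)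
    (n d : nat) (xi_x xi_y : T -> nat -> 'I_n -> 'rV[R]_d)
    (z_x z_y : T -> nat -> 'I_n -> Z)
    (a : (bool * nat * 'I_n * 'I_d) + (bool * nat * 'I_n)) : set (set T) :=
  match a with
  | inl (b, k, i, j) => preimage_set_system setT
      (fun w => (if b then xi_x else xi_y) w k i 0 j) measurable
  | inr (b, k, i) => preimage_set_system setT
      (fun w => (if b then z_x else z_y) w k i) measurable
  end.

(* A stochastic compressor is a map C of the input and of a random seed in Z.
   It is required to be jointly measurable; R^d carries its Borel sigma-algebra
   through the product sigma-algebra of d.-tuple R. *)
Definition measurable_compressor (disp' : measure_display)
    (Z : measurableType disp') (R : realType) (d : nat)
    (C : 'rV[R]_d -> Z -> 'rV[R]_d) : Prop :=
  forall j : 'I_d, measurable_fun setT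
    (fun u : d.-tuple R * Z => C (\row_(l < d) tnth u.1 l) u.2 0 j).

Definition compressor (disp' : measure_display)
    (Z : measurableType disp') (R : realType) (PC : probability Z R) (d : nat)
    (phi r : R) (C : 'rV[R]_d -> Z -> 'rV[R]_d) : Prop :=
  forall x, ('E_PC[fun z => (l2norm (r^-1 *: C x z - x) ^+ 2)%R]
             <= ((1 - phi) * l2norm x ^+ 2)%:E)%E.

Record pgtc_state (R : realType) (n d : nat) : Type := PGTCState {
  st_x : 'I_n -> 'rV[R]_d;
  st_y : 'I_n -> 'rV[R]_d;
  st_xc : 'I_n -> 'rV[R]_d;
  st_yc : 'I_n -> 'rV[R]_d
}.

(* One iteration; nx, ny are the noises added to x, y, and Cx i, Cy i are the
   realizations of the compressor used by agent i on its two messages. *)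
Definition pgtc_step (R : realType) (n d : nat) (W : 'M[R]_n)
    (f : 'I_n -> 'rV[R]_d -> R) (eta gamma alpha_x alpha_y : R)
    (nx ny : 'I_n -> 'rV[R]_d) (Cx Cy : 'I_n -> 'rV[R]_d -> 'rV[R]_d)
    (s : pgtc_state R n d) : pgtc_state R n d :=
  let xa i := st_x s i + nx i in
  let ya i := st_y s i + ny i in
  let xh i := st_xc s i + Cx i (xa i - st_xc s i) in
  let yh i := st_yc s i + Cy i (ya i - st_yc s i) in
  let x' i := xa i + gamma *: \sum_(j < n) W i j *: (xh j - xh i)
              - eta *: st_y s i in
  let y' i := ya i + gamma *: \sum_(j < n) W i j *: (yh j - yh i)
              + grad (f i) (x' i) - grad (f i) (st_x s i) in
  PGTCState x' y'
    (fun i => (1 - alpha_x) *: st_xc s i + alpha_x *: xh i)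
    (fun i => (1 - alpha_y) *: st_yc s i + alpha_y *: yh i).

Fixpoint pgtc (R : realType) (n d : nat) (W : 'M[R]_n)
    (f : 'I_n -> 'rV[R]_d -> R) (eta gamma alpha_x alpha_y : R)
    (x0 : 'I_n -> 'rV[R]_d) (xi_x xi_y : nat -> 'I_n -> 'rV[R]_d)
    (Cx Cy : nat -> 'I_n -> 'rV[R]_d -> 'rV[R]_d) (k : nat)
    : pgtc_state R n d :=
  match k with
  | 0 => PGTCState x0 (fun i => grad (f i) (x0 i)) (fun=> 0) (fun=> 0)
  | k'.+1 => pgtc_step W f eta gamma alpha_x alpha_y
               (xi_x k') (xi_y k') (Cx k') (Cy k')
               (pgtc W f eta gamma alpha_x alpha_y x0 xi_x xi_y Cx Cy k')
  end.

Definition col4 (R : realType) (a b c e : R) : 'cV[R]_4 :=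
  \col_(i < 4) [:: a; b; c; e]`_i.

(* The vector Theta_k, with nx, ny the noises of the current iteration. *)
Definition Theta (R : realType) (n d : nat) (nx ny : 'I_n -> 'rV[R]_d)
    (s : pgtc_state R n d) : 'cV[R]_4 :=
  col4
    (l2norm (stack (fun i => st_x s i - average (st_x s))) ^+ 2)
    (l2norm (stack (fun i => st_y s i - average (st_y s))) ^+ 2)
    (l2norm (stack (fun i => st_xc s i - (st_x s i + nx i))) ^+ 2)
    (l2norm (stack (fun i => st_yc s i - (st_y s i + ny i))) ^+ 2).

(* The inverse of \bar R satisfies 0^-1 = +oo, so a term with zero denominator
   does not constrain the minimum. *)
Definition zetabar2 (R : realType) (n : nat) (nu Lf r0 phi1 lamWI : R)
    : \bar R :=
  (\big[Order.min/+oo]_(t <- [::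
     1 / (8 * lamWI * Num.sqrt r0)%:E;
     n%:R%:E / (2 * Lf * (n%:R * nu / (2 * Lf ^+ 2) + 930))%:E;
     1 / ((2 * nu + 18 * n%:R) / Lf + 576)%:E;
     1 / ((2 * nu + 72 * n%:R * r0) / Lf + 576 + 1024 * r0)%:E;
     1 / (2 * nu / Lf + 144 * r0)%:E;
     1 / (2 * phi1 + 176)%:E]) t)%E.

(* Main.v *)
From HB Require Import structures.
From mathcomp Require Import ring lra spectral measurable_realfun.
Require Import Defs.

Set Implicit Arguments.
Unset Strict Implicit.
Unset Printing Implicit Defensive.

Local Open Scope classical_set_scope.
Local Open Scope ring_scope.

(* In matrix form, with J the averaging matrix, the consensus errors
   (1 - J) X and (1 - J) Y are contracted by 1 + gamma (W - 1) - J, whose norm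
   is at most 1 - gamma rho because W - J is symmetric; the compression errors
   contract by 1 - phi1 / 2 in mean square because E[C] is only evaluated at a
   message independent of the seed of that call; and the objective decreases by
   the descent lemma and the Polyak-Lojasiewicz inequality, since the mean of
   the y_i is the mean gradient plus the mean accumulated noise.  The noise
   drawn at a step is symmetric and independent of the state, hence orthogonal
   to it in L2, so it enters each recursion only through its second moment.
   Weighting the five recursions as in V_k, each coefficient condition reduces
   to one of the bounds on zeta, using |(W - 1) v| <= 2 |v|. *)

(** * Frobenius inner product *)

(** No conditional expectation is formed. Being determined by the past is expressed as measurability
    for the sigma-algebra generated by all elementary sources but one, and an independent source is
    integrated out by Tonelli on a product measure. A second obstacle is integrability: only the
    second moment of the compressor error is controlled, so square integrability of iterates,
    references and compressed messages has to be carried along the iteration before any mean may be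
    split.

    Perturbations are split off by |A + B|^2 <= |A|^2 / p + |B|^2 / (1 - p). With p = 1 - gamma rho
    a squared contraction factor collapses to the factor itself, at the price 1 / (gamma rho) on the
    perturbation. The quantization error pays this price, because nothing makes it orthogonal to the
    state; the noise does not.

    The noise of step k + 1 already occurs in V_{k+1} through the sigma terms, so two consecutive
    noise levels are bounded together. *)

Definition ip (R : realType) (m n : nat) (A B : 'M[R]_(m, n)) : R :=
  \sum_(i < m) \sum_(j < n) A i j * B i j.

Definition sq (R : realType) (m n : nat) (A : 'M[R]_(m, n)) : R := ip A A.

Section InnerProduct.
Variables (R : realType) (m n : nat).
Implicit Types A B C : 'M[R]_(m, n).

Lemma sqE A : sq A = \sum_(i < m) \sum_(j < n) A i j ^+ 2.
Proof. by apply: eq_bigr => i _; apply: eq_bigr => j _; rewrite expr2. Qed.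

Lemma sq_ge0 A : 0 <= sq A.
Proof.
by rewrite sqE; apply: sumr_ge0 => i _; apply: sumr_ge0 => j _; exact: sqr_ge0.
Qed.

Lemma l2normE A : l2norm A ^+ 2 = sq A.
Proof. by rewrite /l2norm -sqE sqr_sqrtr ?sq_ge0. Qed.

Lemma l2norm_ge0 A : 0 <= l2norm A.
Proof. exact: sqrtr_ge0. Qed.

Lemma ip_trace A B : ip A B = \tr (A *m B^T).
Proof.
by apply: eq_bigr => i _; rewrite !mxE; apply: eq_bigr => j _; rewrite mxE.
Qed.

Lemma ipC A B : ip A B = ip B A.
Proof. by apply: eq_bigr => i _; apply: eq_bigr => j _; rewrite mulrC. Qed.

Lemma ipDl A B C : ip (A + B) C = ip A C + ip B C.
Proof. by rewrite !ip_trace mulmxDl mxtraceD. Qed.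

Lemma ipZl a A B : ip (a *: A) B = a * ip A B.
Proof. by rewrite !ip_trace -scalemxAl mxtraceZ. Qed.

Lemma ip0l A : ip 0 A = 0.
Proof. by rewrite -(scale0r A) ipZl mul0r. Qed.

Lemma ipNl A B : ip (- A) B = - ip A B.
Proof. by rewrite -scaleN1r ipZl mulN1r. Qed.

Lemma ipBl A B C : ip (A - B) C = ip A C - ip B C.
Proof. by rewrite ipDl ipNl. Qed.

Lemma ipDr A B C : ip C (A + B) = ip C A + ip C B.
Proof. by rewrite ipC ipDl !(ipC C). Qed.

Lemma ipZr a A B : ip B (a *: A) = a * ip B A.
Proof. by rewrite ipC ipZl ipC. Qed.

Lemma ipNr A B : ip B (- A) = - ip B A.
Proof. by rewrite ipC ipNl ipC. Qed.

Lemma ipBr A B C : ip C (A - B) = ip C A - ip C B.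
Proof. by rewrite ipDr ipNr. Qed.

Lemma sqD A B : sq (A + B) = sq A + 2 * ip A B + sq B.
Proof. by rewrite /sq ipDl !ipDr (ipC B A); ring. Qed.

Lemma sqB A B : sq (A - B) = sq A - 2 * ip A B + sq B.
Proof. by rewrite sqD /sq ipNr ipNl ipNr; ring. Qed.

Lemma sqZ a A : sq (a *: A) = a ^+ 2 * sq A.
Proof. by rewrite /sq ipZl ipZr mulrA. Qed.

Lemma sqN A : sq (- A) = sq A.
Proof. by rewrite /sq ipNl ipNr opprK. Qed.

Lemma sqBC A B : sq (A - B) = sq (B - A).
Proof. by rewrite -sqN opprB. Qed.

(** The defect of the inequality is [sq (q *: A - p *: B) / (p * q)]. Choosing for [p] a contraction
    factor turns [p ^+ 2] on [A] into [p]. *)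
Lemma sq_convex p q A B : 0 < p -> 0 < q -> p + q = 1 ->
  sq (A + B) <= sq A / p + sq B / q.
Proof.
move=> p0 q0 pq; have := sq_ge0 (q *: A - p *: B).
rewrite sqB !sqZ ipZl ipZr sqD => h.
rewrite -subr_ge0.
have -> : sq A / p + sq B / q - (sq A + 2 * ip A B + sq B) =
  (q ^+ 2 * sq A - 2 * (q * (p * ip A B)) + p ^+ 2 * sq B) / (p * q).
  have -> : q = 1 - p by rewrite -pq; ring.
  have ? : 1 - p != 0 by rewrite subr_eq0 -pq eq_sym -subr_eq0; lra.
  by field; rewrite ?gt_eqF //; lra.
by rewrite divr_ge0 // mulr_ge0 // ltW.
Qed.

Lemma sqD2_le A B : sq (A + B) <= 2 * (sq A + sq B).
Proof.
have := @sq_convex 2^-1 2^-1 A B.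
by rewrite !invrK; move=> /(_ _ _ _)/le_trans -> //; lra.
Qed.

(** The weights (k - 1)/k and 1/k turn the bound for k - 1 summands into the one for k; the same
    choice serves four and five summands. *)
Lemma sqD3_le A B C : sq (A + B + C) <= 3 * (sq A + sq B + sq C).
Proof.
have := @sq_convex (2/3) (3^-1) (A + B) C.
rewrite !invf_div invrK => /(_ _ _ _)/le_trans -> //; try lra.
by have := sqD2_le A B; lra.
Qed.

Lemma sqD4_le A B C D :
  sq (A + B + C + D) <= 4 * (sq A + sq B + sq C + sq D).
Proof.
have := @sq_convex (3/4) (4^-1) (A + B + C) D.
rewrite !invf_div invrK => /(_ _ _ _)/le_trans -> //; try lra.
by have := sqD3_le A B C; lra.
Qed.

Lemma sqD5_le A B C D E :
  sq (A + B + C + D + E) <= 5 * (sq A + sq B + sq C + sq D + sq E).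
Proof.
have := @sq_convex (4/5) (5^-1) (A + B + C + D) E.
rewrite !invf_div invrK => /(_ _ _ _)/le_trans -> //; try lra.
by have := sqD4_le A B C D; lra.
Qed.

Lemma sq0_eq0 A : sq A = 0 -> A = 0.
Proof.
rewrite sqE => /psumr_eq0P => h; apply/matrixP => i j; rewrite mxE.
have /psumr_eq0P h2 : \sum_(j < n) A i j ^+ 2 = 0.
  by apply: h => // k _; apply: sumr_ge0 => l _; exact: sqr_ge0.
have : A i j ^+ 2 = 0 by apply: h2 => // k _; exact: sqr_ge0.
by move/eqP; rewrite sqrf_eq0 => /eqP.
Qed.

(** Expanding the square of [l2norm B *: A - l2norm A *: B] gives the inequality multiplied by
    [l2norm A * l2norm B], so the vanishing cases are treated apart. *)
Lemma ip_le_l2norm A B : ip A B <= l2norm A * l2norm B.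
Proof.
have [A0|A0] := eqVneq (sq A) 0.
  have -> : A = 0 by exact: sq0_eq0.
  by rewrite ip0l mulr_ge0 ?l2norm_ge0.
have [B0|B0] := eqVneq (sq B) 0.
  have -> : B = 0 by exact: sq0_eq0.
  by rewrite ipC ip0l mulr_ge0 ?l2norm_ge0.
have a0 : 0 < l2norm A.
  by rewrite lt_def l2norm_ge0 andbT -sqrf_eq0 l2normE A0.
have b0 : 0 < l2norm B.
  by rewrite lt_def l2norm_ge0 andbT -sqrf_eq0 l2normE B0.
have := sq_ge0 (l2norm B *: A - l2norm A *: B).
rewrite sqB !sqZ ipZl ipZr -!l2normE => h.
rewrite -(ler_pM2l (mulr_gt0 a0 b0)).
by nra.
Qed.

End InnerProduct.

Lemma ip_mul (R : realType) m n p (S : 'M[R]_(m, n)) (A : 'M[R]_(n, p)) B :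
  ip (S *m A) B = ip A (S^T *m B).
Proof.
by rewrite !ip_trace trmx_mul trmxK -mulmxA mxtrace_mulC -mulmxA.
Qed.

(** * Spectral bounds *)

Section UnitarySquareNorm.
Local Open Scope sesquilinear_scope.
Variable C : numClosedFieldType.

(** Complex counterpart of [sq]: a real symmetric matrix is diagonalized over the complex numbers,
    by a unitary change of basis. *)
Definition sqC (m n : nat) (A : 'M[C]_(m, n)) : C :=
  \sum_(i < m) \sum_(j < n) `|A i j| ^+ 2.

Lemma sqC_trace m n (A : 'M[C]_(m, n)) : sqC A = \tr (A ^t* *m A).
Proof.
rewrite /sqC exchange_big; apply: eq_bigr => j _; rewrite !mxE.
by apply: eq_bigr => i _; rewrite !mxE normCK mulrC.
Qed.

Lemma sqC_unitary m n (U : 'M[C]_m) (A : 'M[C]_(m, n)) :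
  U \is unitarymx -> sqC (U *m A) = sqC A.
Proof.
move=> Uu; rewrite !sqC_trace trmx_mul map_mxM mulmxA -(mulmxA _ _ U).
by rewrite -invmx_unitary // mulVmx ?unitarymx_unit // mulmx1.
Qed.

Lemma sqC_diag_le m n (D : 'rV[C]_m) (A : 'M[C]_(m, n)) b :
  (forall i, `|D 0 i| <= b) -> sqC (diag_mx D *m A) <= b ^+ 2 * sqC A.
Proof.
move=> Db; rewrite /sqC mulr_sumr; apply: ler_sum => i _.
rewrite mulr_sumr; apply: ler_sum => j _.
rewrite mul_diag_mx mxE normrM exprMn ler_wpM2r ?exprn_ge0 //.
by rewrite lerXn2r ?nnegrE ?(le_trans _ (Db i)).
Qed.

End UnitarySquareNorm.

Section SpectralBound.
Variables (R : realType) (n : nat).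
Implicit Types S : 'M[R]_n.

Lemma normcE_real (z : R[i]) : `|z| = (ComplexField.Normc.normc z)%:C%C.
Proof. by case: z => a b; rewrite normc_def. Qed.

(** The supremum is meaningful because the set is bounded: eigenvalues are roots of the
    characteristic polynomial, and the sum of the moduli of all its roots is an upper bound. *)
Lemma spectral_radius_ub S (lam : R[i]) :
  eigenvalue (map_mx (real_complex R) S) lam ->
  ComplexField.Normc.normc lam <= spectral_radius S.
Proof.
move=> h; apply: sup_ubound; last by exists lam.
have [r rE] := closed_field_poly_normal (char_poly (map_mx (real_complex R) S)).
exists (\sum_(z <- r) ComplexField.Normc.normc z) => _ [z zS <-].
have : z \in r.
  move: zS; rewrite /= eigenvalue_root_char rE.
  rewrite (monicP (char_poly_monic _)) scale1r.
  by rewrite root_prod_XsubC.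
move=> zr; rewrite (big_rem _ zr) /= lerDl.
by apply: sumr_ge0 => -[a b] _; exact: sqrtr_ge0.
Qed.

Lemma spectral_radius_ge0 S : 0 <= spectral_radius S.
Proof.
rewrite /spectral_radius; set E := [set _ | _ in _].
(* Where [E] has no supremum, as for n = 0, [sup] takes its default value 0. *)
have [hS|/sup_out ->//] := pselect (has_sup E).
case: (hS) => -[z zS] ub; apply: le_trans (sup_ubound ub zS).
by case: zS => -[a b] _ <-; exact: sqrtr_ge0.
Qed.

Lemma sqC_real m p (A : 'M[R]_(m, p)) :
  sqC (map_mx (real_complex R) A) = (sq A)%:C%C.
Proof.
rewrite sqE rmorph_sum; apply: eq_bigr => i _; rewrite rmorph_sum.
apply: eq_bigr => j _; rewrite mxE normc_def /= expr0n /= addr0.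
by rewrite -rmorphXn /= sqr_sqrtr // sqr_ge0.
Qed.

(** The complexified matrix is unitarily diagonalizable. Multiplication by the unitary [U] preserves
    [sqC], and the diagonal entries are eigenvalues, hence of modulus at most the spectral
    radius. *)
Lemma sq_sym_mul_le S p (A : 'M[R]_(n, p)) : S^T = S ->
  sq (S *m A) <= spectral_radius S ^+ 2 * sq A.
Proof.
move=> symS; set Sc := map_mx (real_complex R) S.
have : Sc \is hermsymmx.
  apply: realsym_hermsym.
    by apply/is_hermitianmxP; rewrite expr0 scale1r map_mx_id // /Sc map_trmx symS.
  by apply/mxOverP => i j; rewrite mxE; apply/complex_realP; exists (S i j).
move=> /hermitian_normalmx/orthomx_spectralP.
set U := spectralmx Sc; set D := spectral_diag Sc => ScE.
have Uu : U \is unitarymx by exact: spectral_unitarymx.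
have USc : U *m Sc = diag_mx D *m U.
  by rewrite [in LHS]ScE !mulmxA mulmxV ?spectral_unit // mul1mx.
rewrite -(@lecR R) rmorphM rmorphXn /= -!sqC_real map_mxM -/Sc.
rewrite -(sqC_unitary _ Uu) mulmxA USc -mulmxA -(sqC_unitary (map_mx _ A) Uu).
apply: sqC_diag_le => i; rewrite normcE_real lecR; apply: spectral_radius_ub.
(* [eigenvalue] refers to left eigenvectors: these are the rows of [U], nonzero since [U] is
   invertible. *)
apply/eigenvalueP; exists (row i U).
  by rewrite -row_mul USc mul_diag_mx; apply/rowP => j; rewrite !mxE.
apply/eqP => Ui; have /mulmxV/(congr1 (row i)) := spectral_unit Sc.
rewrite row_mul Ui mul0mx => /rowP/(_ i)/eqP.
by rewrite !mxE eqxx /= eq_sym oner_eq0.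
Qed.

End SpectralBound.

(** * The averaging projection and doubly stochastic mixing *)

Section Averaging.
Variables (R : realType) (n : nat) (n_gt0 : (0 < n)%N).
Local Notation J := (const_mx n%:R^-1 : 'M[R]_n).

Let n0 : n%:R != 0 :> R. Proof. by rewrite pnatr_eq0 -lt0n. Qed.

Lemma avg_mulE p (A : 'M[R]_(n, p)) i j :
  (J *m A) i j = n%:R^-1 * \sum_(k < n) A k j.
Proof. by rewrite !mxE mulr_sumr; apply: eq_bigr => k _; rewrite mxE. Qed.

Lemma avg_idem : J *m J = J.
Proof.
apply/matrixP => i j; rewrite avg_mulE mxE.
under eq_bigr do rewrite mxE.
by rewrite sumr_const card_ord -[X in _ * X]mulr_natl mulfV // mulr1.
Qed.

(** Pythagoras: [J] is symmetric and idempotent, so the ranges of [J] and [1%:M - J] are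
    orthogonal. *)
Lemma sq_center_avg p (A : 'M[R]_(n, p)) :
  sq A = sq ((1%:M - J) *m A) + sq (J *m A).
Proof.
rewrite -[in LHS](subrK (J *m A) A) sqD mulmxBl mul1mx.
rewrite ipC ip_mul trmx_const mulmxBr mulmxA avg_idem subrr.
by rewrite ipC ip0l mulr0 addr0.
Qed.

Lemma sq_center_le p (A : 'M[R]_(n, p)) : sq ((1%:M - J) *m A) <= sq A.
Proof.
rewrite [leRHS]sq_center_avg.
by rewrite lerDl sq_ge0.
Qed.

Lemma sq_avg_mul_le p (A : 'M[R]_(n, p)) : sq (J *m A) <= sq A.
Proof.
rewrite [leRHS]sq_center_avg.
by rewrite lerDr sq_ge0.
Qed.

Variable W : 'M[R]_n.
Hypotheses (symW : W^T = W) (dsW : doubly_stochastic W).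

Lemma avg_mulW : J *m W = J.
Proof.
by case: dsW => _ _ c1; apply/matrixP => i j; rewrite avg_mulE c1 mulr1 mxE.
Qed.

Lemma mulW_avg : W *m J = J.
Proof. by apply: trmx_inj; rewrite trmx_mul trmx_const symW avg_mulW. Qed.

(** Jensen's inequality along each row, whose weights sum to 1, obtained from the nonnegativity of a
    weighted variance; after exchanging the sums, the column sums are 1 as well. *)
Lemma sq_stochastic_le p (A : 'M[R]_(n, p)) : sq (W *m A) <= sq A.
Proof.
case: dsW => W0 r1 c1; rewrite !sqE exchange_big [leRHS]exchange_big /=.
apply: ler_sum => j _.
have jensen i : (W *m A) i j ^+ 2 <= \sum_(k < n) W i k * A k j ^+ 2.
  rewrite mxE; set m := \sum_(k < n) _.
  have varE (c : R) : \sum_(k < n) W i k * (A k j - c) ^+ 2 =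
     (\sum_(k < n) W i k * A k j ^+ 2) - 2 * c * (\sum_(k < n) W i k * A k j)
      + c ^+ 2 * \sum_(k < n) W i k.
    rewrite !mulr_sumr -sumrB -big_split /=.
    by apply: eq_bigr => k _; ring.
  have : 0 <= \sum_(k < n) W i k * (A k j - m) ^+ 2.
    by apply: sumr_ge0 => k _; rewrite mulr_ge0 ?sqr_ge0.
  by rewrite varE r1 -/m; nra.
apply: le_trans (ler_sum _ (fun i _ => jensen i)) _.
rewrite exchange_big /=; apply: ler_sum => k _.
by rewrite -mulr_suml c1 mul1r.
Qed.

Lemma sq_laplacian_le p (A : 'M[R]_(n, p)) : sq ((W - 1%:M) *m A) <= 4 * sq A.
Proof.
rewrite mulmxBl mul1mx; apply: le_trans (sqD2_le _ _) _; rewrite sqN.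
by have := sq_stochastic_le A; lra.
Qed.

(** The matrix is the convex combination [(1 - g) *: (1%:M - J) + g *: (W - J)] of a projection and
    a symmetric matrix whose norm is its spectral radius; Cauchy-Schwarz bounds the cross term of
    the square. *)
Lemma sq_mixing_le (g : R) p (A : 'M[R]_(n, p)) :
  0 <= g <= 1 ->
  sq ((1%:M + g *: (W - 1%:M) - J) *m A) <=
  (1 - g * (1 - spectral_radius (W - J))) ^+ 2 * sq A.
Proof.
move=> /andP[g0 g1]; set c := spectral_radius _.
have c0 : 0 <= c by exact: spectral_radius_ge0.
have -> : (1%:M + g *: (W - 1%:M) - J) *m A =
   (1 - g) *: ((1%:M - J) *m A) + g *: ((W - J) *m A).
  rewrite !scalemxAl -mulmxDl; congr (_ *m _).
  by apply/matrixP => i j; rewrite !mxE; ring.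
have h1 := sq_center_le A.
have h2 : sq ((W - J) *m A) <= c ^+ 2 * sq A.
  by apply: sq_sym_mul_le; rewrite linearB /= symW trmx_const.
set B1 := _ *m A in h1 *; set B2 := _ *m A in h2 *.
have h3 : ip B1 B2 <= c * sq A.
  apply: le_trans (ip_le_l2norm _ _) _.
  have s0 := sq_ge0 A.
  have l1 : l2norm B1 <= Num.sqrt (sq A).
    by rewrite -(ler_pXn2r (n:=2)) ?nnegrE ?l2norm_ge0 ?sqrtr_ge0 // l2normE sqr_sqrtr.
  have l2 : l2norm B2 <= c * Num.sqrt (sq A).
    rewrite -(ler_pXn2r (n:=2)) ?nnegrE ?l2norm_ge0 ?mulr_ge0 ?sqrtr_ge0 //.
    by rewrite l2normE exprMn sqr_sqrtr.
  apply: le_trans (ler_pM (l2norm_ge0 _) (l2norm_ge0 _) l1 l2) _.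
  by rewrite mulrCA -expr2 sqr_sqrtr.
rewrite sqD !sqZ ipZl ipZr.
have -> : (1 - g * (1 - c)) ^+ 2 * sq A = (1 - g) ^+ 2 * sq A +
  2 * ((1 - g) * (g * (c * sq A))) + g ^+ 2 * (c ^+ 2 * sq A) by ring.
rewrite lerD ?ler_wpM2l ?sqr_ge0 // lerD ?ler_wpM2l ?sqr_ge0 //.
by rewrite subr_ge0.
Qed.

End Averaging.

(** * Smooth functions *)

Section Gradient.
Variables (R : realType) (d : nat).
Implicit Types (f : 'rV[R]_d -> R) (x h : 'rV[R]_d).

Lemma derive_grad f x h : differentiable f x -> 'D_h f x = ip (grad f x) h.
Proof.
move=> df; rewrite deriveE // {1}(row_sum_delta h) linear_sum /ip big_ord1.
apply: eq_bigr => j _.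
by rewrite linearZ /= -deriveE // mulrC mxE.
Qed.

(** The difference quotients of the restriction to the line at [t] are literally those of [f] at
    [x + t *: h] in direction [h]. *)
Lemma is_derive_line f x h (t : R) : differentiable f (x + t *: h) ->
  is_derive t 1 (fun u => f (x + u *: h)) (ip (grad f (x + t *: h)) h).
Proof.
move=> df; have /diff_derivable -/(_ h) dh := df.
have E : (fun s : R => s^-1 *: ((f \o shift (x + t *: h)) (s *: h)
                                 - f (x + t *: h))) =
         (fun s : R => s^-1 *: (((fun u => f (x + u *: h)) \o shift t) (s *: 1)
                                 - f (x + t *: h))).
  apply/funext => s /=; congr (_ *: (f _ - _)).
  have -> : s *: (1 : R) = s by rewrite /GRing.scale /= mulr1.
  by rewrite scalerDl addrCA.
split; first by rewrite /derivable -E.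
by rewrite -(derive_grad _ df) /derive -E.
Qed.

Lemma smooth_sq (L : R) f x y : 0 <= L -> smooth L f ->
  sq (grad f x - grad f y) <= L ^+ 2 * sq (x - y).
Proof.
move=> L0 [_ /(_ x y) h]; rewrite -!l2normE -exprMn.
by rewrite lerXn2r ?nnegrE ?mulr_ge0 ?l2norm_ge0.
Qed.

Lemma descent (L : R) f x h : 0 < L -> smooth L f ->
  f (x + h) <= f x + ip (grad f x) h + L / 2 * sq h.
Proof.
move=> L0 [df lip].
pose F := fun u : R => f (x + u *: h).
have dF (u : R) : is_derive u 1 F (ip (grad f (x + u *: h)) h).
  exact: is_derive_line.
(* After subtraction of the quadratic majorant the derivative is nonpositive on ]0, 1[, so the mean
   value theorem replaces the integral of the gradient along the segment. *)
pose G : R -> R := F - (fun u : R => u * ip (grad f x) h + u ^+ 2 * (L / 2 * sq h)).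
have dG (u : R) : is_derive u 1 G
    (ip (grad f (x + u *: h)) h - (ip (grad f x) h + 2 * u * (L / 2 * sq h))).
  apply: is_deriveB.
  apply: is_derive_eq; rewrite /GRing.scale /=; ring.
have [|c] := @MVT _ G _ 0 1 ltr01 (fun u _ => dG u).
  by apply: derivable_within_continuous => u _; exact: ex_derive.
rewrite in_itv /= => /andP[c0 c1]; rewrite subr0 mulr1 => GE.
have : G 1 - G 0 <= 0.
  rewrite GE subr_le0 -lerBlDl -ipBl.
  apply: le_trans (ip_le_l2norm _ _) _.
  apply: le_trans (ler_wpM2r (l2norm_ge0 _) (lip _ _)) _.
  have -> : x + c *: h - x = c *: h by rewrite addrC addKr.
  have -> : l2norm (c *: h) = c * l2norm h.
    apply/eqP; rewrite -(@eqrXn2 _ 2) ?mulr_ge0 ?l2norm_ge0 ?(ltW c0) //.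
    by rewrite l2normE sqZ exprMn l2normE.
  by rewrite -l2normE; lra.
rewrite /G !fctE /F scale1r scale0r addr0 expr1n expr0n /=.
by lra.
Qed.

End Gradient.

(** * Averages of vectors and the average objective *)

Section Average.
Variables (R : realType) (n d : nat) (n_gt0 : (0 < n)%N).
Implicit Types v : 'I_n -> 'rV[R]_d.
Local Notation J := (const_mx n%:R^-1 : 'M[R]_n).

Lemma stack_average v : stack (fun=> average v) = J *m stack v.
Proof.
apply/matrixP => i j; rewrite avg_mulE !mxE summxE.
by congr (_ * _); apply: eq_bigr => k _; rewrite mxE.
Qed.

Lemma stack_center v :
  stack (fun i => v i - average v) = (1%:M - J) *m stack v.
Proof.
by rewrite mulmxBl mul1mx -stack_average; apply/matrixP => i j; rewrite !mxE.
Qed.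

Lemma sq_stack v : sq (stack v) = \sum_(i < n) sq (v i).
Proof.
rewrite sqE; apply: eq_bigr => i _; rewrite sqE big_ord1.
by apply: eq_bigr => j _; rewrite mxE.
Qed.

Lemma sq_average_le v : sq (average v) <= n%:R^-1 * sq (stack v).
Proof.
have := sq_avg_mul_le n_gt0 (stack v).
rewrite -stack_average sq_stack sumr_const card_ord -[leLHS]mulr_natl.
by rewrite -ler_pdivlMl // ltr0n.
Qed.

Lemma averageB v w : average (fun i => v i - w i) = average v - average w.
Proof. by rewrite /average sumrB scalerBr. Qed.

Variables (fi : 'I_n -> 'rV[R]_d -> R) (f : 'rV[R]_d -> R) (L : R).
Hypotheses (L_gt0 : 0 < L) (fi_smooth : forall i, smooth L (fi i))
  (fE : forall x, f x = n%:R^-1 * \sum_(i < n) fi i x).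

Let fEfun : f = n%:R^-1 *: \sum_(i < n) fi i.
Proof. by apply/funext => x; rewrite fE !fctE fct_sumE. Qed.

Lemma differentiable_mean x : differentiable f x.
Proof.
rewrite fEfun; apply: differentiableZ; apply: differentiable_sum => i.
by case: (fi_smooth i).
Qed.

Lemma grad_mean x : grad f x = average (fun i => grad (fi i) x).
Proof.
apply/rowP => j; rewrite !mxE summxE fEfun.
have dfi i : derivable (fi i) x (delta_mx 0 j).
  by apply: diff_derivable; case: (fi_smooth i).
rewrite deriveZ; last exact: derivable_sum.
rewrite derive_sum //; congr (_ * _).
by apply: eq_bigr => i _; rewrite mxE.
Qed.

Lemma smooth_mean : smooth L f.
Proof.
split=> [x|x y]; first exact: differentiable_mean.
rewrite -(ler_pXn2r (n:=2)) ?nnegrE ?mulr_ge0 ?l2norm_ge0 ?(ltW L_gt0) //.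
rewrite exprMn !l2normE !grad_mean -averageB.
apply: le_trans (sq_average_le _) _.
rewrite ler_pdivrMl ?ltr0n // sq_stack.
have -> : n%:R = \sum_(i < n) 1 :> R by rewrite sumr_const card_ord.
rewrite mulr_suml; apply: ler_sum => i _; rewrite mul1r.
exact: smooth_sq (ltW L_gt0) _.
Qed.

(** Averaging costs at most a factor 1/n on the stacked square; each local gradient is then compared
    at [xs i] and at the average. *)
Lemma sq_grad_mean_le (xs : 'I_n -> 'rV[R]_d) :
  sq (grad f (average xs) - average (fun i => grad (fi i) (xs i))) <=
  L ^+ 2 / n%:R * sq ((1%:M - J) *m stack xs).
Proof.
rewrite grad_mean -averageB; apply: le_trans (sq_average_le _) _.
rewrite -stack_center (mulrC (L ^+ 2)) -mulrA ler_wpM2l ?invr_ge0 ?ler0n //.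
rewrite !sq_stack mulr_sumr; apply: ler_sum => i _.
by rewrite [in leRHS]sqBC; exact: smooth_sq (ltW L_gt0) _.
Qed.

End Average.

(** * Pathwise inequalities for one iteration *)

Section OneStep.
Variables (R : realType) (n d : nat) (n_gt0 : (0 < n)%N) (W : 'M[R]_n).
Hypotheses (symW : W^T = W) (dsW : doubly_stochastic W).
Local Notation J := (const_mx n%:R^-1 : 'M[R]_n).
Local Notation rho := (1 - spectral_radius (W - J)).
Variable gamma : R.
Hypotheses (gamma_gt0 : 0 < gamma) (gamma_lt1 : gamma < 1)
  (rho_gt0 : 0 < rho).
Implicit Types (U N E B V Q Y : 'M[R]_(n, d)).

Lemma spectral_gap_le1 : rho <= 1.
Proof. by rewrite gerBl spectral_radius_ge0. Qed.

Lemma gamma_rho_lt1 : gamma * rho < 1.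
Proof. by apply: le_lt_trans gamma_lt1; rewrite ger_pMr // spectral_gap_le1. Qed.

Let gr_gt0 : 0 < gamma * rho. Proof. by rewrite mulr_gt0. Qed.

Let gamma01 : 0 <= gamma <= 1. Proof. by rewrite !ltW. Qed.

Lemma laplacian_center U : (W - 1%:M) *m U = (W - 1%:M) *m ((1%:M - J) *m U).
Proof.
have LJ0 : (W - 1%:M) *m J = 0.
  by rewrite mulmxBl mul1mx (mulW_avg symW dsW) subrr.
by rewrite mulmxA mulmxBr mulmx1 LJ0 subr0.
Qed.

Lemma sq_scaled_laplacian_le c E :
  sq (c *: ((W - 1%:M) *m E)) <= 4 * c ^+ 2 * sq E.
Proof.
have := sq_laplacian_le dsW E; have := sqr_ge0 c; rewrite sqZ.
by move: (c ^+ 2) => c2; nra.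
Qed.

(** [U] is the iterate, [N] the fresh noise, [E] the quantization error and [B] the remaining drift.
    Iterate and noise pass through the same mixing matrix, so their inner product is kept until its
    mean vanishes. [E] and [B] are split off with weights 1 - gamma rho and gamma rho. *)
Lemma consensus_step U N E B :
  sq ((1%:M - J) *m (U + N + gamma *: ((W - 1%:M) *m (U + N + E)) + B)) <=
  (1 - gamma * rho) *
    (sq ((1%:M - J) *m U) + 2 * ip ((1%:M - J) *m U) N + sq N) +
  2 / (gamma * rho) * (4 * gamma ^+ 2 * sq E + sq ((1%:M - J) *m B)).
Proof.
have grlt := gamma_rho_lt1.
pose M := 1%:M + gamma *: (W - 1%:M) - J.
have JW : (1%:M - J) *m (W - 1%:M) = W - 1%:M.
  by rewrite mulmxBl mul1mx mulmxBr mulmx1 (avg_mulW dsW) subrr subr0.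
have JM : (1%:M - J) *m (1%:M + gamma *: (W - 1%:M)) = M.
  by rewrite mulmxDr mulmx1 -scalemxAr JW addrAC.
have MJ0 : M *m J = 0.
  rewrite mulmxBl mulmxDl mul1mx -scalemxAl mulmxBl mul1mx.
  by rewrite (mulW_avg symW dsW) subrr scaler0 addr0 (avg_idem _ n_gt0) subrr.
have MU : M *m U = M *m ((1%:M - J) *m U).
  by rewrite mulmxA mulmxBr mulmx1 MJ0 subr0.
have -> : (1%:M - J) *m (U + N + gamma *: ((W - 1%:M) *m (U + N + E)) + B) =
   M *m ((1%:M - J) *m U + N) +
   (gamma *: ((W - 1%:M) *m E) + (1%:M - J) *m B).
  have -> : U + N + gamma *: ((W - 1%:M) *m (U + N + E)) =
      (1%:M + gamma *: (W - 1%:M)) *m (U + N) + gamma *: ((W - 1%:M) *m E).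
    by rewrite (mulmxDr (W - 1%:M)) scalerDr addrA mulmxDl mul1mx -scalemxAl.
  rewrite !(mulmxDr (1%:M - J)) mulmxA JM -scalemxAr mulmxA JW.
  by rewrite (mulmxDr M ((1%:M - J) *m U)) -MU -mulmxDr addrA.
have lh0 : 0 < 1 - gamma * rho by rewrite subr_gt0.
apply: le_trans (sq_convex _ _ lh0 gr_gt0 (subrK _ _)) _.
apply: lerD.
  rewrite ler_pdivrMr //; have := sq_mixing_le n_gt0 symW
    ((1%:M - J) *m U + N) gamma01; rewrite -/M => /le_trans; apply.
  by rewrite sqD [leRHS]mulrAC -expr2.
rewrite mulrAC ler_pM2r ?invr_gt0 //; apply: le_trans (sqD2_le _ _) _.
by rewrite ler_pM2l // lerD2r sq_scaled_laplacian_le.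
Qed.

(** A convex combination of [N] and [W *m N]. Grouping the noise this way keeps its coefficient in
    the increment free of gamma. *)
Lemma sq_lazy_le N : sq (N + gamma *: ((W - 1%:M) *m N)) <= sq N.
Proof.
have -> : N + gamma *: ((W - 1%:M) *m N) = (1 - gamma) *: N + gamma *: (W *m N).
  by rewrite mulmxBl mul1mx scalerBr scalerBl scale1r addrA addrAC.
have g0 : 0 < 1 - gamma by rewrite subr_gt0.
apply: le_trans (sq_convex _ _ g0 gamma_gt0 (subrK _ _)) _.
rewrite !sqZ; have := sq_stochastic_le dsW N.
move: (sq (W *m N)) (sq N) => b a ba.
have -> : (1 - gamma) ^+ 2 * a / (1 - gamma) + gamma ^+ 2 * b / gamma =
  (1 - gamma) * a + gamma * b by field; rewrite !gt_eqF.
by rewrite -lerBrDl mulrBl mul1r opprB addrC subrK ler_pM2l.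
Qed.

(** The [J] part of [U] is invisible to the gossip. [Y] is split into disagreement and average
    because the two are paid for differently: the first by its own recursion, the second by the
    descent of the objective. *)
Lemma increment_le eta U N E Y :
  sq (N + gamma *: ((W - 1%:M) *m (U + N + E)) - eta *: Y) <=
  5 * (sq N + 4 * gamma ^+ 2 * sq ((1%:M - J) *m U) + 4 * gamma ^+ 2 * sq E
       + eta ^+ 2 * sq ((1%:M - J) *m Y) + eta ^+ 2 * sq (J *m Y)).
Proof.
have -> : N + gamma *: ((W - 1%:M) *m (U + N + E)) - eta *: Y =
  (N + gamma *: ((W - 1%:M) *m N)) + gamma *: ((W - 1%:M) *m ((1%:M - J) *m U))
  + gamma *: ((W - 1%:M) *m E) + (- eta) *: ((1%:M - J) *m Y)
  + (- eta) *: (J *m Y).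
  rewrite -laplacian_center !mulmxDr (mulmxBl 1%:M J Y) (mul1mx Y).
  move: (_ *m U) (_ *m N) (_ *m E) (_ *m Y) => a b c y.
  by apply/matrixP => i j; rewrite !mxE; ring.
apply: le_trans (sqD5_le _ _ _ _ _) _; rewrite ler_pM2l //.
rewrite (sqZ (- eta)) (sqZ (- eta)) sqrrN.
by rewrite !lerD ?sq_lazy_le ?sq_scaled_laplacian_le.
Qed.

(** The bounded vector is [U + N] minus the next iterate, the motion of the target followed by the
    reference. The noisy iterate cancels, so all that remains, noise included, carries a factor
    gamma or eta. *)
Lemma drift_x_le eta U N E Y :
  sq (- (gamma *: ((W - 1%:M) *m (U + N + E))) + eta *: Y) <=
  5 * (4 * gamma ^+ 2 * (sq ((1%:M - J) *m U) + sq N + sq E)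
       + eta ^+ 2 * (sq ((1%:M - J) *m Y) + sq (J *m Y))).
Proof.
have -> : - (gamma *: ((W - 1%:M) *m (U + N + E))) + eta *: Y =
  (- gamma) *: ((W - 1%:M) *m ((1%:M - J) *m U))
  + (- gamma) *: ((W - 1%:M) *m N)
  + (- gamma) *: ((W - 1%:M) *m E) + eta *: ((1%:M - J) *m Y)
  + eta *: (J *m Y).
  rewrite -laplacian_center !mulmxDr (mulmxBl 1%:M J Y) (mul1mx Y).
  move: (_ *m U) (_ *m N) (_ *m E) (_ *m Y) => a b c y.
  by apply/matrixP => i j; rewrite !mxE; ring.
apply: le_trans (sqD5_le _ _ _ _ _) _; rewrite ler_pM2l //.
rewrite (sqZ eta) (sqZ eta) -(sqrrN gamma) !mulrDr !addrA.
by rewrite !lerD ?sq_scaled_laplacian_le.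
Qed.

Lemma drift_y_le U N E G :
  sq (- (gamma *: ((W - 1%:M) *m (U + N + E))) - G) <=
  4 * (4 * gamma ^+ 2 * (sq ((1%:M - J) *m U) + sq N + sq E) + sq G).
Proof.
have -> : - (gamma *: ((W - 1%:M) *m (U + N + E))) - G =
  (- gamma) *: ((W - 1%:M) *m ((1%:M - J) *m U))
  + (- gamma) *: ((W - 1%:M) *m N)
  + (- gamma) *: ((W - 1%:M) *m E) + (- G).
  rewrite -laplacian_center !mulmxDr !scalerDr !scaleNr.
  by rewrite !opprD.
apply: le_trans (sqD4_le _ _ _ _) _; rewrite ler_pM2l //.
rewrite sqN -(sqrrN gamma) !mulrDr ?addrA.
by rewrite !lerD ?sq_scaled_laplacian_le.
Qed.

End OneStep.

(** * One compressed transmission *)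

Section CompressionStep.
Variables (R : realType) (n d : nat) (r : R).
Hypothesis r_gt0 : 0 < r.
Implicit Types (V Q B : 'M[R]_(n, d)).

(** Writing [Q - V] as [r *: (r^-1 *: Q - V) + (r - 1) *: V] produces, after the compressor bound,
    the constant r0. *)
Lemma compression_error_le V Q :
  sq (Q - V) <= 2 * r ^+ 2 * sq (r^-1 *: Q - V) + 2 * (1 - r) ^+ 2 * sq V.
Proof.
have -> : Q - V = r *: (r^-1 *: Q - V) + (r - 1) *: V.
  by rewrite scalerBr scalerA divff ?gt_eqF // scale1r scalerBl scale1r addrA subrK.
apply: le_trans (sqD2_le _ _) _; rewrite !sqZ -(opprB r 1) sqrrN.
by rewrite mulrDr !mulrA.
Qed.

(** [alpha *: Q - V] combines [- V] and the scaled compressor error with weights 1 - alpha r and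
    alpha r, to which convexity applies. The drift [B] is split off with p = 1 / (1 + t/2), for
    which 1/q = (2 + t)/t is at most 3/t. *)
Lemma compression_step alpha t V Q B :
  0 < alpha -> alpha * r < 1 -> 0 < t <= 1 ->
  sq (alpha *: Q - V + B) <=
  (1 + t / 2) * ((1 - alpha * r) * sq V + alpha * r * sq (r^-1 *: Q - V))
  + 3 / t * sq B.
Proof.
move=> a0 ar1 /andP[t0 t1]; have ar0 : 0 < alpha * r by rewrite mulr_gt0.
have h : sq (alpha *: Q - V) <=
    (1 - alpha * r) * sq V + alpha * r * sq (r^-1 *: Q - V).
  have -> : alpha *: Q - V =
     (- (1 - alpha * r)) *: V + (alpha * r) *: (r^-1 *: Q - V).
    by apply/matrixP => i j; rewrite !mxE; field; rewrite gt_eqF.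
  have lar0 : 0 < 1 - alpha * r by rewrite subr_gt0.
  apply: le_trans (sq_convex _ _ lar0 ar0 (subrK _ _)) _.
  rewrite !sqZ sqrrN le_eqVlt; apply/orP; left; apply/eqP.
  by field; rewrite (gt_eqF a0) (gt_eqF r_gt0) gt_eqF.
have p0 : 0 < (1 + t / 2)^-1 by rewrite invr_gt0; lra.
have q0 : 0 < t / 2 / (1 + t / 2) by rewrite !divr_gt0 //; lra.
have pq : (1 + t / 2)^-1 + t / 2 / (1 + t / 2) = 1.
  by field; rewrite gt_eqF //; lra.
apply: le_trans (sq_convex _ _ p0 q0 pq) _; rewrite invrK; apply: lerD.
  by rewrite mulrC ler_pM2l //; lra.
rewrite mulrC ler_wpM2r ?sq_ge0 //.
have -> : (t / 2 / (1 + t / 2))^-1 = (2 + t) / t.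
  by field; rewrite !gt_eqF //; lra.
by rewrite ler_pM2r ?invr_gt0 //; lra.
Qed.

End CompressionStep.

(** * Descent of the objective under a perturbed gradient *)

Section DescentStep.
Variables (R : realType) (d : nat) (f : 'rV[R]_d -> R) (L nu fstar : R).
Hypotheses (L_gt0 : 0 < L) (f_smooth : smooth L f)
  (PL : forall x, 2^-1 * l2norm (grad f x) ^+ 2 >= nu * (f x - fstar)).

(** Polarization expresses the inner product of gradient and [y] through [sq (g - y)]; the resulting
    [- sq g] is what the Polyak-Lojasiewicz inequality consumes. With [b] the mean of the local
    gradients, [g - b] is a consensus error and [y - b] the accumulated noise. The part linear in
    [xi] is isolated because its mean will vanish. *)
Lemma descent_step eta (x y b xi : 'rV[R]_d) : 0 < eta ->
  f (x + xi - eta *: y) - fstar <=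
  (1 - eta * nu) * (f x - fstar) - eta / 2 * (1 - L * eta) * sq y
  + eta * sq (grad f x - b) + eta * sq (y - b)
  + ip (grad f x - (L * eta) *: y) xi + L / 2 * sq xi.
Proof.
move=> eta0; set g := grad f x.
have hPL : nu * (f x - fstar) <= 2^-1 * sq g by rewrite -l2normE; exact: PL.
have h1 : f (x + xi - eta *: y) <= f x + ip g (xi - eta *: y)
    + L / 2 * sq (xi - eta *: y) by rewrite -addrA; exact: descent.
have h2 : sq (g - y) <= 2 * (sq (g - b) + sq (y - b)).
  have -> : g - y = (g - b) + (b - y) by rewrite addrA subrK.
  by rewrite (sqBC y); exact: sqD2_le.
move: h1; rewrite ipBr ipZr (sqB xi) ipZr sqZ => h1.
move: h2; rewrite (sqB g y) => h2.
rewrite ipBl ipZl (ipC y).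
have h3 : eta * (sq g - 2 * ip g y + sq y) <=
  eta * (2 * (sq (g - b) + sq (y - b))) by rewrite ler_pM2l.
have h4 : eta * (nu * (f x - fstar)) <= eta * (2^-1 * sq g) by rewrite ler_pM2l.
by lra.
Qed.

End DescentStep.

(** * The iteration in matrix form *)

Section MatrixForm.
Variables (R : realType) (n d : nat) (W : 'M[R]_n)
  (fi : 'I_n -> 'rV[R]_d -> R) (eta gamma alpha_x alpha_y : R)
  (nx ny : 'I_n -> 'rV[R]_d) (Cx Cy : 'I_n -> 'rV[R]_d -> 'rV[R]_d)
  (s : pgtc_state R n d).
Hypothesis (dsW : doubly_stochastic W).
Let s' := pgtc_step W fi eta gamma alpha_x alpha_y nx ny Cx Cy s.
Local Notation gradF x := (stack (fun i => grad (fi i) (x i))).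

Definition gap_x i := st_x s i + nx i - st_xc s i.
Definition gap_y i := st_y s i + ny i - st_yc s i.

Lemma stackD (u v : 'I_n -> 'rV[R]_d) :
  stack (fun i => u i + v i) = stack u + stack v.
Proof. by apply/matrixP => i j; rewrite !mxE. Qed.

Lemma stackN (u : 'I_n -> 'rV[R]_d) : stack (fun i => - u i) = - stack u.
Proof. by apply/matrixP => i j; rewrite !mxE. Qed.

Lemma stackZ (c : R) (u : 'I_n -> 'rV[R]_d) :
  stack (fun i => c *: u i) = c *: stack u.
Proof. by apply/matrixP => i j; rewrite !mxE. Qed.

Lemma stack_gossip (u : 'I_n -> 'rV[R]_d) :
  stack (fun i => \sum_(j < n) W i j *: (u j - u i)) = (W - 1%:M) *m stack u.
Proof.
case: dsW => _ r1 _; rewrite mulmxBl mul1mx; apply/matrixP => i j.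
rewrite !mxE summxE; under eq_bigr do rewrite !mxE mulrBr.
rewrite sumrB -mulr_suml r1 mul1r; congr (_ - _).
by apply: eq_bigr => k _; rewrite mxE.
Qed.

Lemma stack_x_step : stack (st_x s') =
  stack (st_x s) + stack nx
  + gamma *: ((W - 1%:M) *m
      (stack (st_xc s) + stack (fun i => Cx i (gap_x i))))
  - eta *: stack (st_y s).
Proof. by rewrite !stackD stackN !stackZ stack_gossip stackD. Qed.

Lemma stack_y_step : stack (st_y s') =
  stack (st_y s) + stack ny
  + gamma *: ((W - 1%:M) *m
      (stack (st_yc s) + stack (fun i => Cy i (gap_y i))))
  + (gradF (st_x s') - gradF (st_x s)).
Proof. by rewrite addrA !stackD stackN stackZ stack_gossip stackD. Qed.

Lemma stack_xc_step : stack (st_xc s') =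
  stack (st_xc s) + alpha_x *: stack (fun i => Cx i (gap_x i)).
Proof.
rewrite !stackD !stackZ stackD scalerDr addrA -scalerDl subrK scale1r.
by [].
Qed.

Lemma stack_yc_step : stack (st_yc s') =
  stack (st_yc s) + alpha_y *: stack (fun i => Cy i (gap_y i)).
Proof.
rewrite !stackD !stackZ stackD scalerDr addrA -scalerDl subrK scale1r.
by [].
Qed.

Lemma averageE_stack (u : 'I_n -> 'rV[R]_d) :
  average u = const_mx n%:R^-1 *m stack u.
Proof.
apply/rowP => j; rewrite !mxE summxE mulr_sumr.
by apply: eq_bigr => k _; rewrite !mxE.
Qed.

End MatrixForm.

(** * Independence and integration *)

Section Independence.
Context (disp : measure_display) (T : measurableType disp) (R : realType)
  (P : probability T R) (I : eqType) (F : I -> set (set T)).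
Hypotheses (FT : forall a, F a setT) (FI : forall a, setI_closed (F a))
  (Fm : forall a, F a `<=` measurable).

Definition others (a : I) : set (set T) := \bigcup_(b in [set b | b != a]) F b.

(** Finite cylinders over the sources other than [a]. The family [E] is total, equal to the whole
    space outside [J], so that cylinders with different [J] are intersected pointwise. *)
Let cyl (a : I) : set (set T) := [set A | exists J (E : I -> set T),
  [/\ uniq J, a \notin J, forall b, F b (E b),
      forall b, b \notin J -> E b = setT & A = \bigcap_(b in [set: I]) E b]].

Let cylE (J : seq I) (E : I -> set T) :
  (forall b, b \notin J -> E b = setT) ->
  \bigcap_(b in [set: I]) E b = \bigcap_(b in [set` J]) E b.
Proof.
move=> EJ; rewrite eqEsubset; split=> w h b bJ; first exact: h.
by have [bJ'|bJ'] := boolP (b \in J); [exact: h|rewrite EJ].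
Qed.

(** As functions of [A], both sides are finite measures: the restriction of [P] to [B], and [P]
    scaled by [P B]. They agree on finite cylinders, which are closed under intersection and whose
    sigma-algebra contains [others a]. *)
Lemma independent_others (a : I) (A B : set T) :
  mutually_independent P F -> <<s others a >> A -> F a B ->
  P (A `&` B) = (P A * P B)%E.
Proof.
move=> ind sA FB; have mB := Fm FB.
have cylm : cyl a `<=` measurable.
  move=> _ [J [E [_ _ FE EJ ->]]]; rewrite (cylE EJ).
  by apply: fin_bigcap_measurable => // b _; exact: Fm (FE b).
have PB0 : 0 <= fine (P B) by exact: fine_ge0.
pose m1 : {measure set T -> \bar R} := mrestr P mB.
pose m2 : {measure set T -> \bar R} := mscale (NngNum PB0) P.
suff : m1 A = m2 A.
  rewrite /m1 /m2 /= /mrestr /mscale /= => ->.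
  by rewrite fineK ?fin_num_measure // muleC.
apply: (g_sigma_algebra_measure_unique (cyl a) cylm (fun=> setT)).
- move=> _; exists [::], (fun=> setT); split => //.
  by rewrite bigcapT.
- by rewrite bigcup_const //; exists 0%N.
- move=> _ _ [J1 [E1 [u1 n1 F1 T1 ->]]] [J2 [E2 [u2 n2 F2 T2 ->]]].
  exists (undup (J1 ++ J2)), (fun b => E1 b `&` E2 b); split.
  + exact: undup_uniq.
  + by rewrite mem_undup mem_cat negb_or n1.
  + by move=> b; exact: FI.
  + move=> b; rewrite mem_undup mem_cat negb_or => /andP[b1 b2].
    by rewrite T1 // T2 // setIT.
  + by rewrite bigcapI.
- move=> _ [J [E [uJ nJ FE EJ ->]]].
  (* [E'] inserts [B] at the coordinate [a], which is not in [J]; independence over [a :: J] and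
     over [J] then gives the product. *)
  pose E' b := if b == a then B else E b.
  have EE' : {in J, E =1 E'}.
    by move=> b bJ; rewrite /E'; case: eqP => // ba; rewrite -ba bJ in nJ.
  rewrite /m1 /m2 /= /mrestr /mscale /= fineK ?fin_num_measure //.
  rewrite (cylE EJ).
  have -> : \bigcap_(b in [set` J]) E b = \bigcap_(b in [set` J]) E' b.
    by apply: eq_bigcapr => b bJ; exact: EE'.
  have consE : \bigcap_(b in [set` a :: J]) E' b =
      B `&` \bigcap_(b in [set` J]) E' b.
    rewrite eqEsubset; split=> [w h|w [wB h] b /=].
      split; first by have := h a; rewrite /= mem_head /E' eqxx; exact.
      by move=> b bJ; apply: h; rewrite /= inE bJ orbT.
    by rewrite inE => /predU1P[->|bJ]; [rewrite /E' eqxx|exact: h].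
  have E'a : E' a = B by rewrite /E' eqxx.
  have := ind (a :: J) E'; rewrite consE big_cons E'a setIC => ->.
  + by rewrite -(ind J E') // => b bJ; rewrite -EE'.
  + by rewrite /= nJ.
  + by move=> b _; rewrite /E'; case: eqP => [->//|_].
- move=> k; rewrite /m1 /= /mrestr /= setTI.
  by rewrite -ge0_fin_numE // fin_num_measure.
- move: A sA; apply: sub_sigma_algebra2.
  move=> X [b /= ba FX]; exists [:: b], (fun c => if c == b then X else setT).
  split => //.
  + by rewrite inE eq_sym.
  + by move=> c; case: eqP => [->|].
  + by move=> c; rewrite inE => /negbTE ->.
  + rewrite eqEsubset; split=> [w Xw c _|w /(_ b Logic.I)]; last by rewrite eqxx.
    by case: eqP.
Qed.

End Independence.

Section Freezing.
Context (disp dU dV : measure_display) (T : measurableType disp)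
  (U : measurableType dU) (V : measurableType dV) (R : realType)
  (P : probability T R) (Q : probability V R).

(** This takes the place of conditioning on [X]. The hypothesis on rectangles says that [Z] has law
    [Q] and is independent of [X], so the pair has the product law and Tonelli applies. Since [h] is
    nonnegative, no integrability has to be known beforehand. *)
Lemma integral_frozen (X : {mfun T >-> U}) (Z : {mfun T >-> V})
    (h : U * V -> \bar R) :
  measurable_fun setT h -> (forall u, 0 <= h u)%E ->
  (forall A B, measurable A -> measurable B ->
     P (X @^-1` A `&` Z @^-1` B) = P (X @^-1` A) * Q B)%E ->
  (\int[P]_w h (X w, Z w) = \int[P]_w \int[Q]_z h (X w, z))%E.
Proof.
move=> mh h0 ind.
have mXZ : measurable_fun setT (fun w => (X w, Z w)).
  by apply: measurable_fun_pair; exact: measurable_funP.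
pose XZ : {mfun T >-> (U * V)%type} :=
  HB.pack (fun w => (X w, Z w)) (isMeasurableFun.Build _ _ _ _ _ mXZ).
have -> : (\int[P]_w h (X w, Z w) = \int[distribution P XZ]_u h u)%E.
  by rewrite ge0_integral_distribution.
have -> : (\int[distribution P XZ]_u h u
           = \int[distribution P X \x Q]_u h u)%E.
  apply: eq_measure_integral => A mA _; apply/esym.
  by apply: product_measure_unique.
rewrite fubini_tonelli1 // ge0_integral_distribution //.
- exact: measurable_fun_fubini_tonelli_F.
- by move=> u; exact: integral_ge0.
Qed.

End Freezing.

(** * Integration against a density; reflection of Lebesgue measure *)

Section Density.
Context (R : realType).
Local Notation mu := (@lebesgue_measure R).
Local Notation TR := (measurableTypeR R).
Import HBNNSimple.

(** A Laplace variable is specified by its law on sets; this passes to moments through indicators,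
    simple functions and monotone limits. *)
Lemma ge0_integral_density (Q : {measure set TR -> \bar R})
    (p : TR -> R) (g : TR -> \bar R) :
  measurable_fun setT p -> (forall x, 0 <= p x) ->
  (forall A, measurable A -> Q A = \int[mu]_(x in A) (p x)%:E)%E ->
  measurable_fun setT g -> (forall x, 0 <= g x)%E ->
  (\int[Q]_x g x = \int[mu]_x (g x * (p x)%:E))%E.
Proof.
move=> mp p0 Qp mg g0.
have mpE : measurable_fun setT (EFin \o p) by exact/measurable_EFinP.
have indic A : measurable A ->
    (\int[Q]_x (\1_A x)%:E = \int[mu]_x ((\1_A x)%:E * (p x)%:E))%E.
  move=> mA; rewrite integral_indic // setIT Qp // integral_mkcond.
  apply: eq_integral => x _; rewrite patchE indicE.
  by case: ifP; rewrite ?mul1e ?mul0e.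
have nnsf (f : {nnsfun TR >-> R}) :
    (\int[Q]_x (f x)%:E = \int[mu]_x ((f x)%:E * (p x)%:E))%E.
  under [LHS]eq_integral do rewrite fimfunE -fsumEFin//.
  rewrite [LHS]ge0_integral_fsum//; last 2 first.
    - by move=> r; exact/measurable_EFinP/measurableT_comp.
    - by move=> n x _; rewrite EFinM nnfun_muleindic_ge0.
  under [RHS]eq_integral.
    move=> x _; rewrite fimfunE -fsumEFin // ge0_mule_fsuml; last first.
      by move=> r; rewrite EFinM nnfun_muleindic_ge0.
    over.
  have mi r : measurable_fun setT
      (fun x : TR => (r * \1_(f @^-1` [set r]) x)%:E).
    exact/measurable_EFinP/measurableT_comp.
  rewrite [RHS]ge0_integral_fsum//; last 2 first.
    - by move=> r; apply: emeasurable_funM.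
    - move=> n x _; apply: mule_ge0; last by rewrite lee_fin.
      by rewrite EFinM nnfun_muleindic_ge0.
  apply: eq_fsbigr => r /set_mem [x _ frx].
  under [LHS]eq_integral do rewrite EFinM.
  under [RHS]eq_integral do rewrite EFinM -muleA.
  have r0 : 0 <= r by rewrite -frx.
  rewrite integralZl_indic_nnsfun // indic // -ge0_integralZl //.
  - apply: emeasurable_funM => //; exact/measurable_EFinP.
  - by move=> y _; rewrite mule_ge0 // lee_fin.
pose f_ := nnsfun_approx measurableT mg.
transitivity (lim (\int[Q]_x (f_ n x)%:E @[n --> \oo])%E).
  rewrite -monotone_convergence//=.
  - apply: eq_integral => ? /[!inE] xD; apply/esym/cvg_lim => //=.
    exact: cvg_nnsfun_approx.
  - by move=> n; exact/measurable_EFinP/measurable_funTS.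
  - by move=> n ? _; rewrite lee_fin.
  - by move=> ? _ ? ? mn; rewrite lee_fin; exact/lefP/nd_nnsfun_approx.
transitivity (lim (\int[mu]_x ((f_ n x)%:E * (p x)%:E) @[n --> \oo])%E).
  by apply: congr_lim; apply/funext => n; exact: nnsf.
rewrite -monotone_convergence//=.
- apply: eq_integral => x _; apply/cvg_lim => //=.
  by apply: cvgeZr => //; exact: cvg_nnsfun_approx.
- by move=> n; apply: emeasurable_funM => //; exact/measurable_EFinP.
- by move=> n x _; rewrite mule_ge0 // lee_fin.
- move=> x _ a b ab; rewrite lee_wpmul2r ?lee_fin //.
  exact/lefP/nd_nnsfun_approx.
Qed.

(** By uniqueness it is enough to consider intervals []a, b]]; reflection moves the closed end but
    keeps the length. *)
Lemma lebesgue_measure_opp (A : set TR) : measurable A ->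
  mu A = mu (-%R @^-1` A).
Proof.
have mN : measurable_fun setT (-%R : TR -> TR) by exact: oppr_measurable.
move=> mA; apply: (@lebesgue_measure_unique _ (pushforward mu (-%R : TR -> TR))) => //.
move=> _ [[a b] _ <-] /=.
have -> : (lebesgue_measure `]a, b] = wlength idfun `]a, b]%classic).
  by rewrite lebesgue_measure_itv /= wlength_itv.
rewrite /pushforward opp_preimage_itvbndbnd /= lebesgue_measure_itv /= wlength_itv /=.
rewrite !lte_fin ltrN2; case: ifP => // _.
by rewrite opprK addrC.
Qed.

Lemma integral_even_opp (p : TR -> R) (A : set TR) :
  measurable_fun setT p -> (forall x, 0 <= p x) -> (forall x, p (- x) = p x) ->
  measurable A ->
  (\int[mu]_(x in A) (p x)%:E = \int[mu]_(x in -%R @^-1` A) (p x)%:E)%E.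
Proof.
move=> mp p0 pN mA.
have mN : measurable_fun setT (-%R : TR -> TR) by exact: oppr_measurable.
rewrite (@eq_measure_integral _ _ _ _ (pushforward mu (-%R : TR -> TR))).
  rewrite ge0_integral_pushforward //.
  - by apply: eq_integral => x _ /=; rewrite pN.
  - exact/measurable_EFinP/measurable_funTS.
  - by move=> x _; rewrite lee_fin.
by move=> B mB _; exact: lebesgue_measure_opp.
Qed.

End Density.

(** * Integrable and square-integrable random variables *)

Section Moments.
Context (disp : measure_display) (T : measurableType disp) (R : realType)
  (P : probability T R).
Implicit Types (X Y : T -> R) (c : R).

Definition L1 X : Prop := P.-integrable setT (EFin \o X).
(** Real-valued, so that the recursions are computed in [R]; for integrable variables [expectationE]
    leads back to the extended-real expectation. *)
Definition mean X : R := (\int[P]_w X w)%R.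
Definition L2 X : Prop := measurable_fun setT X /\ L1 (fun w => X w ^+ 2).

Lemma expectationE X : L1 X -> ('E_P[X] = (mean X)%:E)%E.
Proof. by move=> iX; rewrite unlock /mean /Rintegral fineK ?integrable_fin_num. Qed.

Lemma L1_measurable X : L1 X -> measurable_fun setT X.
Proof. by move=> /measurable_int/measurable_EFinP. Qed.

Lemma L1_le X Y : measurable_fun setT X -> L1 Y ->
  (forall w, `|X w| <= Y w) -> L1 X.
Proof.
move=> mX iY XY; apply: (le_integrable measurableT _ _ iY).
  exact/measurable_EFinP.
by move=> w _ /=; rewrite lee_fin (le_trans (XY w)) // ler_norm.
Qed.

Lemma L1_cst c : L1 (fun=> c).
Proof. exact: finite_measure_integrable_cst. Qed.

Lemma L1D X Y : L1 X -> L1 Y -> L1 (fun w => X w + Y w).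
Proof. by move=> iX iY; exact: (integrableD measurableT iX iY). Qed.

Lemma L1Z c X : L1 X -> L1 (fun w => c * X w).
Proof. by move=> iX; exact: (integrableZl measurableT c iX). Qed.

Lemma L1B X Y : L1 X -> L1 Y -> L1 (fun w => X w - Y w).
Proof. by move=> iX iY; exact: (integrableB measurableT iX iY). Qed.

Lemma L1_sum (I : Type) (r : seq I) (X : I -> T -> R) :
  (forall i, L1 (X i)) -> L1 (fun w => \sum_(i <- r) X i w).
Proof.
move=> iX; elim: r => [|i r IH].
  by under eq_fun do rewrite big_nil; exact: L1_cst.
by under eq_fun do rewrite big_cons; exact: L1D.
Qed.

Lemma meanD X Y : L1 X -> L1 Y ->
  mean (fun w => X w + Y w) = mean X + mean Y.
Proof. by move=> iX iY; rewrite /mean RintegralD. Qed.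

Lemma meanB X Y : L1 X -> L1 Y ->
  mean (fun w => X w - Y w) = mean X - mean Y.
Proof. by move=> iX iY; rewrite /mean RintegralB. Qed.

Lemma meanZ c X : L1 X -> mean (fun w => c * X w) = c * mean X.
Proof. by move=> iX; rewrite /mean RintegralZl. Qed.

Lemma mean_cst c : mean (fun=> c) = c.
Proof.
rewrite /mean Rintegral_cst // -[RHS]mulr1; congr (_ * _).
by transitivity (fine (1%E : \bar R)) => //; congr fine; exact: probability_setT.
Qed.

Lemma mean_sum (I : Type) (r : seq I) (X : I -> T -> R) :
  (forall i, L1 (X i)) ->
  mean (fun w => \sum_(i <- r) X i w) = \sum_(i <- r) mean (X i).
Proof.
move=> iX; elim: r => [|i r IH].
  by under eq_fun do rewrite big_nil; rewrite mean_cst big_nil.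
under eq_fun do rewrite big_cons.
by rewrite meanD ?big_cons ?IH //; exact: L1_sum.
Qed.

Lemma mean_le X Y : L1 X -> L1 Y -> (forall w, X w <= Y w) -> mean X <= mean Y.
Proof. by move=> iX iY XY; apply: le_Rintegral. Qed.

Lemma mean_ge0 X : (forall w, 0 <= X w) -> 0 <= mean X.
Proof. by move=> X0; apply: Rintegral_ge0. Qed.

Lemma L2_cst c : L2 (fun=> c).
Proof. by split; [exact: measurable_cst|exact: L1_cst]. Qed.

Lemma L2_le X Y : measurable_fun setT X -> L1 Y ->
  (forall w, X w ^+ 2 <= Y w) -> L2 X.
Proof.
move=> mX iY XY; split => //; apply: (L1_le _ iY).
  exact: measurable_funX.
by move=> w; rewrite ger0_norm ?sqr_ge0.
Qed.

Lemma L2D X Y : L2 X -> L2 Y -> L2 (fun w => X w + Y w).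
Proof.
move=> [mX iX] [mY iY].
apply: (L2_le _ (L1D (L1Z 2 iX) (L1Z 2 iY))); first exact: measurable_funD.
by move=> w; have := sqr_ge0 (X w - Y w); nra.
Qed.

Lemma L2Z c X : L2 X -> L2 (fun w => c * X w).
Proof.
move=> [mX iX]; apply: (L2_le _ (L1Z (c ^+ 2) iX)).
  exact: measurable_funM.
by move=> w; rewrite exprMn.
Qed.

Lemma L2N X : L2 X -> L2 (fun w => - X w).
Proof. by move=> /(L2Z (-1)); under eq_fun do rewrite mulN1r. Qed.

Lemma L2_sum (I : Type) (r : seq I) (X : I -> T -> R) :
  (forall i, L2 (X i)) -> L2 (fun w => \sum_(i <- r) X i w).
Proof.
move=> iX; elim: r => [|i r IH].
  by under eq_fun do rewrite big_nil; exact: L2_cst.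
by under eq_fun do rewrite big_cons; exact: L2D.
Qed.

Lemma L2M X Y : L2 X -> L2 Y -> L1 (fun w => X w * Y w).
Proof.
move=> [mX iX] [mY iY]; apply: (L1_le _ (L1D iX iY)).
  exact: measurable_funM.
move=> w; rewrite normrM -(real_normK (num_real (X w))).
rewrite -[in leRHS](real_normK (num_real (Y w))).
by have := sqr_ge0 (`|X w| - `|Y w|); have := normr_ge0 (X w);
  have := normr_ge0 (Y w); nra.
Qed.

(* Freezing [G] in [(G + X)^2] and [(G - X)^2] shows that these have the same
   mean, and their difference is [4 G X]. *)
Lemma mean_mul_symmetric (G X : T -> R) : L2 G -> L2 X ->
  (forall B, measurable B -> P (X @^-1` B) = P ((fun w => - X w) @^-1` B)) ->
  (forall A B, measurable A -> measurable B ->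
     P (G @^-1` A `&` X @^-1` B) = P (G @^-1` A) * P (X @^-1` B))%E ->
  mean (fun w => G w * X w) = 0.
Proof.
move=> G2 X2 sym ind; have [mG iG] := G2; have [mX iX] := X2.
have mNX : measurable_fun setT (fun w => - X w).
  exact: measurableT_comp.
pose GT : {mfun T >-> R} := HB.pack G (isMeasurableFun.Build _ _ _ _ _ mG).
pose XT : {mfun T >-> R} := HB.pack X (isMeasurableFun.Build _ _ _ _ _ mX).
pose NT : {mfun T >-> R} :=
  HB.pack (fun w => - X w) (isMeasurableFun.Build _ _ _ _ _ mNX).
pose h := fun u : R * R => ((u.1 + u.2) ^+ 2)%:E.
have mh : measurable_fun setT h.
  by apply/measurable_EFinP; apply: measurable_funX; exact: measurable_funD.
have h0 u : (0 <= h u)%E by rewrite lee_fin sqr_ge0.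
have fr1 : (\int[P]_w h (G w, X w) =
            \int[P]_w \int[distribution P XT]_z h (G w, z))%E.
  exact: (integral_frozen (Q := distribution P XT) (X := GT) (Z := XT)).
have fr2 : (\int[P]_w h (G w, - X w)%R =
            \int[P]_w \int[distribution P XT]_z h (G w, z))%E.
  apply: (integral_frozen (Q := distribution P XT) (X := GT) (Z := NT)) => //.
  move=> A B mA mB.
  have mNB : measurable (-%R @^-1` B : set R).
    by rewrite -[X in measurable X]setTI; exact: oppr_measurable.
  have E : (P (G @^-1` A `&` (fun w => (- X w)%R) @^-1` B) =
            P (G @^-1` A) * P (X @^-1` B))%E.
    by rewrite sym //; exact: ind mA mNB.
  exact: E.
have eqs : mean (fun w => (G w + X w) ^+ 2) = mean (fun w => (G w - X w) ^+ 2).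
  by rewrite /mean /Rintegral; congr fine; move: fr1 fr2 => /= -> ->.
have GX := L2M G2 X2.
have := eqs.
have -> : (fun w => (G w + X w) ^+ 2) =
          (fun w => (G w ^+ 2 + X w ^+ 2) + 2 * (G w * X w)).
  by apply/funext => w; ring.
have -> : (fun w => (G w - X w) ^+ 2) =
          (fun w => (G w ^+ 2 + X w ^+ 2) - 2 * (G w * X w)).
  by apply/funext => w; ring.
rewrite meanD ?meanB ?meanZ //; [lra|..]; try exact: L1D; exact: L1Z.
Qed.

End Moments.

(** * The Laplace distribution: symmetry and second moment *)

Section Laplace.
Context (R : realType) (theta : R).
Hypothesis theta_gt0 : 0 < theta.
Local Notation mu := (@lebesgue_measure R).
Local Notation TR := (measurableTypeR R).
Local Notation pdf := (@laplace_pdf R theta).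

Lemma laplace_pdf_ge0 x : 0 <= pdf x.
Proof. by rewrite mulr_ge0 ?invr_ge0 ?mulr_ge0 ?expR_ge0 // ltW. Qed.

Lemma laplace_pdfN x : pdf (- x) = pdf x.
Proof. by rewrite /laplace_pdf normrN. Qed.

Lemma continuous_laplace_pdf : continuous pdf.
Proof.
move=> x; rewrite /laplace_pdf; apply: cvgM; first exact: cvg_cst.
apply: (@continuous_comp _ _ _ (fun y : R => - `|y| / theta) expR).
  apply: cvgM; last exact: cvg_cst.
  by apply: cvgN; exact: norm_continuous.
exact: continuous_expR.
Qed.

Lemma measurable_laplace_pdf : measurable_fun setT (pdf : TR -> R).
Proof. exact: continuous_measurable_fun continuous_laplace_pdf. Qed.

(** On x >= 0 an antiderivative of x^2 times the density, with value - theta^2 at 0. *)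
Let F (x : R) : R :=
  - (2^-1 * (x ^+ 2 + 2 * theta * x + 2 * theta ^+ 2) * expR (- x / theta)).

Let F_derive (x : R) : is_derive x 1 F (2^-1 / theta * (x ^+ 2 * expR (- x / theta))).
Proof.
apply: is_derive_eq; rewrite /GRing.scale /= /GRing.scale /=.
by field; rewrite gt_eqF.
Qed.

Let F_cvg : F x @[x --> +oo] --> 0.
Proof.
apply/cvgrPdist_le => e e0; near=> x.
have x0 : theta <= x by near: x; apply: nbhs_pinfty_ge; rewrite num_real.
(* For x >= theta the polynomial in [F] is at most 5 x^2, while exp(x / theta) is at least (x /
   theta)^3 / 6; hence the modulus of [F] is at most 15 theta^3 / x. *)
have xe : 15 * theta ^+ 3 / e <= x.
  by near: x; apply: nbhs_pinfty_ge; rewrite num_real.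
have xp : 0 < x by apply: lt_le_trans x0.
rewrite sub0r normrN /F normrN ger0_norm; last first.
  rewrite mulr_ge0 ?expR_ge0 // mulr_ge0 //.
  have tx : 0 < theta * x by rewrite mulr_gt0.
  have := sqr_ge0 theta; have := sqr_ge0 x; lra.
have u0 : 0 <= x / theta by rewrite divr_ge0 // ltW.
have := expR_ge1Dxn 2 u0; rewrite mulNr expRN => hexp.
have hE : (x / theta) ^+ 3 / 6 <= expR (x / theta).
  apply: le_trans hexp; rewrite (_ : (3`!)%N = 6)%N //; lra.
have E0 := expR_gt0 (x / theta).
rewrite ler_pdivrMr //.
have : e * ((x / theta) ^+ 3 / 6) <= e * expR (x / theta) by rewrite ler_pM2l.
apply: le_trans.
have -> : e * ((x / theta) ^+ 3 / 6) = e * x ^+ 3 / (6 * theta ^+ 3).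
  by field; rewrite gt_eqF.
rewrite ler_pdivlMr; last by rewrite mulr_gt0 // exprn_gt0.
move: xe; rewrite ler_pdivrMr // => xe.
have h1 : x ^+ 2 + 2 * theta * x + 2 * theta ^+ 2 <= 5 * x ^+ 2.
  have h2 : theta * x <= x * x by rewrite ler_pM2r.
  have h3 : theta * theta <= theta * x by rewrite ler_pM2l.
  by rewrite !expr2; lra.
have t3 : 0 < theta ^+ 3 by rewrite exprn_gt0.
apply: (@le_trans _ _ (2^-1 * (5 * x ^+ 2) * (6 * theta ^+ 3))).
  rewrite ler_wpM2r ?ler_wpM2l //; lra.
have -> : 2^-1 * (5 * x ^+ 2) * (6 * theta ^+ 3) = 15 * theta ^+ 3 * x ^+ 2.
  by field.
have -> : e * x ^+ 3 = x * e * x ^+ 2 by ring.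
by rewrite ler_wpM2r // sqr_ge0.
Unshelve. all: by end_near. Qed.

(** The integrand is even, so the integral is twice the one over the half-line, which is [- F 0]
    because [F] vanishes at infinity. *)
Lemma laplace_second_moment :
  (\int[mu]_x ((x ^+ 2)%:E * (pdf x)%:E) = (2 * theta ^+ 2)%:E)%E.
Proof.
pose g (x : R) : R := x ^+ 2 * pdf x.
have cg : continuous g.
  move=> x; apply: cvgM; last exact: continuous_laplace_pdf.
  exact: exprn_continuous.
have g0 x : 0 <= g x by rewrite mulr_ge0 ?sqr_ge0 ?laplace_pdf_ge0.
under eq_integral do rewrite -EFinM.
rewrite (@ge0_symfun_integralT R g) //; last first.
  by move=> x; rewrite /g /= laplace_pdfN sqrrN.
rewrite -set_itvcy (@ge0_continuous_FTC2y _ g F 0 0) //.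
- rewrite /F sub0e -EFinN -EFinM; congr EFin.
  by rewrite expr0n /= oppr0 mul0r expR0; field.
- exact: continuous_subspaceT.
- apply: cvg_at_right_filter.
  by apply: differentiable_continuous; apply/derivable1_diffP; case: (F_derive 0).
- move=> x; rewrite in_itv /= andbT => x0.
  rewrite derive1E; case: (F_derive x) => _ ->; rewrite /g /laplace_pdf ger0_norm ?ltW //.
  by field; rewrite gt_eqF.
Qed.

End Laplace.

Section LaplaceVariable.
Context (disp : measure_display) (T : measurableType disp) (R : realType)
  (P : probability T R) (theta : R) (X : T -> R).
Hypotheses (theta_gt0 : 0 < theta) (lapX : laplace_rv P theta X).

Lemma laplace_symmetric B : measurable B ->
  P (X @^-1` B) = P ((fun w => - X w) @^-1` B).
Proof.
move=> mB; have [_ lX] := lapX.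
have mNB : measurable (-%R @^-1` B : set R).
  by rewrite -[X in measurable X]setTI; exact: oppr_measurable.
have -> : (fun w => - X w) @^-1` B = X @^-1` (-%R @^-1` B) by [].
rewrite !lX //; apply: integral_even_opp => //.
- exact: measurable_laplace_pdf.
- exact: laplace_pdf_ge0.
- exact: laplace_pdfN.
Qed.

Let integral_sqr : (\int[P]_w (X w ^+ 2)%:E = (2 * theta ^+ 2)%:E)%E.
Proof.
have [mX lX] := lapX.
have mX' : measurable_fun setT (X : T -> measurableTypeR R) by exact: mX.
pose XT : {mfun T >-> measurableTypeR R} :=
  HB.pack (X : T -> measurableTypeR R) (isMeasurableFun.Build _ _ _ _ _ mX').
transitivity (\int[distribution P XT]_x (x ^+ 2)%:E)%E.
  rewrite (ge0_integral_distribution XT) //.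
  - by apply/measurable_EFinP; exact: measurable_funX.
  - by move=> x; rewrite lee_fin sqr_ge0.
rewrite -(laplace_second_moment theta_gt0).
apply: (ge0_integral_density (Q := distribution P XT)) => //.
- exact: measurable_laplace_pdf.
- exact: laplace_pdf_ge0.
- by apply/measurable_EFinP; exact: measurable_funX.
- by move=> x; rewrite lee_fin sqr_ge0.
Qed.

Lemma laplace_L2 : L2 P X.
Proof.
have [mX lX] := lapX; split => //; apply/integrableP; split.
  by apply/measurable_EFinP; exact: measurable_funX.
under eq_integral do rewrite /= ger0_norm ?sqr_ge0 //.
by rewrite integral_sqr ltry.
Qed.

Lemma laplace_mean_sqr : mean P (fun w => X w ^+ 2) = 2 * theta ^+ 2.
Proof. by rewrite /mean /Rintegral integral_sqr. Qed.

End LaplaceVariable.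

(** * Measurability *)

Section ContinuousGradient.
Variables (R : realType) (d : nat).

Lemma continuous_sum (I : Type) (r : seq I) (F : I -> 'rV[R]_d -> R) :
  (forall i, continuous (F i)) -> continuous (fun x => \sum_(i <- r) F i x).
Proof.
move=> cF; elim: r => [|i r IH].
  have -> : (fun x => \sum_(i <- [::]) F i x) = cst 0.
    by apply/funext => x; rewrite big_nil.
  exact: cst_continuous.
have -> : (fun x => \sum_(j <- i :: r) F j x) =
          (fun x => F i x + \sum_(j <- r) F j x).
  by apply/funext => x; rewrite big_cons.
by move=> x; exact: (cvgD (cF i x) (IH x)).
Qed.

Lemma continuous_sq_dist (x0 : 'rV[R]_d) :
  continuous (fun x : 'rV[R]_d => sq (x - x0)).
Proof.
have -> : (fun x : 'rV[R]_d => sq (x - x0)) =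
    (fun x : 'rV[R]_d => \sum_j (x 0 j - x0 0 j) ^+ 2).
  apply/funext => x; rewrite sqE big_ord1.
  by apply: eq_bigr => j _; rewrite !mxE.
apply: continuous_sum => j x.
apply: (@continuous_comp _ _ _ (fun x : 'rV[R]_d => x 0 j - x0 0 j)
  (fun u : R => u ^+ 2)); last exact: exprn_continuous.
apply: (@cvgB _ _ _ _ _ (fun y : 'rV[R]_d => y 0 j) (fun=> x0 0 j)).
- exact: (@nbhs_filter _ x).
- exact: (@coord_continuous R 1 d 0 j x).
- exact: (@cst_continuous _ _ (x0 0 j) x).
Qed.

Lemma continuous_at_of_sq_le (V : topologicalType) (g h : V -> R) x0 :
  {for x0, continuous h} -> h x0 = 0 ->
  (forall x, `|g x0 - g x| ^+ 2 <= h x) -> {for x0, continuous g}.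
Proof.
move=> ch h0 gh; apply/cvgrPdist_lt => e e0.
have e2 : 0 < e ^+ 2 by rewrite exprn_gt0.
move/cvgrPdist_lt : ch => /(_ _ e2); apply: filterS => x.
rewrite h0 sub0r normrN ger0_norm; last exact: le_trans (gh x).
move=> hx; rewrite -(ltr_pXn2r (n:=2)) ?nnegrE ?(ltW e0) //.
exact: le_lt_trans (gh x) hx.
Qed.

(** Smoothness is stated in the Euclidean norm, whereas the topology comes from the maximum norm.
    The squared Euclidean distance, a polynomial in the coordinates, is continuous and mediates
    between them. *)
Lemma continuous_grad (L : R) (f : 'rV[R]_d -> R) (j : 'I_d) : 0 < L ->
  smooth L f -> continuous (fun x => grad f x 0 j).
Proof.
move=> L0 sf x0.
apply: (@continuous_at_of_sq_le 'rV[R]_d (fun x => grad f x 0 j)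
  (fun x => L ^+ 2 * sq (x - x0))).
- apply: (@continuous_comp _ _ _ (fun x : 'rV[R]_d => sq (x - x0))
    (fun u : R => L ^+ 2 * u)); first exact: continuous_sq_dist.
  exact: mulrl_continuous.
- by rewrite subrr /sq ip0l mulr0.
- move=> x; apply: le_trans; last first.
    by rewrite sqBC; exact: smooth_sq (ltW L0) sf.
  rewrite real_normK ?num_real // sqE big_ord1 (bigD1 j) //=.
  by rewrite !mxE lerDl sumr_ge0 // => k _; exact: sqr_ge0.
Qed.

End ContinuousGradient.

Section MeasurableRows.
Context (disp : measure_display) (T : measurableType disp) (R : realType)
  (d : nat).
Implicit Types X Y : T -> 'rV[R]_d.

Definition measurable_row X :=
  forall j, measurable_fun setT (fun w => X w 0 j).

Lemma measurable_row_cst x : measurable_row (fun=> x).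
Proof. by move=> j; exact: measurable_cst. Qed.

Lemma measurable_rowD X Y : measurable_row X -> measurable_row Y ->
  measurable_row (fun w => X w + Y w).
Proof.
by move=> mX mY j; under eq_fun do rewrite mxE; exact: measurable_funD.
Qed.

Lemma measurable_rowN X : measurable_row X -> measurable_row (fun w => - X w).
Proof.
by move=> mX j; under eq_fun do rewrite mxE; exact: measurableT_comp.
Qed.

Lemma measurable_rowB X Y : measurable_row X -> measurable_row Y ->
  measurable_row (fun w => X w - Y w).
Proof.
by move=> mX mY; apply: measurable_rowD => //; exact: measurable_rowN.
Qed.

Lemma measurable_rowZ (c : R) X : measurable_row X ->
  measurable_row (fun w => c *: X w).
Proof.
by move=> mX j; under eq_fun do rewrite mxE; exact: measurable_funM.
Qed.

Lemma measurable_row_sum (I : Type) (r : seq I) (X : I -> T -> 'rV[R]_d) :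
  (forall i, measurable_row (X i)) ->
  measurable_row (fun w => \sum_(i <- r) X i w).
Proof.
move=> mX; elim: r => [|i r IH].
  by under eq_fun do rewrite big_nil; exact: measurable_row_cst.
by under eq_fun do rewrite big_cons; exact: measurable_rowD.
Qed.

Lemma measurable_row_average n (X : T -> 'I_n -> 'rV[R]_d) :
  (forall i, measurable_row (fun w => X w i)) ->
  measurable_row (fun w => average (X w)).
Proof.
by move=> mX; apply: measurable_rowZ; exact: measurable_row_sum.
Qed.

(* [X] is the limit of its roundings to the grid [Z^d / (m + 1)], which take
   countably many values. *)
Lemma measurable_row_continuous (g : 'rV[R]_d -> R) X : continuous g ->
  measurable_row X -> measurable_fun setT (fun w => g (X w)).
Proof.
move=> cg mX.
pose N (m : nat) (w : T) : {ffun 'I_d -> int} :=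
  [ffun j => Num.floor (m.+1%:R * X w 0 j)].
pose pt (m : nat) (v : {ffun 'I_d -> int}) : 'rV[R]_d :=
  \row_j ((v j)%:~R / m.+1%:R).
apply: (@measurable_fun_cvg _ _ _ _ (fun m w => g (pt m (N m w)))).
  move=> m _ B mB; rewrite setTI.
  have -> : (fun w => g (pt m (N m w))) @^-1` B =
    \bigcup_v (if g (pt m v) \in B then
       \bigcap_(j in [set: 'I_d])
         (fun w => m.+1%:R * X w 0 j) @^-1` `[(v j)%:~R, (v j + 1)%:~R[
       else set0).
    apply/seteqP; split=> [w /= Bw|w [v _]].
      exists (N m w) => //; rewrite mem_set // => j _ /=.
      by rewrite in_itv /= ffunE; exact: floor_itv.
    case: ifP => // /set_mem Bv h.
    suff Nv : N m w = v by rewrite /= Nv.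
    apply/ffunP => j; rewrite ffunE; apply: floor_def.
    by have := h j Logic.I; rewrite /= in_itv.
  apply: countable_bigcupT_measurable => //.

  move=> v; case: ifP => // _.
  apply: fin_bigcap_measurable => // j _.
  rewrite -[X in measurable X]setTI.
  exact: measurable_funM.
move=> w _; apply: continuous_cvg; first exact: cg.
apply/cvgrPdist_le => e e0; near=> m.
rewrite -[leLHS]/(mx_norm _) mx_normrE; apply/bigmax_leP; split; first exact: ltW.
move=> [i j] _ /=; rewrite ord1 !mxE ffunE.
set u := X w 0 j; have m0 : 0 < m.+1%:R :> R by rewrite ltr0n.
have /andP[f1 f2] := floor_itv (m.+1%:R * u).
have me : e^-1 <= m.+1%:R.
  near: m; apply: filterS (nbhs_infty_ger e^-1) => k ek.
  by apply: le_trans ek _; rewrite ler_nat.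
rewrite ger0_norm; last by rewrite subr_ge0 ler_pdivrMr // (mulrC u).
rewrite lerBlDr -lerBlDl ler_pdivlMr //.
move: f2; rewrite intrD => f2.
have : 1 <= e * m.+1%:R by rewrite -ler_pdivrMl // mulr1.
move=> h; rewrite mulrBl (mulrC u); lra.
Unshelve. all: by end_near. Qed.

Lemma measurable_row_grad (L : R) (f : 'rV[R]_d -> R) X : 0 < L ->
  smooth L f -> measurable_row X -> measurable_row (fun w => grad f (X w)).
Proof.
move=> L0 sf mX j.
by apply: (measurable_row_continuous (continuous_grad (j := j) L0 sf)).
Qed.

Lemma measurable_row_tuple X : measurable_row X ->
  measurable_fun setT (fun w => [tuple X w 0 l | l < d]).
Proof.
move=> mX; apply/measurable_fun_tnthP => l.
by rewrite [X in measurable_fun _ X](_ : _ = (fun w => X w 0 l)) //;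
  apply/funext => w; rewrite /= tnth_mktuple.
Qed.

Lemma row_tuple (x : 'rV[R]_d) : \row_l tnth [tuple x 0 l | l < d] l = x.
Proof. by apply/rowP => l; rewrite mxE tnth_mktuple. Qed.

Lemma measurable_row_compressor (dZ : measure_display) (Z : measurableType dZ)
    (C : 'rV[R]_d -> Z -> 'rV[R]_d) X (z : T -> Z) :
  measurable_compressor C -> measurable_row X -> measurable_fun setT z ->
  measurable_row (fun w => C (X w) (z w)).
Proof.
move=> mC mX mz j.
have := measurableT_comp (mC j) (measurable_fun_pair (measurable_row_tuple mX) mz).
by apply: eq_measurable_fun => w _ /=; rewrite row_tuple.
Qed.

End MeasurableRows.

Section MeasurableState.
Context (disp dispZ : measure_display) (T : measurableType disp)
  (Z : measurableType dispZ) (R : realType) (n d : nat).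
Variables (W : 'M[R]_n) (fi : 'I_n -> 'rV[R]_d -> R) (L : R)
  (C : 'rV[R]_d -> Z -> 'rV[R]_d) (eta gamma alpha_x alpha_y : R)
  (x0 : 'I_n -> 'rV[R]_d) (xi_x xi_y : T -> nat -> 'I_n -> 'rV[R]_d)
  (z_x z_y : T -> nat -> 'I_n -> Z).
Hypotheses (L_gt0 : 0 < L) (fi_smooth : forall i, smooth L (fi i))
  (C_meas : measurable_compressor C).

Let state w k := pgtc W fi eta gamma alpha_x alpha_y x0 (xi_x w) (xi_y w)
  (fun t i v => C v (z_x w t i)) (fun t i v => C v (z_y w t i)) k.

(** The measurable space [T] is arbitrary and only sources of time below [k] are assumed measurable.
    Read over a smaller sigma-algebra, the statement tells which sources the state depends on. *)
Lemma measurable_state (k : nat) :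
  (forall t i, (t < k)%N ->
     [/\ measurable_row (fun w => xi_x w t i),
         measurable_row (fun w => xi_y w t i),
         measurable_fun setT (fun w => z_x w t i)
       & measurable_fun setT (fun w => z_y w t i)]) ->
  forall i, [/\ measurable_row (fun w => st_x (state w k) i),
     measurable_row (fun w => st_y (state w k) i),
     measurable_row (fun w => st_xc (state w k) i)
   & measurable_row (fun w => st_yc (state w k) i)].
Proof.
elim: k => [|k IH] src i.
  by split; exact: measurable_row_cst.
have {IH}IH := IH (fun t i tk => src t i (leqW tk)).
have mx j : measurable_row (fun w => st_x (state w k) j) by case: (IH j).
have my j : measurable_row (fun w => st_y (state w k) j) by case: (IH j).
have mxc j : measurable_row (fun w => st_xc (state w k) j) by case: (IH j).
have myc j : measurable_row (fun w => st_yc (state w k) j) by case: (IH j).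
have mnx j : measurable_row (fun w => xi_x w k j) by case: (src k j (ltnSn k)).
have mny j : measurable_row (fun w => xi_y w k j) by case: (src k j (ltnSn k)).
have mzx j : measurable_fun setT (fun w => z_x w k j).
  by case: (src k j (ltnSn k)).
have mzy j : measurable_fun setT (fun w => z_y w k j).
  by case: (src k j (ltnSn k)).
have mxa j := measurable_rowD (mx j) (mnx j).
have mya j := measurable_rowD (my j) (mny j).
have mxh j := measurable_rowD (mxc j) (measurable_row_compressor C_meas
  (measurable_rowB (mxa j) (mxc j)) (mzx j)).
have myh j := measurable_rowD (myc j) (measurable_row_compressor C_meas
  (measurable_rowB (mya j) (myc j)) (mzy j)).
have mx' : measurable_row (fun w => st_x (state w k.+1) i).
  apply: measurable_rowB; last exact: measurable_rowZ.
  apply: measurable_rowD => //; apply: measurable_rowZ.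
  apply: measurable_row_sum => j; apply: measurable_rowZ.
  exact: measurable_rowB.
split => //.
- apply: measurable_rowB; last exact: (measurable_row_grad L_gt0 (fi_smooth i) (mx i)).
  apply: measurable_rowD; last exact: (measurable_row_grad L_gt0 (fi_smooth i) mx').
  apply: measurable_rowD => //; apply: measurable_rowZ.
  apply: measurable_row_sum => j; apply: measurable_rowZ.
  exact: measurable_rowB.
- by apply: measurable_rowD; exact: measurable_rowZ.
- by apply: measurable_rowD; exact: measurable_rowZ.
Qed.

End MeasurableState.

(** * Elementary sources, orthogonality of the noise, and the compressor at random inputs *)

Section Sources.
Context (disp dispZ : measure_display) (T : measurableType disp)
  (Z : measurableType dispZ) (R : realType) (P : probability T R)
  (PC : probability Z R) (n d : nat).
Variables (xi_x xi_y : T -> nat -> 'I_n -> 'rV[R]_d)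
  (z_x z_y : T -> nat -> 'I_n -> Z).

Local Notation index := ((bool * nat * 'I_n * 'I_d) + (bool * nat * 'I_n))%type.
Local Notation F := (source_events xi_x xi_y z_x z_y).
Local Notation noise b := (if b then xi_x else xi_y).
Local Notation seed b := (if b then z_x else z_y).
Local Notation others_of a := (g_sigma_algebraType (others F a)).

Definition source_time (a : index) : nat :=
  match a with inl (_, k, _, _) => k | inr (_, k, _) => k end.

Hypotheses
  (noise_meas : forall b k i j, measurable_fun setT (fun w => noise b w k i 0 j))
  (seed_law : forall b k i, has_law P PC (fun w => seed b w k i))
  (indep : mutually_independent P F).

Lemma source_eventsT a : F a setT.
Proof. by case: a => [[[[b k] i] j]|[[b k] i]]; exists setT; rewrite ?setTI. Qed.

Lemma source_eventsI a : setI_closed (F a).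
Proof.
by case: a => [[[[b k] i] j]|[[b k] i]] _ _ [A mA <-] [B mB <-];
  exists (A `&` B); rewrite ?setTI ?preimage_setI //; exact: measurableI.
Qed.

Lemma source_events_measurable a : F a `<=` measurable.
Proof.
case: a => [[[[b k] i] j]|[[b k] i]] _ [A mA <-]; first exact: noise_meas.
by case: (seed_law b k i) => h _; exact: h.
Qed.

(** [others_of a] is [T] with the sigma-algebra generated by all sources except [a]; measurability
    over it stands for not depending on [a]. *)
Lemma noise_others a b k i j : inl (b, k, i, j) != a ->
  measurable_fun setT ((fun w => noise b w k i 0 j) : others_of a -> R).
Proof.
move=> ba _ B mB; apply: sub_sigma_algebra.
by exists (inl (b, k, i, j)) => //; exists B.
Qed.

Lemma seed_others a b k i : inr (b, k, i) != a ->
  measurable_fun setT ((fun w => seed b w k i) : others_of a -> Z).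
Proof.
move=> ba _ B mB; apply: sub_sigma_algebra.
by exists (inr (b, k, i)) => //; exists B.
Qed.

Lemma others_independent d' (U : measurableType d') a (G : T -> U) A B :
  measurable_fun setT (G : others_of a -> U) -> measurable A -> F a B ->
  P (G @^-1` A `&` B) = (P (G @^-1` A) * P B)%E.
Proof.
move=> mG mA FB; apply: (independent_others source_eventsT source_eventsI
  source_events_measurable indep) FB.
by have := mG measurableT _ mA; rewrite setTI.
Qed.

Lemma measurable_others d' (U : measurableType d') a (G : T -> U) :
  measurable_fun setT (G : others_of a -> U) -> measurable_fun setT G.
Proof.
move=> mG _ A mA; have := mG measurableT _ mA; apply: smallest_sub.
  exact: sigma_algebra_measurable.
by move=> B [b _ FB]; exact: source_events_measurable FB.
Qed.

Lemma noise_orthogonal b k i j (theta : R) (G : T -> R) : 0 < theta ->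
  laplace_rv P theta (fun w => noise b w k i 0 j) -> L2 P G ->
  measurable_fun setT (G : others_of (inl (b, k, i, j)) -> R) ->
  mean P (fun w => G w * noise b w k i 0 j) = 0.
Proof.
move=> t0 lap G2 mG; apply: mean_mul_symmetric => //.
- exact: laplace_L2 lap.
- by move=> B mB; exact: laplace_symmetric lap _ mB.
- move=> A B mA mB; apply: others_independent mG mA _.
  by exists B => //; rewrite setTI.
Qed.

Variables (phi r : R) (C : 'rV[R]_d -> Z -> 'rV[R]_d).
Hypotheses (C_meas : measurable_compressor C) (C_compr : compressor PC phi r C).

Local Notation err V b k i :=
  (fun w => sq (r^-1 *: C (V w) (seed b w k i) - V w)).

Let err_meas : measurable_fun setT (fun u : d.-tuple R * Z =>
  sq (r^-1 *: C (\row_l tnth u.1 l) u.2 - \row_l tnth u.1 l)).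
Proof.
under eq_fun do rewrite sqE big_ord1.
apply: measurable_sum => j; apply: measurable_funX.
under eq_fun do rewrite !mxE.
apply: measurable_funB; first exact: measurable_funM.
exact: (measurableT_comp (measurable_tnth j) measurable_fst).
Qed.

(** The compressor bound concerns a fixed input. As [V] does not depend on the seed of the call, the
    seed is integrated out first with the value of [V] frozen. The estimate is made in the extended
    reals, and its finite right-hand side is what gives integrability of the error. *)
Lemma compression_mean b k i (V : T -> 'rV[R]_d) :
  (forall j, L2 P (fun w => V w 0 j)) ->
  measurable_row (V : others_of (inr (b, k, i)) -> 'rV[R]_d) ->
  L1 P (err V b k i) /\
  mean P (err V b k i) <= (1 - phi) * mean P (fun w => sq (V w)).
Proof.
move=> V2 mV; have mV' : measurable_row V.
  by move=> j; apply: (measurable_others (mV j)).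
have [mz lz] := seed_law b k i.
pose tup w := [tuple V w 0 l | l < d].
pose XT : {mfun T >-> d.-tuple R} := HB.pack tup
  (isMeasurableFun.Build _ _ _ _ _ (measurable_row_tuple mV')).
pose ZT : {mfun T >-> Z} := HB.pack (fun w => seed b w k i)
  (isMeasurableFun.Build _ _ _ _ _ mz).
pose h (u : d.-tuple R * Z) :=
  (sq (r^-1 *: C (\row_l tnth u.1 l) u.2 - \row_l tnth u.1 l))%:E.
have mh : measurable_fun setT h by apply/measurable_EFinP.
have h0 u : (0 <= h u)%E by rewrite lee_fin sq_ge0.
have sV1 : L1 P (fun w => sq (V w)).
  under eq_fun do rewrite sqE big_ord1.
  by apply: L1_sum => j; case: (V2 j).
have fr : (\int[P]_w (err V b k i w)%:E =
           \int[P]_w \int[PC]_z h (tup w, z))%E.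
  transitivity (\int[P]_w h (XT w, ZT w))%E.
    by apply: eq_integral => w _; rewrite /h /= row_tuple.
  apply: (integral_frozen (Q := PC) (X := XT) (Z := ZT)) => // A B mA mB.
  rewrite -lz //; apply: (others_independent (measurable_row_tuple mV) mA).
  by exists B => //; rewrite setTI.
have le : (\int[P]_w (err V b k i w)%:E
           <= ((1 - phi) * mean P (fun w => sq (V w)))%:E)%E.
  rewrite fr -meanZ // -expectationE; last exact: L1Z.
  rewrite unlock; apply: ge0_le_integral => //.
  - by move=> w _; exact: integral_ge0.
  - have mF : measurable_fun setT (fun u => \int[PC]_z h (u, z))%E.
      exact: measurable_fun_fubini_tonelli_F.
    by apply: (measurableT_comp mF); exact: measurable_row_tuple.
  - by apply/measurable_EFinP; apply: measurable_funM => //; exact: (L1_measurable sV1).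
  - move=> w _; rewrite /h /= row_tuple.
    by have := C_compr (V w); rewrite unlock l2normE; under eq_integral do rewrite l2normE.
have me : measurable_fun setT (err V b k i).
  have := measurableT_comp err_meas
    (measurable_fun_pair (measurable_row_tuple mV') mz).
  by apply: eq_measurable_fun => w _ /=; rewrite row_tuple.
have i1 : L1 P (err V b k i).
  apply/integrableP; split; first exact/measurable_EFinP.
  under eq_integral do rewrite /= ger0_norm ?sq_ge0 //.
  exact: le_lt_trans le (ltry _).
split => //; rewrite -lee_fin -expectationE // unlock.
exact: le.
Qed.

End Sources.

(** * Combination of the recursions *)

(* The coefficients stand for [lh = 1 - gamma rho], [i2 = 2 / (gamma rho)],
   [i3 = 3 / phi1], [g2 = 4 gamma^2], [e2 = eta^2], [L2 = Lf^2],
   [t = 1 - phi1 / 2], [en = eta nu]; the variables for the objective gap [v],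
   the four entries [a b c e] of Theta, [T = |J Y|^2], the squared increment [D]
   of X and the squared quantization errors [qx qy]. *)
Lemma lyapunov_combination (R : realFieldType)
    (lh i2 i3 g2 e2 L2 r0 t en ca cg cn es kap s1 s2 s3 s4 : R)
    (v v' a a' b b' c c' e e' T D qx qy nx ny nx' ny' nb S : R) :
  [/\ 0 <= lh, 0 <= i2, 0 <= i3, 0 <= g2 & 0 <= e2] ->
  [/\ 0 <= L2, 0 <= t, 0 <= en & 0 <= cn] ->
  [/\ 0 <= s1, 0 <= s2, 0 <= s3 & 0 <= s4] ->
  [/\ 0 <= v, 0 <= a, 0 <= b, 0 <= c & 0 <= e] -> 0 <= T ->
  [/\ nx <= nb, ny <= nb, nx' <= nb & ny' <= nb] ->  0 <= nb ->
  qx <= r0 * c -> qy <= r0 * e ->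
  D <= 5 * (nx + g2 * a + g2 * qx + e2 * b + e2 * T) ->
  v' <= (1 - en) * v - cg * T + ca * a + es * S + cn * nx ->
  a' <= lh * (a + nx) + i2 * (g2 * qx + e2 * b) ->
  b' <= lh * (b + ny) + i2 * (g2 * qy + L2 * D) ->
  c' <= t * c + i3 * (5 * (g2 * (a + nx + qx) + e2 * (b + T))) + nx' ->
  e' <= t * e + i3 * (4 * (g2 * (b + ny + qy) + L2 * D)) + ny' ->
  ca + s1 * lh + 5 * g2 * (s2 * i2 * L2 + s3 * i3 + 4 * (s4 * i3 * L2))
    <= s1 * (1 - en / 2) ->
  s1 * i2 * e2 + s2 * lh + 5 * e2 * (s2 * i2 * L2 + s3 * i3
    + 4 * (s4 * i3 * L2)) + 4 * (s4 * i3 * g2) <= s2 * (1 - en / 2) ->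
  s1 * i2 * g2 * r0 + s3 * t
    + 5 * g2 * r0 * (s2 * i2 * L2 + s3 * i3 + 4 * (s4 * i3 * L2))
    <= s3 * (1 - en / 2) ->
  s2 * i2 * g2 * r0 + s4 * t + 4 * (s4 * i3 * g2 * r0) <= s4 * (1 - en / 2) ->
  5 * e2 * (s2 * i2 * L2 + s3 * i3 + 4 * (s4 * i3 * L2)) <= cg ->
  s1 * lh + s2 * lh + 5 * (s2 * i2 * L2) + s3 + 5 * (s3 * i3 * g2)
    + s4 + 4 * (s4 * i3 * g2) + 20 * (s4 * i3 * L2) + cn <= kap ->
  v' + (s1 * a' + s2 * b' + s3 * c' + s4 * e') <=
  (1 - en / 2) * (v + (s1 * a + s2 * b + s3 * c + s4 * e)) + kap * nb + es * S.
Proof.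
move=> [lh0 i20 i30 g20 e20] [L20 t0 en0 cn0] [s10 s20 s30 s40].
move=> [v0 a0 b0 c0 e0] T0 [nxb nyb nxb' nyb'] nb0 hqx hqy hD h0 h1 h2 h3 h4.
move=> Ca Cb Cc Ce Cg Cn.
have gqx : g2 * qx <= g2 * (r0 * c) by rewrite ler_wpM2l.
have gqy : g2 * qy <= g2 * (r0 * e) by rewrite ler_wpM2l.
have gnx : g2 * nx <= g2 * nb by rewrite ler_wpM2l.
have gny : g2 * ny <= g2 * nb by rewrite ler_wpM2l.
pose D' := 5 * (nb + g2 * a + g2 * (r0 * c) + e2 * b + e2 * T).
have hD' : L2 * D <= L2 * D'.
  by rewrite ler_wpM2l //; apply: le_trans hD _; rewrite /D'; lra.
have k0 : s1 * a' <= s1 * (lh * (a + nb) + i2 * (g2 * (r0 * c) + e2 * b)).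
  rewrite ler_wpM2l //; apply: le_trans h1 _.
  by rewrite lerD // ler_wpM2l //; lra.
have k1 : s2 * b' <= s2 * (lh * (b + nb) + i2 * (g2 * (r0 * e) + L2 * D')).
  rewrite ler_wpM2l //; apply: le_trans h2 _.
  by rewrite lerD // ler_wpM2l //; lra.
have k2 : s3 * c' <= s3 * (t * c
    + i3 * (5 * (g2 * a + g2 * nb + g2 * (r0 * c) + e2 * (b + T))) + nb).
  rewrite ler_wpM2l //; apply: le_trans h3 _.
  by rewrite !lerD // ler_wpM2l //; lra.
have k3 : s4 * e' <= s4 * (t * e
    + i3 * (4 * (g2 * b + g2 * nb + g2 * (r0 * e) + L2 * D')) + nb).
  rewrite ler_wpM2l //; apply: le_trans h4 _.
  by rewrite !lerD // ler_wpM2l //; lra.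
have k4 : cn * nx <= cn * nb by rewrite ler_wpM2l.
have Ca' := ler_wpM2r a0 Ca; have Cb' := ler_wpM2r b0 Cb.
have Cc' := ler_wpM2r c0 Cc; have Ce' := ler_wpM2r e0 Ce.
have Cg' := ler_wpM2r T0 Cg; have Cn' := ler_wpM2r nb0 Cn.
(* The objective contracts by 1 - en, whereas the coefficient conditions give only 1 - en / 2 for
   the errors; the difference on [v] is given up. *)
have vv : 0 <= en * v by rewrite mulr_ge0.
rewrite /D' in k1 k3.
by lra.
Qed.

(* [C2]-[C5] are four of the bounds in [zetabar2], cleared of denominators,
   with [m = n%:R]. *)
Section Coefficients.
Variables (R : realFieldType) (z rho p1 L nu m r0 lam2 : R).
Hypotheses (z0 : 0 < z) (rho0 : 0 < rho) (rho1 : rho <= 1) (p0 : 0 < p1)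
  (p1_le1 : p1 <= 1) (L0 : 0 < L) (nu0 : 0 < nu) (m0 : 0 < m)
  (r00 : 0 <= r0) (lam20 : 0 <= lam2).
Hypotheses
  (C2 : z * (nu / L) + 1860 * (z * (L / m)) <= 1)
  (C3 : z * (2 * (nu / L) + 18 * (m / L) + 576) <= 1)
  (C4 : z * (2 * (nu / L) + 72 * (m / L) * r0 + 576 + 1024 * r0) <= 1)
  (C5 : z * (2 * (nu / L) + 144 * r0) <= 1).
Let g := z * rho * p1.
Let eta := z * g * rho ^+ 2 / L.
Let s1 : R := 2^-1.
Let s2 := z * rho ^+ 2 / (m * L).
Let s3 := L / m.

Let z576 : 576 * z <= 1.
Proof.
have : 0 <= z * (nu / L) by rewrite mulr_ge0 ?divr_ge0 ?ltW.
have : 0 <= z * (m / L) by rewrite mulr_ge0 ?divr_ge0 ?ltW.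
by move: C3; lra.
Qed.

Let w := z * (L / m).
Let u := z * (nu / L).
Let y := z * (m / L).
Let x := z * r0.
Let w0 : 0 <= w. Proof. by rewrite mulr_ge0 ?divr_ge0 ?ltW. Qed.
Let u0 : 0 <= u. Proof. by rewrite mulr_ge0 ?divr_ge0 ?ltW. Qed.
Let y0 : 0 <= y. Proof. by rewrite mulr_ge0 ?divr_ge0 ?ltW. Qed.
Let x0 : 0 <= x. Proof. by rewrite mulr_ge0 // ltW. Qed.
Let rho2 : rho ^+ 2 <= 1. Proof. exact: (exprn_ile1 _ (ltW rho0) rho1). Qed.
Let rho3 : rho ^+ 3 <= 1. Proof. exact: (exprn_ile1 _ (ltW rho0) rho1). Qed.
Let rho4 : rho ^+ 4 <= 1. Proof. exact: (exprn_ile1 _ (ltW rho0) rho1). Qed.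
Let rho5 : rho ^+ 5 <= 1. Proof. exact: (exprn_ile1 _ (ltW rho0) rho1). Qed.

(** Powers of rho and phi1 are bounded by 1, and a surplus factor [z] is worth 1/576; this disposes
    of all terms of higher order in [z]. *)
Let zle (k c : R) : 0 <= c <= 1 -> 0 <= k -> z * c * k <= k / 576.
Proof.
move=> /andP[c0 c1] k0; rewrite mulrC ler_wpM2l //.
have : z * c <= z * 1 by rewrite ler_wpM2l // ltW.
by move: z576; lra.
Qed.

Let rhop k : 0 <= rho ^+ k * p1 <= 1.
Proof.
have rk0 : 0 <= rho ^+ k by exact: (exprn_ge0 k (ltW rho0)).
have rk1 : rho ^+ k <= 1 by exact: (exprn_ile1 k (ltW rho0) rho1).
by rewrite (mulr_ge0 rk0 (ltW p0)) (mulr_ile1 rk0 (ltW p0) rk1 p1_le1).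
Qed.

Let g2 := 4 * g ^+ 2.
Let i2 := 2 / (g * rho).
Let i3 := 3 / p1.
Let lh := 1 - g * rho.
Let en := eta * nu.
Let common := s2 * i2 * L ^+ 2 + s3 * i3 + 4 * (s2 * i3 * L ^+ 2).

Let neq : [/\ z != 0, rho != 0, p1 != 0 & L != 0] /\ m != 0.
Proof. by rewrite !gt_eqF. Qed.

(** In this and the next four lemmas the slack factors as a nonnegative product times a constant
    minus a sum in the scaled quantities [u], [w], [y], [x], [z]. [field] checks the factorization,
    and the bounds on [z] keep the sum below the constant. *)
Lemma coef_disagreement_x :
  eta * L ^+ 2 / m + s1 * lh + 5 * g2 * common <= s1 * (1 - en / 2).
Proof.
case: neq => -[? ? ? ?] ?; rewrite -subr_ge0.
rewrite (_ : _ - _ = g * rho * (2^-1 - (rho * u / 4 + rho * w + 40 * w + 60 * w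
  + 240 * (z * rho ^+ 2 * w)))); last first.
  rewrite /common /s1 /s2 /s3 /i2 /i3 /lh /en /eta /g2 /g /u /w; field.
  by do ?[apply/andP; split].
have gr : 0 <= g * rho by rewrite !mulr_ge0 // ltW.
rewrite mulr_ge0 // subr_ge0.
have h1 : rho * u <= 1 * u by rewrite ler_wpM2r.
have h2 : rho * w <= 1 * w by rewrite ler_wpM2r.
have h3 : z * rho ^+ 2 * w <= w / 576 by rewrite zle // ?rho2 ?exprn_ge0 ?ltW.
by move: C2 u0 w0; rewrite -/u -/w; lra.
Qed.

Lemma coef_disagreement_y :
  s1 * i2 * eta ^+ 2 + s2 * lh + 5 * eta ^+ 2 * common + 4 * (s2 * i3 * g2)
  <= s2 * (1 - en / 2).
Proof.
case: neq => -[? ? ? ?] ?; rewrite -subr_ge0.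
rewrite (_ : _ - _ = s2 * g * rho * (1 - (rho * u / 2 + y
  + 10 * (z * rho ^+ 2 * z) + 15 * (z * rho ^+ 2 * z)
  + 60 * (z * rho ^+ 4 * (z * z)) + 48 * z))); last first.
  rewrite /common /s1 /s2 /s3 /i2 /i3 /lh /en /eta /g2 /g /u /y; field.
  by do ?[apply/andP; split].
have gr : 0 <= s2 * g * rho by rewrite !mulr_ge0 ?exprn_ge0 ?invr_ge0 ?mulr_ge0 // ltW.
rewrite mulr_ge0 // subr_ge0.
have h1 : rho * u <= 1 * u by rewrite ler_wpM2r.
have h3 : z * rho ^+ 2 * z <= z / 576 by rewrite zle // ?rho2 ?exprn_ge0 ?ltW.
have h4 : z * rho ^+ 4 * (z * z) <= (z * z) / 576.
  by rewrite zle ?mulr_ge0 // ?rho4 ?exprn_ge0 ?ltW.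
have h5 : z * z <= z by rewrite ger_pMr //; move: z576; lra.
have C3' : 2 * u + 18 * y + 576 * z <= 1 by apply: le_trans C3; rewrite /u /y; lra.
by move: z0 z576 u0 y0; lra.
Qed.

Lemma coef_message_x :
  s1 * i2 * g2 * r0 + s3 * (1 - p1 / 2) + 5 * g2 * r0 * common
  <= s3 * (1 - en / 2).
Proof.
case: neq => -[? ? ? ?] ?; rewrite -subr_ge0.
rewrite (_ : _ - _ = s3 * p1 * (2^-1 - (z * rho ^+ 3 * u / 2 + 4 * (y * r0)
  + 40 * (z * rho ^+ 2 * x) + 60 * (z * rho ^+ 2 * x)
  + 240 * (z * rho ^+ 4 * (z * x))))); last first.
  rewrite /common /s1 /s2 /s3 /i2 /i3 /lh /en /eta /g2 /g /u /y /x; field.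
  by do ?[apply/andP; split].
have gr : 0 <= s3 * p1 by rewrite !mulr_ge0 ?invr_ge0 // ltW.
rewrite mulr_ge0 // subr_ge0.
have h1 : z * rho ^+ 3 * u <= u / 576 by rewrite zle // ?rho3 ?exprn_ge0 ?ltW.
have h3 : z * rho ^+ 2 * x <= x / 576 by rewrite zle // ?rho2 ?exprn_ge0 ?ltW.
have h4 : z * rho ^+ 4 * (z * x) <= (z * x) / 576.
  by rewrite zle ?mulr_ge0 // ?rho4 ?exprn_ge0 ?ltW.
have h5 : z * x <= 1 * x by rewrite ler_wpM2r //; move: z0 z576; lra.
have h6 : 0 <= y * r0 by rewrite mulr_ge0.
have : 2 * u + 72 * (y * r0) + 576 * z + 1024 * x <= 1.
  apply: le_trans C4; rewrite /u /y /x; lra.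
by move: z0 u0 x0; lra.
Qed.

Lemma coef_message_y :
  s2 * i2 * g2 * r0 + s2 * (1 - p1 / 2) + 4 * (s2 * i3 * g2 * r0)
  <= s2 * (1 - en / 2).
Proof.
case: neq => -[? ? ? ?] ?; rewrite -subr_ge0.
rewrite (_ : _ - _ = s2 * p1 * (2^-1 - (z * rho ^+ 3 * u / 2 + 8 * x
  + 48 * (z * rho ^+ 2 * x)))); last first.
  rewrite /s2 /i2 /i3 /en /eta /g2 /g /u /x; field.
  by do ?[apply/andP; split].
have gr : 0 <= s2 * p1 by rewrite !mulr_ge0 ?exprn_ge0 ?invr_ge0 ?mulr_ge0 // ltW.
rewrite mulr_ge0 // subr_ge0.
have h1 : z * rho ^+ 3 * u <= u / 576 by rewrite zle // ?rho3 ?exprn_ge0 ?ltW.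
have h3 : z * rho ^+ 2 * x <= x / 576 by rewrite zle // ?rho2 ?exprn_ge0 ?ltW.
have : 2 * u + 144 * x <= 1 by apply: le_trans C5; rewrite /u /x; lra.
by move: z0 u0 x0; lra.
Qed.

(** The average of the trackers enters the increment and the drift with factor eta^2; the negative
    term left by the descent of the objective, of first order in eta, absorbs it. *)
Lemma coef_tracking :
  5 * eta ^+ 2 * common <= eta / 2 * (1 - L * eta) / m.
Proof.
case: neq => -[? ? ? ?] ?; rewrite -subr_ge0.
rewrite (_ : _ - _ = eta / m * (2^-1 - (z * (rho ^+ 3 * p1) * z / 2
  + 10 * (z * rho ^+ 3 * z) + 15 * (z * rho ^+ 3 * z)
  + 60 * (z * rho ^+ 5 * (z * z))))); last first.
  rewrite /common /s2 /s3 /i2 /i3 /eta /g; field.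
  by do ?[apply/andP; split].
have gr : 0 <= eta / m by rewrite !mulr_ge0 ?exprn_ge0 ?invr_ge0 ?mulr_ge0 // ltW.
rewrite mulr_ge0 // subr_ge0.
have h1 := zle (rhop 3) (ltW z0).
have h3 : z * rho ^+ 3 * z <= z / 576 by rewrite zle // ?rho3 ?exprn_ge0 ?ltW.
have h4 : z * rho ^+ 5 * (z * z) <= (z * z) / 576.
  by rewrite zle ?mulr_ge0 // ?rho5 ?exprn_ge0 ?ltW.
have h5 : z * z <= z by rewrite ger_pMr //; move: z576; lra.
by move: z0 z576; lra.
Qed.

(** From gamma rho <= phi1 / 576 follow [lh] >= 9/10 and 1 / (gamma rho) >= 576 / phi1. The terms
    are then compared in groups carrying the weights [s1], [s2] and [s3]; the noise coefficient of
    the objective is [s3 / 2] and joins the last group. *)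
Lemma coef_noise :
  s1 * lh + s2 * lh + 5 * (s2 * i2 * L ^+ 2) + s3 + 5 * (s3 * i3 * g2)
    + s2 + 4 * (s2 * i3 * g2) + 20 * (s2 * i3 * L ^+ 2) + L / 2 / m
  <= s1 * (9 * lh ^+ 2 / (g * rho))
     + s2 * (36 * lh ^+ 2 * L ^+ 2 / (g * rho) + 9 * lh ^+ 2 / (g * rho))
     + s3 * (16 * (lh ^+ 2 + 1) / p1)
     + s2 * ((64 * lam2 + 16 * (lam2 + 1)) / p1).
Proof.
case: neq => -[? ? ? ?] ?.
have gr0 : 0 < g * rho by rewrite !mulr_gt0.
have zr : 0 <= z * rho ^+ 2 by rewrite mulr_ge0 ?exprn_ge0 // ltW.
have gr1 : g * rho <= p1 / 576.
  have -> : g * rho = z * rho ^+ 2 * p1 by rewrite /g; ring.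
  by rewrite zle // ?rho2 ?exprn_ge0 ?ltW.
have lh1 : lh <= 1 by rewrite /lh; lra.
have lh2 : 9 / 10 <= lh by move: p1_le1; rewrite /lh; lra.
have lh3 : 8 / 10 <= lh ^+ 2.
  have q9 : 0 <= 9 / 10 :> R by lra.
  by have := ler_pM q9 q9 lh2 lh2; rewrite expr2; lra.
have ig : p1^-1 * 576 <= (g * rho)^-1.
  have ip0 : 0 <= p1^-1 by rewrite invr_ge0 ltW.
  have := ler_wpM2l ip0 gr1; rewrite (mulrA p1^-1 p1) mulVf // => h.
  by rewrite -[leRHS]mul1r (ler_pdivlMr _ _ gr0) mulrAC; lra.
have ip1 : 1 <= p1^-1 by rewrite invf_ge1.
have s20 : 0 < s2 by rewrite divr_gt0 ?mulr_gt0 ?exprn_gt0.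
have s30 : 0 < s3 by rewrite divr_gt0.
have g1 : 5 * (i3 * g2) <= 1.
  have -> : i3 * g2 = 12 * (z * (rho ^+ 2 * p1) * z).
    by rewrite /i3 /g2 /g; field.
  by have := zle (rhop 2) (ltW z0); move: z576; lra.
set G := (g * rho)^-1 in ig *.
have G0 : 0 < G by rewrite invr_gt0.
have lG : 8 / 10 * G <= lh ^+ 2 * G by rewrite ler_pM2r.
have G1 : 576 <= G by lra.
have hA : s1 * lh <= s1 * (9 * lh ^+ 2 / (g * rho)).
  by rewrite -/G /s1; lra.
have hB : s2 * (lh + 5 * (i2 * L ^+ 2) + 1 + 4 * (i3 * g2)
    + 20 * (i3 * L ^+ 2)) <=
  s2 * (36 * lh ^+ 2 * L ^+ 2 / (g * rho) + 9 * lh ^+ 2 / (g * rho)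
   + (64 * lam2 + 16 * (lam2 + 1)) / p1).
  rewrite ler_pM2l // /i2 /i3 -/G.
  have q0 : 0 < L ^+ 2 by rewrite exprn_gt0.
  have lGL := ler_wpM2r (ltW q0) lG.
  have igL := ler_wpM2r (ltW q0) ig.
  have lp : 0 <= lam2 / p1 by rewrite divr_ge0 // ltW.
  rewrite /i3 in g1.
  by nra.
have hC : s3 * (1 + 5 * (i3 * g2) + 2^-1) <= s3 * (16 * (lh ^+ 2 + 1) / p1).
  rewrite ler_pM2l //.
  have : 8 / 10 * p1^-1 <= lh ^+ 2 * p1^-1 by rewrite ler_wpM2r // invr_ge0 ltW.
  by move: g1; lra.
have s3E : L / 2 / m = s3 * 2^-1 by rewrite /s3; field.
by rewrite -/G in hA hB; rewrite s3E; lra.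
Qed.

End Coefficients.

(** * Random matrices: measurability and square integrability *)

Section MeasurableMatrices.
Context (disp : measure_display) (T : measurableType disp) (R : realType)
  (m n : nat).
Implicit Types A B : T -> 'M[R]_(m, n).

Definition measurable_mx A :=
  forall i j, measurable_fun setT (fun w => A w i j).

Lemma measurable_mxD A B : measurable_mx A -> measurable_mx B ->
  measurable_mx (fun w => A w + B w).
Proof.
by move=> mA mB i j; under eq_fun do rewrite mxE; exact: measurable_funD.
Qed.

Lemma measurable_mxN A : measurable_mx A -> measurable_mx (fun w => - A w).
Proof.
by move=> mA i j; under eq_fun do rewrite mxE; exact: measurableT_comp.
Qed.

Lemma measurable_mxB A B : measurable_mx A -> measurable_mx B ->
  measurable_mx (fun w => A w - B w).
Proof. by move=> mA mB; apply: measurable_mxD => //; exact: measurable_mxN. Qed.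

Lemma measurable_mxZ (c : R) A : measurable_mx A ->
  measurable_mx (fun w => c *: A w).
Proof.
by move=> mA i j; under eq_fun do rewrite mxE; exact: measurable_funM.
Qed.

End MeasurableMatrices.

Lemma measurable_mx_mull (disp : measure_display) (T : measurableType disp)
    (R : realType) (p m n : nat) (S : 'M[R]_(p, m)) (A : T -> 'M[R]_(m, n)) :
  measurable_mx A -> measurable_mx (fun w => S *m A w).
Proof.
move=> mA i j; under eq_fun do rewrite mxE.
by apply: measurable_sum => k; exact: measurable_funM.
Qed.

Lemma measurable_mx_stack (disp : measure_display) (T : measurableType disp)
    (R : realType) (n d : nat) (v : T -> 'I_n -> 'rV[R]_d) :
  (forall i, measurable_row (fun w => v w i)) ->
  measurable_mx (fun w => stack (v w)).
Proof. by move=> mv i j; under eq_fun do rewrite mxE; exact: mv. Qed.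

Section SquareIntegrableMatrices.
Context (disp : measure_display) (T : measurableType disp) (R : realType)
  (P : probability T R).

Definition L2mx (m n : nat) (A : T -> 'M[R]_(m, n)) :=
  forall i j, L2 P (fun w => A w i j).

Section Closure.
Variables (m n : nat).
Implicit Types A B : T -> 'M[R]_(m, n).

Lemma L2mxD A B : L2mx A -> L2mx B -> L2mx (fun w => A w + B w).
Proof. by move=> A2 B2 i j; under eq_fun do rewrite mxE; exact: L2D. Qed.

Lemma L2mxN A : L2mx A -> L2mx (fun w => - A w).
Proof. by move=> A2 i j; under eq_fun do rewrite mxE; exact: L2N. Qed.

Lemma L2mxB A B : L2mx A -> L2mx B -> L2mx (fun w => A w - B w).
Proof. by move=> A2 B2; apply: L2mxD => //; exact: L2mxN. Qed.

Lemma L2mxZ (c : R) A : L2mx A -> L2mx (fun w => c *: A w).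
Proof. by move=> A2 i j; under eq_fun do rewrite mxE; exact: L2Z. Qed.

Lemma L2mx_cst (M : 'M[R]_(m, n)) : L2mx (fun=> M).
Proof. by move=> i j; exact: L2_cst. Qed.

Lemma L2mx_sum (I : Type) (r : seq I) (A : I -> T -> 'M[R]_(m, n)) :
  (forall i, L2mx (A i)) -> L2mx (fun w => \sum_(i <- r) A i w).
Proof.
move=> A2 i j; under eq_fun do rewrite summxE.
by apply: L2_sum => k; exact: A2.
Qed.

Lemma L1_ip A B : L2mx A -> L2mx B -> L1 P (fun w => ip (A w) (B w)).
Proof.
by move=> A2 B2; apply: L1_sum => i; apply: L1_sum => j; exact: L2M.
Qed.

Lemma L1_sq A : L2mx A -> L1 P (fun w => sq (A w)).
Proof. by move=> A2; exact: L1_ip. Qed.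

Lemma L2mx_le A (G : T -> R) : measurable_mx A -> L1 P G ->
  (forall w, sq (A w) <= G w) -> L2mx A.
Proof.
move=> mA G1 AG i j; apply: (L2_le (mA i j) G1) => w.
apply: le_trans (AG w); rewrite sqE (bigD1 i) //= (bigD1 j) //= -addrA lerDl.
apply: addr_ge0; first by apply: sumr_ge0 => k _; exact: sqr_ge0.
apply: sumr_ge0 => k _; apply: sumr_ge0 => l _; exact: sqr_ge0.
Qed.

End Closure.

Lemma L2mx_mull (p m n : nat) (S : 'M[R]_(p, m)) (A : T -> 'M[R]_(m, n)) :
  L2mx A -> L2mx (fun w => S *m A w).
Proof.
move=> A2 i j; under eq_fun do rewrite mxE.
by apply: L2_sum => k; exact: L2Z.
Qed.

Lemma L2mx_row (n d : nat) (v : T -> 'I_n -> 'rV[R]_d) :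
  L2mx (fun w => stack (v w)) -> forall i, L2mx (fun w => v w i).
Proof.
move=> v2 i k j; have := v2 i j.
by under eq_fun do rewrite mxE; rewrite (ord1 k).
Qed.

Lemma L2mx_stack (n d : nat) (v : T -> 'I_n -> 'rV[R]_d) :
  (forall i, L2mx (fun w => v w i)) -> L2mx (fun w => stack (v w)).
Proof. by move=> v2 i j; under eq_fun do rewrite mxE; exact: v2. Qed.

End SquareIntegrableMatrices.

(** * Mean-square recursions *)

Section Process.
Context (disp dispZ : measure_display) (T : measurableType disp)
  (Z : measurableType dispZ) (R : realType) (P : probability T R)
  (PC : probability Z R) (n d : nat).
Hypothesis n_gt0 : (0 < n)%N.
Variables (xi_x xi_y : T -> nat -> 'I_n -> 'rV[R]_d)
  (z_x z_y : T -> nat -> 'I_n -> Z) (theta : bool -> nat -> 'I_n -> R).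
Variables (W : 'M[R]_n) (fi : 'I_n -> 'rV[R]_d -> R) (L phi r : R)
  (C : 'rV[R]_d -> Z -> 'rV[R]_d) (eta gamma alpha_x alpha_y : R)
  (x0 : 'I_n -> 'rV[R]_d).

Local Notation F := (source_events xi_x xi_y z_x z_y).
Local Notation noise b := (if b then xi_x else xi_y).
Local Notation seed b := (if b then z_x else z_y).
Local Notation others_of a := (g_sigma_algebraType (others F a)).
Local Notation J := (const_mx n%:R^-1 : 'M[R]_n).

Hypotheses (theta_gt0 : forall b k i, 0 < theta b k i)
  (lap : forall b k i j,
     laplace_rv P (theta b k i) (fun w => noise b w k i 0 j))
  (seed_law : forall b k i, has_law P PC (fun w => seed b w k i))
  (indep : mutually_independent P F)
  (L_gt0 : 0 < L) (fi_smooth : forall i, smooth L (fi i))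
  (dsW : doubly_stochastic W) (r_gt0 : 0 < r)
  (C_meas : measurable_compressor C) (C_compr : compressor PC phi r C).

Let noise_meas b k i j : measurable_fun setT (fun w => noise b w k i 0 j).
Proof. by case: (lap b k i j). Qed.

Definition state w k := pgtc W fi eta gamma alpha_x alpha_y x0 (xi_x w) (xi_y w)
  (fun t i v => C v (z_x w t i)) (fun t i v => C v (z_y w t i)) k.

(* As in [source_events], the boolean is [true] for the x-variables and [false]
   for the y-variables. *)
Local Notation iter b := (if b then @st_x R n d else @st_y R n d).
Local Notation refp b := (if b then @st_xc R n d else @st_yc R n d).

Definition iterate b k w := stack (iter b (state w k)).
Definition reference b k w := stack (refp b (state w k)).
Definition noise_mx b k w := stack (noise b w k).
(* The compressor is applied to [message = - sigma]. *)
Definition message b k w i :=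
  iter b (state w k) i + noise b w k i - refp b (state w k) i.
Definition message_mx b k w := stack (message b k w).
Definition compressed b k w :=
  stack (fun i => C (message b k w i) (seed b w k i)).
Definition gradient_mx k w :=
  stack (fun i => grad (fi i) (st_x (state w k) i)).

Lemma message_mxE b k w :
  message_mx b k w = iterate b k w + noise_mx b k w - reference b k w.
Proof. by apply/matrixP => i j; rewrite !mxE. Qed.

Lemma iterate_xS k w : iterate true k.+1 w =
  iterate true k w + noise_mx true k w
  + gamma *: ((W - 1%:M) *m (reference true k w + compressed true k w))
  - eta *: iterate false k w.
Proof. exact: (stack_x_step _ _ _ _ _ _ _ _ _ _ dsW). Qed.

Lemma iterate_yS k w : iterate false k.+1 w =
  iterate false k w + noise_mx false k w
  + gamma *: ((W - 1%:M) *m (reference false k w + compressed false k w))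
  + (gradient_mx k.+1 w - gradient_mx k w).
Proof. exact: (stack_y_step _ _ _ _ _ _ _ _ _ _ dsW). Qed.

Lemma referenceS b k w : reference b k.+1 w =
  reference b k w + (if b then alpha_x else alpha_y) *: compressed b k w.
Proof. by case: b; [exact: stack_xc_step|exact: stack_yc_step]. Qed.

(** Sources of time t act in the step from t to t + 1, so the state at time [k] reads none of time
    [k] or later. *)
Definition unused_before (k : nat) (a : (bool * nat * 'I_n * 'I_d) + (bool * nat * 'I_n)) :=
  (k <= source_time a)%N.

Lemma state_others k a : unused_before k a -> forall b i,
  measurable_row ((fun w => iter b (state w k) i) : others_of a -> _) /\
  measurable_row ((fun w => refp b (state w k) i) : others_of a -> _).
Proof.
move=> ka b i.
have src t l : (t < k)%N ->
    [/\ measurable_row ((fun w => xi_x w t l) : others_of a -> _),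
        measurable_row ((fun w => xi_y w t l) : others_of a -> _),
        measurable_fun setT ((fun w => z_x w t l) : others_of a -> _)
      & measurable_fun setT ((fun w => z_y w t l) : others_of a -> _)].
  move=> tk; have ne b' j : inl (b', t, l, j) != a.
    by apply/eqP => ae; move: ka; rewrite /unused_before -ae /= leqNgt tk.
  have ne' b' : inr (b', t, l) != a.
    by apply/eqP => ae; move: ka; rewrite /unused_before -ae /= leqNgt tk.
  split.
  - by move=> j; exact: (noise_others (b := true) (ne true j)).
  - by move=> j; exact: (noise_others (b := false) (ne false j)).
  - exact: (seed_others (b := true) (ne' true)).
  - exact: (seed_others (b := false) (ne' false)).
have [m1 m2 m3 m4] := @measurable_state _ _ (others_of a) Z R n d W fi L C eta
  gamma alpha_x alpha_y x0 xi_x xi_y z_x z_y L_gt0 fi_smooth C_meas k src i.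
by case: b; split; [exact: m1|exact: m3|exact: m2|exact: m4].
Qed.

Lemma iterate_others k a b : unused_before k a ->
  measurable_mx (iterate b k : others_of a -> _).
Proof.
move=> ka; apply: measurable_mx_stack => i.
by case: (state_others ka b i).
Qed.

Lemma reference_others k a b : unused_before k a ->
  measurable_mx (reference b k : others_of a -> _).
Proof.
move=> ka; apply: measurable_mx_stack => i.
by case: (state_others ka b i).
Qed.

Lemma noise_mx_L2 b k : L2mx P (noise_mx b k).
Proof.
apply: L2mx_stack => i i0 j; rewrite (ord1 i0).
exact: laplace_L2 (theta_gt0 b k i) (lap b k i j).
Qed.

Lemma noise_mx_orthogonal b k (G : T -> 'M[R]_(n, d)) : L2mx P G ->
  (forall a, unused_before k a ->
     measurable_mx (G : others_of a -> _)) ->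
  mean P (fun w => ip (G w) (noise_mx b k w)) = 0.
Proof.
move=> G2 mG; have i1 i j : L1 P (fun w => G w i j * noise_mx b k w i j).
  exact: L2M (G2 i j) (noise_mx_L2 b k i j).
rewrite /ip mean_sum; last by move=> i; apply: L1_sum => j; exact: i1.
rewrite big1 // => i _; rewrite mean_sum // big1 // => j _.
under [X in mean P X]eq_fun do rewrite /noise_mx mxE.
apply: (noise_orthogonal noise_meas seed_law indep (theta_gt0 b k i)) => //.
by apply: mG; rewrite /unused_before.
Qed.

(** The message contains noise of time [k] but no seed of time [k]; hence it is independent of the
    seed of its own compression, though not of every source of that time. *)
Lemma message_others b k i :
  measurable_row ((fun w => message b k w i) : others_of (inr (b, k, i)) -> _).
Proof.
have [mx mc] := state_others (leqnn k : unused_before k (inr (b, k, i))) b i.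
apply: measurable_rowB => //; apply: measurable_rowD => // j.
exact: noise_others.
Qed.

Definition compression_error b k w :=
  sq (r^-1 *: compressed b k w - message_mx b k w).

Lemma compression_errorE b k w : compression_error b k w =
  \sum_(i < n) sq (r^-1 *: C (message b k w i) (seed b w k i) - message b k w i).
Proof.
rewrite -(sq_stack (fun i => r^-1 *: C (message b k w i) (seed b w k i)
  - message b k w i)) /compression_error.
by congr sq; apply/matrixP => i j; rewrite !mxE.
Qed.

Section Compression.
Variables (b : bool) (k : nat).
Hypothesis m2 : L2mx P (message_mx b k).

Let row2 i j : L2 P (fun w => message b k w i 0 j).
Proof. exact: (L2mx_row m2). Qed.

Let cm i := compression_mean noise_meas seed_law indep C_meas C_compr
  (row2 i) (@message_others b k i).

Lemma compression_error_L1 : L1 P (compression_error b k).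
Proof.
rewrite (_ : compression_error b k = fun w => \sum_(i < n)
  sq (r^-1 *: C (message b k w i) (seed b w k i) - message b k w i)).
  by apply: L1_sum => i; case: (cm i).
by apply/funext => w; exact: compression_errorE.
Qed.

Lemma compression_error_mean :
  mean P (compression_error b k) <=
  (1 - phi) * mean P (fun w => sq (message_mx b k w)).
Proof.
rewrite (_ : compression_error b k = fun w => \sum_(i < n)
  sq (r^-1 *: C (message b k w i) (seed b w k i) - message b k w i)); last first.
  by apply/funext => w; exact: compression_errorE.
under [X in _ <= _ * mean P X]eq_fun do rewrite sq_stack.
rewrite !mean_sum.
- by rewrite mulr_sumr; apply: ler_sum => i _; case: (cm i).
- by move=> i; apply: L1_sq => i0 j; rewrite (ord1 i0); exact: row2.
- by move=> i; case: (cm i).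
Qed.

(** Only the error of the compressor has a controlled second moment, so the output is recovered as
    [r] times the sum of error and message. *)
Lemma compressed_L2 : L2mx P (compressed b k).
Proof.
have m2s : L1 P (fun w => sq (message_mx b k w)) by exact: L1_sq.
have e1 := compression_error_L1.
apply: (L2mx_le _ (L1D (L1Z (2 * r ^+ 2) e1) (L1Z (2 * r ^+ 2) m2s))).
  apply: measurable_mx_stack => i; apply: measurable_row_compressor => //.
    by move=> j; case: (row2 i j).
  by case: (seed_law b k i).
move=> w; rewrite /compression_error.
have QE : compressed b k w =
   r *: ((r^-1 *: compressed b k w - message_mx b k w) + message_mx b k w).
  by rewrite subrK scalerA divff ?gt_eqF // scale1r.
rewrite [in leLHS]QE sqZ.
have := sqD2_le (r^-1 *: compressed b k w - message_mx b k w) (message_mx b k w).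
move: (sq (_ + _)) (sq (_ - _)) (sq (message_mx b k w)) (sqr_ge0 r) => u v t.
by move: (r ^+ 2) => r2 r20; nra.
Qed.

End Compression.

(** Smoothness bounds the distance to the deterministic matrix [G0] of gradients at the origin by
    the size of the iterate. *)
Lemma gradient_mx_L2 k : L2mx P (iterate true k) -> L2mx P (gradient_mx k).
Proof.
move=> x2; pose G0 : 'M[R]_(n, d) := stack (fun i => grad (fi i) 0).
have x1 := L1_sq x2.
apply: (L2mx_le _ (L1D (L1Z (2 * L ^+ 2) x1) (L1_cst P (2 * sq G0)))).
  apply: measurable_mx_stack => i; apply: (measurable_row_grad L_gt0) => //.
  by move=> j; case: (L2mx_row x2 i 0 j).
move=> w; rewrite -(subrK G0 (gradient_mx k w)).
apply: le_trans (sqD2_le _ _) _; rewrite mulrDr lerD2r -mulrA ler_pM2l //.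
have -> : gradient_mx k w - G0 =
   stack (fun i => grad (fi i) (st_x (state w k) i) - grad (fi i) 0).
  by apply/matrixP => i j; rewrite !mxE.
rewrite !sq_stack mulr_sumr; apply: ler_sum => i _.
apply: le_trans (smooth_sq _ _ (ltW L_gt0) (fi_smooth i)) _.
by rewrite subr0.
Qed.

Lemma gradient_increment_le k w :
  sq (gradient_mx k.+1 w - gradient_mx k w) <=
  L ^+ 2 * sq (iterate true k.+1 w - iterate true k w).
Proof.
have -> : gradient_mx k.+1 w - gradient_mx k w = stack (fun i =>
   grad (fi i) (st_x (state w k.+1) i) - grad (fi i) (st_x (state w k) i)).
  by apply/matrixP => i j; rewrite !mxE.
have -> : iterate true k.+1 w - iterate true k w = stack (fun i =>
   st_x (state w k.+1) i - st_x (state w k) i).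
  by apply/matrixP => i j; rewrite !mxE.
rewrite !sq_stack mulr_sumr; apply: ler_sum => i _.
exact: smooth_sq (ltW L_gt0) (fi_smooth i).
Qed.

(** Every later splitting of a mean depends on this. Iterates and references share one induction
    because the messages combine them, and the x-iterate at [k.+1] comes before the y-iterate, whose
    update uses its gradient. *)
Lemma state_L2 k b : L2mx P (iterate b k) /\ L2mx P (reference b k).
Proof.
elim: k b => [|k IH] b.
  have z2 : L2mx P (fun=> stack (fun=> 0) : 'M[R]_(n, d)) by exact: L2mx_cst.
  case: b; split; [|exact: z2| |exact: z2].
  - exact: (L2mx_cst P (stack x0)).
  - exact: (L2mx_cst P (stack (fun i => grad (fi i) (x0 i)))).
have x2 b' : L2mx P (iterate b' k) by case: (IH b').
have c2 b' : L2mx P (reference b' k) by case: (IH b').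
have m2 b' : L2mx P (message_mx b' k).
  rewrite (funext (message_mxE b' k)).
  by apply: L2mxB => //; apply: L2mxD => //; exact: noise_mx_L2.
have q2 b' : L2mx P (compressed b' k) by exact: compressed_L2.
have xS2 : L2mx P (iterate true k.+1).
  rewrite (funext (iterate_xS k)); apply: L2mxB; last exact: L2mxZ.
  apply: L2mxD; first by apply: L2mxD => //; exact: noise_mx_L2.
  by apply: L2mxZ; apply: L2mx_mull; exact: L2mxD.
split.
  case: b => //; rewrite (funext (iterate_yS k)); apply: L2mxD.
    apply: L2mxD; first by apply: L2mxD => //; exact: noise_mx_L2.
    by apply: L2mxZ; apply: L2mx_mull; exact: L2mxD.
  by apply: L2mxB; exact: gradient_mx_L2.
by rewrite (funext (referenceS b k)); apply: L2mxD => //; exact: L2mxZ.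
Qed.

Lemma iterate_L2 b k : L2mx P (iterate b k).
Proof. by case: (state_L2 k b). Qed.

Lemma reference_L2 b k : L2mx P (reference b k).
Proof. by case: (state_L2 k b). Qed.

Lemma message_L2 b k : L2mx P (message_mx b k).
Proof.
rewrite (funext (message_mxE b k)).
apply: L2mxB (reference_L2 b k).
by apply: L2mxD; [exact: iterate_L2|exact: noise_mx_L2].
Qed.

(** * Mean-square recursions for the four error terms *)

Hypotheses (symW : W^T = W) (gamma_gt0 : 0 < gamma) (gamma_lt1 : gamma < 1).
Local Notation rho := (1 - spectral_radius (W - J)).
Hypothesis rho_gt0 : 0 < rho.

Definition disagreement b k := mean P (fun w => sq ((1%:M - J) *m iterate b k w)).
Definition tracking k := mean P (fun w => sq (J *m iterate false k w)).
Definition message_sq b k := mean P (fun w => sq (message_mx b k w)).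
Definition noise_sq b k := mean P (fun w => sq (noise_mx b k w)).
Definition quantization b k w := compressed b k w - message_mx b k w.
Definition quantization_sq b k := mean P (fun w => sq (quantization b k w)).
Definition increment_sq k :=
  mean P (fun w => sq (iterate true k.+1 w - iterate true k w)).

(** The estimate exchanged with the neighbours is the noisy iterate plus the quantization error, the
    form [U + N + E] of the pathwise bounds. *)
Lemma quantizationE b k w : reference b k w + compressed b k w =
  iterate b k w + noise_mx b k w + quantization b k w.
Proof.
by rewrite /quantization message_mxE; apply/matrixP => i j; rewrite !mxE; ring.
Qed.

Lemma compressed_mx_L2 b k : L2mx P (compressed b k).
Proof. exact: compressed_L2 (message_L2 b k). Qed.

Lemma quantization_L2 b k : L2mx P (quantization b k).
Proof. exact: L2mxB (compressed_mx_L2 b k) (message_L2 b k). Qed.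

(** Follows the syntax of an integrand down to the processes known to be square integrable;
    [expand_mean] uses it for the side conditions of linearity. *)
Ltac integrable :=
  lazymatch goal with
  | |- L1 _ (fun w => @?f w - @?g w) => apply: (@L1B _ _ _ _ f g); integrable
  | |- L1 _ (fun w => @?f w + @?g w) => apply: (@L1D _ _ _ _ f g); integrable
  | |- L1 _ (fun w => ?c * @?f w) => apply: (@L1Z _ _ _ _ c f); integrable
  | |- L1 _ (fun w => sq (@?f w)) => apply: (@L1_sq _ _ _ _ _ _ f); integrable
  | |- L1 _ (fun w => ip (@?f w) (@?g w)) =>
      apply: (@L1_ip _ _ _ _ _ _ f g); integrable
  | |- L1 _ (fun w => compression_error ?b ?k w) =>
      exact: (compression_error_L1 (message_L2 b k))
  | |- L1 _ (compression_error ?b ?k) =>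
      exact: (compression_error_L1 (message_L2 b k))
  | |- L2mx _ (fun w => @?f w - @?g w) =>
      apply: (@L2mxB _ _ _ _ _ _ f g); integrable
  | |- L2mx _ (fun w => @?f w + @?g w) =>
      apply: (@L2mxD _ _ _ _ _ _ f g); integrable
  | |- L2mx _ (fun w => ?c *: @?f w) =>
      apply: (@L2mxZ _ _ _ _ _ _ c f); integrable
  | |- L2mx _ (fun w => ?S *m @?f w) =>
      apply: (@L2mx_mull _ _ _ _ _ _ _ S f); integrable
  | |- L2mx _ (fun w => iterate ?b ?k w) => exact: (iterate_L2 b k)
  | |- L2mx _ (fun w => reference ?b ?k w) => exact: (reference_L2 b k)
  | |- L2mx _ (fun w => message_mx ?b ?k w) => exact: (message_L2 b k)
  | |- L2mx _ (fun w => noise_mx ?b ?k w) => exact: (noise_mx_L2 b k)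
  | |- L2mx _ (fun w => quantization ?b ?k w) => exact: (quantization_L2 b k)
  | |- L2mx _ (fun w => compressed ?b ?k w) => exact: (compressed_mx_L2 b k)
  end.

Ltac expand_mean :=
  repeat match goal with
  | |- context [mean ?Q (fun w => @?f w - @?g w)] =>
      let e := fresh in
      have e : mean Q (fun w => f w - g w) = mean Q f - mean Q g;
      [apply: meanB; integrable | cbv beta in e; rewrite e; clear e]
  | |- context [mean ?Q (fun w => @?f w + @?g w)] =>
      let e := fresh in
      have e : mean Q (fun w => f w + g w) = mean Q f + mean Q g;
      [apply: meanD; integrable | cbv beta in e; rewrite e; clear e]
  | |- context [mean ?Q (fun w => ?c * @?f w)] =>
      let e := fresh in
      have e : mean Q (fun w => c * f w) = c * mean Q f;
      [apply: meanZ; integrable | cbv beta in e; rewrite e; clear e]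
  end.

Lemma quantization_le b k : quantization_sq b k <=
  (2 * r ^+ 2 * (1 - phi) + 2 * (1 - r) ^+ 2) * message_sq b k.
Proof.
apply: le_trans (mean_le _ _ (fun w => compression_error_le r_gt0
  (message_mx b k w) (compressed b k w))) _; try solve [cbv beta; integrable].
expand_mean; rewrite /message_sq [leRHS]mulrDl lerD2r -[leRHS]mulrA.
apply: ler_wpM2l; first by rewrite mulr_ge0 ?sqr_ge0.
exact: compression_error_mean (message_L2 b k).
Qed.

Lemma disagreement_orthogonal b k :
  mean P (fun w => ip ((1%:M - J) *m iterate b k w) (noise_mx b k w)) = 0.
Proof.
apply: noise_mx_orthogonal => [|a ka]; first by cbv beta; integrable.
by apply: measurable_mx_mull; exact: iterate_others.
Qed.

Lemma disagreement_x_le k : disagreement true k.+1 <=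
  (1 - gamma * rho) * (disagreement true k + noise_sq true k)
  + 2 / (gamma * rho) * (4 * gamma ^+ 2 * quantization_sq true k
                         + eta ^+ 2 * disagreement false k).
Proof.
have pt w : sq ((1%:M - J) *m iterate true k.+1 w) <=
  (1 - gamma * rho) * (sq ((1%:M - J) *m iterate true k w)
     + 2 * ip ((1%:M - J) *m iterate true k w) (noise_mx true k w)
     + sq (noise_mx true k w))
  + 2 / (gamma * rho) * (4 * gamma ^+ 2 * sq (quantization true k w)
                         + eta ^+ 2 * sq ((1%:M - J) *m iterate false k w)).
  rewrite iterate_xS quantizationE -scaleNr.
  apply: le_trans (consensus_step n_gt0 symW dsW gamma_gt0 gamma_lt1 rho_gt0
    _ _ _ _) _.
  by rewrite -scalemxAr sqZ sqrrN.
rewrite /disagreement /increment_sq /message_sq /noise_sq /quantization_sq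
  /tracking; apply: le_trans (mean_le _ _ pt) _; try solve [cbv beta; integrable].
by expand_mean; rewrite disagreement_orthogonal mulr0 addr0.
Qed.

Lemma disagreement_y_le k : disagreement false k.+1 <=
  (1 - gamma * rho) * (disagreement false k + noise_sq false k)
  + 2 / (gamma * rho) * (4 * gamma ^+ 2 * quantization_sq false k
                         + L ^+ 2 * increment_sq k).
Proof.
have pt w : sq ((1%:M - J) *m iterate false k.+1 w) <=
  (1 - gamma * rho) * (sq ((1%:M - J) *m iterate false k w)
     + 2 * ip ((1%:M - J) *m iterate false k w) (noise_mx false k w)
     + sq (noise_mx false k w))
  + 2 / (gamma * rho) * (4 * gamma ^+ 2 * sq (quantization false k w)
     + L ^+ 2 * sq (iterate true k.+1 w - iterate true k w)).
  rewrite iterate_yS quantizationE.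
  apply: le_trans (consensus_step n_gt0 symW dsW gamma_gt0 gamma_lt1 rho_gt0
    _ _ _ _) _.
  rewrite lerD2l ler_pM2l ?divr_gt0 ?mulr_gt0 // lerD2l.
  by apply: le_trans (sq_center_le n_gt0 _) _; exact: gradient_increment_le.
rewrite /disagreement /increment_sq /message_sq /noise_sq /quantization_sq
  /tracking; apply: le_trans (mean_le _ _ pt) _; try solve [cbv beta; integrable].
by expand_mean; rewrite disagreement_orthogonal mulr0 addr0.
Qed.

Lemma increment_sq_le k : increment_sq k <=
  5 * (noise_sq true k + 4 * gamma ^+ 2 * disagreement true k
       + 4 * gamma ^+ 2 * quantization_sq true k
       + eta ^+ 2 * disagreement false k + eta ^+ 2 * tracking k).
Proof.
have pt w : sq (iterate true k.+1 w - iterate true k w) <=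
  5 * (sq (noise_mx true k w)
       + 4 * gamma ^+ 2 * sq ((1%:M - J) *m iterate true k w)
       + 4 * gamma ^+ 2 * sq (quantization true k w)
       + eta ^+ 2 * sq ((1%:M - J) *m iterate false k w)
       + eta ^+ 2 * sq (J *m iterate false k w)).
  rewrite iterate_xS quantizationE; apply: le_trans (increment_le symW dsW
    gamma_gt0 gamma_lt1 _ _ _ _ _).
  rewrite le_eqVlt; apply/orP; left; apply/eqP; congr sq.
  move: (_ *m (_ + _ + _)) => K.
  by apply/matrixP => i j; rewrite !mxE; ring.
rewrite /disagreement /increment_sq /message_sq /noise_sq /quantization_sq
  /tracking; apply: le_trans (mean_le _ _ pt) _; try solve [cbv beta; integrable].
by expand_mean.
Qed.

Lemma message_residual_orthogonal b k :
  mean P (fun w => ip (reference b k w - iterate b k w) (noise_mx b k w)) = 0.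
Proof.
apply: noise_mx_orthogonal => [|a ka]; first by cbv beta; integrable.
apply: measurable_mxB; [exact: reference_others|exact: iterate_others].
Qed.

(** The noise of time [k] is drawn after iterate and reference of time [k] are determined. In the
    recursion this is used at [k.+1], which is how the noise of the following step enters, with
    coefficient 1. *)
Lemma message_sqS b k : message_sq b k =
  mean P (fun w => sq (reference b k w - iterate b k w)) + noise_sq b k.
Proof.
rewrite /message_sq (_ : (fun w => sq (message_mx b k w)) = fun w =>
  sq (reference b k w - iterate b k w)
  - 2 * ip (reference b k w - iterate b k w) (noise_mx b k w)
  + sq (noise_mx b k w)); last first.
  apply/funext => w; rewrite -sqB -sqN message_mxE; congr sq.
  by apply/matrixP => i j; rewrite !mxE; ring.
by expand_mean; rewrite message_residual_orthogonal mulr0 subr0.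
Qed.

Section MessageStep.
Variables (b : bool) (k : nat) (t : R).
Let alpha := if b then alpha_x else alpha_y.
Hypotheses (phi_gt0 : 0 < phi) (alpha_gt0 : 0 < alpha)
  (alpha_lt : alpha * r < 1) (t01 : 0 < t <= 1) (t_le : t <= alpha * r * phi).
Local Notation drift w := (iterate b k w + noise_mx b k w - iterate b k.+1 w).

Lemma message_step : message_sq b k.+1 <=
  (1 - t / 2) * message_sq b k + 3 / t * mean P (fun w => sq (drift w))
  + noise_sq b k.+1.
Proof.
rewrite message_sqS lerD2r.
have pt w : sq (reference b k.+1 w - iterate b k.+1 w) <=
  (1 + t / 2) * ((1 - alpha * r) * sq (message_mx b k w)
                 + alpha * r * compression_error b k w)
  + 3 / t * sq (drift w).
  have -> : reference b k.+1 w - iterate b k.+1 w =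
      alpha *: compressed b k w - message_mx b k w + drift w.
    rewrite referenceS message_mxE -/alpha.
    by apply/matrixP => i j; rewrite !mxE; ring.
  exact: compression_step.
rewrite /disagreement /increment_sq /message_sq /noise_sq /quantization_sq
  /tracking; apply: le_trans (mean_le _ _ pt) _; try solve [cbv beta; integrable].
expand_mean; rewrite lerD2r.
have ce := compression_error_mean (message_L2 b k).
have c0 : 0 <= message_sq b k by apply: mean_ge0 => w; exact: sq_ge0.
have ar0 : 0 < alpha * r by rewrite mulr_gt0.
case/andP: t01 => t0 t1.
have h1 : alpha * r * mean P (compression_error b k) <=
  alpha * r * ((1 - phi) * message_sq b k) by rewrite ler_pM2l.
have h2 : t * message_sq b k <= alpha * r * phi * message_sq b k.
  by rewrite ler_wpM2r.
have h3 : (1 + t / 2) * ((1 - alpha * r) * message_sq b k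
    + alpha * r * mean P (compression_error b k)) <=
  (1 + t / 2) * ((1 - t) * message_sq b k).
  rewrite ler_pM2l; last by lra.
  by rewrite /message_sq in h1 h2 c0 *; lra.
(* (1 + t/2) (1 - t) = 1 - t/2 - t^2/2: half of the contraction is spent on splitting off the
   drift. *)
apply: le_trans h3 _; rewrite mulrA ler_wpM2r //.
by have := sqr_ge0 t; lra.
Qed.

End MessageStep.

Lemma drift_x_mean_le k :
  mean P (fun w => sq (iterate true k w + noise_mx true k w - iterate true k.+1 w))
  <= 5 * (4 * gamma ^+ 2 * (disagreement true k + noise_sq true k
                            + quantization_sq true k)
          + eta ^+ 2 * (disagreement false k + tracking k)).
Proof.
have pt w : sq (iterate true k w + noise_mx true k w - iterate true k.+1 w) <=
  5 * (4 * gamma ^+ 2 * (sq ((1%:M - J) *m iterate true k w)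
         + sq (noise_mx true k w) + sq (quantization true k w))
       + eta ^+ 2 * (sq ((1%:M - J) *m iterate false k w)
                     + sq (J *m iterate false k w))).
  rewrite iterate_xS quantizationE; apply: le_trans (drift_x_le symW dsW
    _ _ _ _ _ _).
  rewrite le_eqVlt; apply/orP; left; apply/eqP; congr sq.
  move: (_ *m (_ + _ + _)) => K.
  by apply/matrixP => i j; rewrite !mxE; ring.
rewrite /disagreement /increment_sq /message_sq /noise_sq /quantization_sq
  /tracking; apply: le_trans (mean_le _ _ pt) _; try solve [cbv beta; integrable].
by expand_mean.
Qed.

Lemma drift_y_mean_le k :
  mean P (fun w => sq (iterate false k w + noise_mx false k w - iterate false k.+1 w))
  <= 4 * (4 * gamma ^+ 2 * (disagreement false k + noise_sq false k
                            + quantization_sq false k)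
          + L ^+ 2 * increment_sq k).
Proof.
have pt w : sq (iterate false k w + noise_mx false k w - iterate false k.+1 w) <=
  4 * (4 * gamma ^+ 2 * (sq ((1%:M - J) *m iterate false k w)
         + sq (noise_mx false k w) + sq (quantization false k w))
       + L ^+ 2 * sq (iterate true k.+1 w - iterate true k w)).
  have h := gradient_increment_le k w.
  apply: (@le_trans _ _ (4 * (4 * gamma ^+ 2 *
     (sq ((1%:M - J) *m iterate false k w)
         + sq (noise_mx false k w) + sq (quantization false k w))
       + sq (gradient_mx k.+1 w - gradient_mx k w)))); last first.
    by rewrite ler_pM2l // lerD2l.
  rewrite iterate_yS quantizationE; apply: le_trans (drift_y_le symW dsW
    _ _ _ _ _).
  rewrite le_eqVlt; apply/orP; left; apply/eqP; congr sq.
  move: (_ *m (_ + _ + _)) (gradient_mx k.+1 w - _) => K G.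
  by apply/matrixP => i j; rewrite !mxE; ring.
rewrite /disagreement /increment_sq /message_sq /noise_sq /quantization_sq
  /tracking; apply: le_trans (mean_le _ _ pt) _; try solve [cbv beta; integrable].
by expand_mean.
Qed.

Definition noise_sum k w := \sum_(t < k) noise_mx false t w.

Lemma noise_sum_L2 k : L2mx P (noise_sum k).
Proof. by apply: L2mx_sum => t; exact: noise_mx_L2. Qed.

(** The trackers at time [k] carry noise up to time [k - 1], whereas the final bound sums up to [k].
    The added noise is orthogonal to the partial sum, so the mean square can only grow. *)
Lemma noise_sum_le k : mean P (fun w => sq (noise_sum k w)) <=
  mean P (fun w => sq (noise_sum k.+1 w)).
Proof.
have -> : (fun w => sq (noise_sum k.+1 w)) = fun w =>
    sq (noise_sum k w) + 2 * ip (noise_sum k w) (noise_mx false k w)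
    + sq (noise_mx false k w).
  by apply/funext => w; rewrite /noise_sum big_ord_recr /= sqD.
have s2 := noise_sum_L2 k; have n2 := noise_mx_L2 false k.
have s1 := L1_sq s2; have n1 := L1_sq n2; have sn1 := L1_ip s2 n2.
rewrite !(meanD, meanZ) //; [|exact: L1Z|by apply: L1D => //; exact: L1Z].
rewrite noise_mx_orthogonal //.
  by rewrite mulr0 addr0 lerDl mean_ge0 // => w; exact: sq_ge0.
move=> a ka i j; under eq_fun do rewrite summxE.
apply: measurable_sum => t; under eq_fun do rewrite mxE.
apply: (noise_others (b := false)); apply/eqP => ae.
by move: ka; rewrite /unused_before -ae /= leqNgt ltn_ord.
Qed.

(** * The objective along the averaged iterate *)

Variables (f : 'rV[R]_d -> R) (fstar nu : R).
Hypotheses (fE : forall x, f x = n%:R^-1 * \sum_(i < n) fi i x)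
  (f_ge : forall x, fstar <= f x)
  (PL : forall x, 2^-1 * l2norm (grad f x) ^+ 2 >= nu * (f x - fstar))
  (eta_gt0 : 0 < eta).
Local Notation j1 := (const_mx n%:R^-1 : 'M[R]_(1, n)).

Let f_smooth : smooth L f.
Proof. exact: (smooth_mean n_gt0 L_gt0 fi_smooth fE). Qed.

Definition mean_iterate b k w := average (iter b (state w k)).
Definition mean_noise b k w := average (noise b w k).
Definition mean_gradient k w :=
  average (fun i => grad (fi i) (st_x (state w k) i)).

Let mean_iterateE b k w : mean_iterate b k w = j1 *m iterate b k w.
Proof. by rewrite /mean_iterate averageE_stack; case: b. Qed.

Let mean_noiseE b k w : mean_noise b k w = j1 *m noise_mx b k w.
Proof. by rewrite /mean_noise averageE_stack; case: b. Qed.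

Let mean_gradientE k w : mean_gradient k w = j1 *m gradient_mx k w.
Proof. exact: averageE_stack. Qed.

Let avg_laplacian p (A : 'M[R]_(n, p)) : j1 *m ((W - 1%:M) *m A) = 0.
Proof.
rewrite mulmxA (_ : j1 *m (W - 1%:M) = 0) ?mul0mx //.
case: dsW => _ _ c1; rewrite mulmxBr mulmx1; apply/eqP; rewrite subr_eq0.
apply/eqP/rowP => j; rewrite !mxE; under eq_bigr do rewrite mxE.
by rewrite -mulr_sumr c1 mulr1.
Qed.

Lemma mean_iterate_xS k w : mean_iterate true k.+1 w =
  mean_iterate true k w + mean_noise true k w - eta *: mean_iterate false k w.
Proof.
rewrite !mean_iterateE mean_noiseE iterate_xS.
have := avg_laplacian (reference true k w + compressed true k w).
move: (_ *m (_ + _)) => K K0.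
by rewrite mulmxBr !mulmxDr -!scalemxAr K0 scaler0 addr0.
Qed.

(** The gradient-tracking invariant: averaging removes the gossip, the gradient differences
    telescope, and the start at the local gradients leaves no constant. *)
Lemma mean_iterate_yE k w : mean_iterate false k w =
  mean_gradient k w + j1 *m noise_sum k w.
Proof.
rewrite mean_gradientE; elim: k => [|k IH].
  by rewrite /noise_sum big_ord0 mulmx0 addr0 -mean_gradientE.
rewrite mean_iterateE iterate_yS.
have := avg_laplacian (reference false k w + compressed false k w).
move: (_ *m (_ + _)) => K K0.
rewrite !mulmxDr -!scalemxAr K0 scaler0 addr0 -mean_iterateE IH mulmxN.
rewrite /noise_sum big_ord_recr /= mulmxDr.
move: (j1 *m gradient_mx k w) => G.
by apply/matrixP => i j; rewrite !mxE; ring.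
Qed.

Let sq_avg_row_le p (A : 'M[R]_(n, p)) : sq (j1 *m A) <= n%:R^-1 * sq A.
Proof.
have -> : A = stack (fun i => row i A) by apply/matrixP => i j; rewrite !mxE.
by rewrite -averageE_stack; exact: sq_average_le.
Qed.

Lemma tracking_sqE k w :
  sq (J *m iterate false k w) = n%:R * sq (mean_iterate false k w).
Proof.
by rewrite /iterate -stack_average sq_stack sumr_const card_ord -[LHS]mulr_natl.
Qed.

Lemma mean_iterate_L2 b k : L2mx P (mean_iterate b k).
Proof.
by rewrite (funext (mean_iterateE b k)); apply: L2mx_mull; exact: iterate_L2.
Qed.

Lemma mean_iterate_others k a b : unused_before k a ->
  measurable_row (mean_iterate b k : others_of a -> _).
Proof.
move=> ka; apply: measurable_row_average => i.
by case: (state_others ka b i).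
Qed.

(** The gap is nonnegative and, by the descent lemma at the origin, at most a quadratic function of
    a square-integrable vector. *)
Lemma objective_L1 k : L1 P (fun w => f (mean_iterate true k w) - fstar).
Proof.
have x2 := mean_iterate_L2 true k.
apply: (@L1_le _ _ _ _ _ (fun w => (f 0 - fstar)
   + (ip (grad f 0) (mean_iterate true k w)
      + L / 2 * sq (mean_iterate true k w)))).
- apply: measurable_funB => //; apply: measurable_row_continuous.
    by move=> x; apply: differentiable_continuous; case: f_smooth.
  by move=> j; case: (x2 0 j).
- apply: L1D; first exact: L1_cst.
  apply: L1D; first by apply: L1_ip => //; exact: L2mx_cst.
  by apply: L1Z; exact: L1_sq.
- move=> w; rewrite ger0_norm ?subr_ge0 //.
  by have := descent 0 (mean_iterate true k w) L_gt0 f_smooth; rewrite add0r; lra.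
Qed.

Lemma mean_objective_gradient_L2 k :
  L2mx P (fun w => grad f (mean_iterate true k w)).
Proof.
have x2 := mean_iterate_L2 true k.
apply: (L2mx_le _ (L1D (L1Z (2 * L ^+ 2) (L1_sq x2))
  (L1_cst P (2 * sq (grad f 0))))).
  move=> i j; rewrite (ord1 i); apply: (measurable_row_grad L_gt0 f_smooth).
  by move=> l; case: (x2 0 l).
move=> w; rewrite -(subrK (grad f 0) (grad f _)).
apply: le_trans (sqD2_le _ _) _; rewrite mulrDr lerD2r -mulrA ler_pM2l //.
by apply: le_trans (smooth_sq _ _ (ltW L_gt0) f_smooth) _; rewrite subr0.
Qed.

(** Transposition moves the averaging onto the first factor, leaving the full noise matrix against a
    matrix determined by the state. *)
Lemma descent_orthogonal k : mean P (fun w =>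
  ip (grad f (mean_iterate true k w) - (L * eta) *: mean_iterate false k w)
     (mean_noise true k w)) = 0.
Proof.
have -> : (fun w =>
  ip (grad f (mean_iterate true k w) - (L * eta) *: mean_iterate false k w)
     (mean_noise true k w)) = fun w =>
  ip (j1^T *m (grad f (mean_iterate true k w)
               - (L * eta) *: mean_iterate false k w)) (noise_mx true k w).
  by apply/funext => w; rewrite ip_mul trmxK mean_noiseE.
apply: noise_mx_orthogonal => [|a ka].
  apply: L2mx_mull; apply: L2mxB; first exact: mean_objective_gradient_L2.
  by apply: L2mxZ; exact: mean_iterate_L2.
apply: measurable_mx_mull; apply: measurable_mxB.
  move=> i j; rewrite (ord1 i); apply: (measurable_row_grad L_gt0 f_smooth).
  exact: mean_iterate_others.
apply: measurable_mxZ => i j; rewrite (ord1 i).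
exact: mean_iterate_others.
Qed.

Definition objective k := mean P (fun w => f (mean_iterate true k w) - fstar).

Lemma objective_ge0 k : 0 <= objective k.
Proof. by apply: mean_ge0 => w; rewrite subr_ge0. Qed.

(** The point separating consensus error from accumulated noise is the mean gradient. The factors
    1/n come from passing from averages to stacked matrices, which is an equality for the tracking
    term, where the sign is negative. *)
Lemma objective_le k : objective k.+1 <=
  (1 - eta * nu) * objective k - eta / 2 * (1 - L * eta) / n%:R * tracking k
  + eta * L ^+ 2 / n%:R * disagreement true k
  + eta / n%:R * mean P (fun w => sq (noise_sum k w))
  + L / 2 / n%:R * noise_sq true k.
Proof.
have n0 : 0 < n%:R :> R by rewrite ltr0n.
pose cross w :=
  ip (grad f (mean_iterate true k w) - (L * eta) *: mean_iterate false k w)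
     (mean_noise true k w).
have pt w : f (mean_iterate true k.+1 w) - fstar <=
  (1 - eta * nu) * (f (mean_iterate true k w) - fstar)
  + - (eta / 2 * (1 - L * eta) / n%:R) * sq (J *m iterate false k w)
  + eta * L ^+ 2 / n%:R * sq ((1%:M - J) *m iterate true k w)
  + eta / n%:R * sq (noise_sum k w)
  + cross w + L / 2 / n%:R * sq (noise_mx true k w).
  rewrite mean_iterate_xS.
  apply: le_trans (descent_step L_gt0 f_smooth PL _ _ (mean_gradient k w) _
    eta_gt0) _.
  rewrite -/(cross w) tracking_sqE.
  have h1 := sq_grad_mean_le n_gt0 L_gt0 fi_smooth fE (st_x (state w k)).
  have h2 : sq (mean_iterate false k w - mean_gradient k w) <=
      n%:R^-1 * sq (noise_sum k w).
    by rewrite mean_iterate_yE addrC addKr; exact: sq_avg_row_le.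
  have h3 : sq (mean_noise true k w) <= n%:R^-1 * sq (noise_mx true k w).
    by rewrite mean_noiseE; exact: sq_avg_row_le.
  have -> : - (eta / 2 * (1 - L * eta) / n%:R)
      * (n%:R * sq (mean_iterate false k w)) =
      - (eta / 2 * (1 - L * eta) * sq (mean_iterate false k w)).
    by field; rewrite gt_eqF.
  apply: lerD; last first.
    by rewrite -[leRHS]mulrA ler_pM2l // divr_gt0.
  rewrite lerD2r; apply: lerD; last by rewrite -[leRHS]mulrA ler_pM2l.
  by rewrite lerD2l -(mulrA eta) -[leRHS]mulrA ler_pM2l.
have i1 := objective_L1 k; have i2 := objective_L1 k.+1.
have s1 := L1_sq (noise_sum_L2 k); have n1 := L1_sq (noise_mx_L2 true k).
have y1 := L1_sq (L2mx_mull J (iterate_L2 false k)).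
have d1 := L1_sq (L2mx_mull (1%:M - J) (iterate_L2 true k)).
have c1 : L1 P cross.
  apply: L1_ip.
    apply: L2mxB; first exact: mean_objective_gradient_L2.
    by apply: L2mxZ; exact: mean_iterate_L2.
  rewrite (funext (mean_noiseE true k)); apply: L2mx_mull.
  exact: noise_mx_L2.
have m1 := L1Z (1 - eta * nu) i1.
have m2 := L1D m1 (L1Z (- (eta / 2 * (1 - L * eta) / n%:R)) y1).
have m3 := L1D m2 (L1Z (eta * L ^+ 2 / n%:R) d1).
have m4 := L1D m3 (L1Z (eta / n%:R) s1).
have m5 := L1D m4 c1.
apply: le_trans (mean_le i2 (L1D m5 (L1Z (L / 2 / n%:R) n1)) pt) _.
rewrite (meanD m5 (L1Z _ n1)) (meanD m4 c1) (meanD m3 (L1Z _ s1)).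
rewrite (meanD m2 (L1Z _ d1)) (meanD m1 (L1Z _ y1)) !meanZ //.
by rewrite [mean P cross]descent_orthogonal addr0 mulNr.
Qed.

Lemma noise_sqE b k :
  noise_sq b k = \sum_(i < n) \sum_(j < d) 2 * theta b k i ^+ 2.
Proof.
rewrite /noise_sq; under [X in mean P X]eq_fun do rewrite sqE.
have l2 i j : L1 P (fun w => noise_mx b k w i j ^+ 2).
  by case: (noise_mx_L2 b k i j).
rewrite mean_sum; last by move=> i; apply: L1_sum => j; exact: l2.
apply: eq_bigr => i _; rewrite mean_sum //; apply: eq_bigr => j _.
rewrite -(laplace_mean_sqr (theta_gt0 b k i) (lap b k i j)).
by congr mean; apply/funext => w; rewrite mxE.
Qed.

Lemma noise_sq_le b k (B : R) : (forall i, theta b k i <= B) ->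
  noise_sq b k <= 2 * n%:R * d%:R * B ^+ 2.
Proof.
move=> tB; rewrite noise_sqE.
apply: (@le_trans _ _ (\sum_(i < n) \sum_(j < d) 2 * B ^+ 2)).
  apply: ler_sum => i _; apply: ler_sum => j _; rewrite ler_pM2l //.
  by rewrite lerXn2r ?nnegrE ?(le_trans _ (tB i)) // ltW.
rewrite !sumr_const !card_ord -[_ *+ d]mulr_natl -[_ *+ n]mulr_natl.
by rewrite le_eqVlt; apply/orP; left; apply/eqP; ring.
Qed.

(** The real form of V_k; a single [s2] serves the second and fourth entries because zeta_2 =
    zeta_4. *)
Definition lyapunov (s1 s2 s3 : R) k :=
  objective k + (s1 * disagreement true k + s2 * disagreement false k
                 + s3 * message_sq true k + s2 * message_sq false k).

Lemma lyapunov_step (z p1 r0 lam2 nb : R) k :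
  let m := n%:R : R in
  let lh := 1 - gamma * rho in
  let s2 := z * rho ^+ 2 / (m * L) in
  let s3 := L / m in
  0 < phi -> 0 < nu -> 0 < z -> 0 < p1 <= 1 -> 0 <= lam2 -> 0 <= nb ->
  0 < alpha_x -> alpha_x * r < 1 -> p1 <= alpha_x * r * phi ->
  0 < alpha_y -> alpha_y * r < 1 -> p1 <= alpha_y * r * phi ->
  r0 = 2 * r ^+ 2 * (1 - phi) + 2 * (1 - r) ^+ 2 -> 0 <= r0 ->
  gamma = z * rho * p1 -> eta = z * gamma * rho ^+ 2 / L ->
  z * (nu / L) + 1860 * (z * (L / m)) <= 1 ->
  z * (2 * (nu / L) + 18 * (m / L) + 576) <= 1 ->
  z * (2 * (nu / L) + 72 * (m / L) * r0 + 576 + 1024 * r0) <= 1 ->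
  z * (2 * (nu / L) + 144 * r0) <= 1 ->
  (forall b, noise_sq b k <= nb /\ noise_sq b k.+1 <= nb) ->
  lyapunov 2^-1 s2 s3 k.+1 <=
  (1 - eta * nu / 2) * lyapunov 2^-1 s2 s3 k
  + (2^-1 * (9 * lh ^+ 2 / (gamma * rho))
     + s2 * (36 * lh ^+ 2 * L ^+ 2 / (gamma * rho) + 9 * lh ^+ 2 / (gamma * rho))
     + s3 * (16 * (lh ^+ 2 + 1) / p1)
     + s2 * ((64 * lam2 + 16 * (lam2 + 1)) / p1)) * nb
  + eta / m * mean P (fun w => sq (noise_sum k.+1 w)).
Proof.
move=> m lh s2 s3 phi0 nu0 z0 p1p lam20 nb0 ax0 axr axp ay0 ayr ayp r0E r00.
move=> gE eE C2 C3 C4 C5 nzb; have /andP[p10 p11] := p1p.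
have t0 : 0 <= 1 - p1 / 2.
  by rewrite subr_ge0 ler_pdivrMr // mul1r (le_trans p11) // ler1n.
have m0 : 0 < m by rewrite ltr0n.
have cn0 : 0 <= L / 2 / m.
  by apply: divr_ge0; [apply: divr_ge0 => //; exact: ltW|exact: ltW].
have rho1 := spectral_gap_le1 W.
have grlt := gamma_rho_lt1 W gamma_gt0 gamma_lt1.
have gr0 : 0 < gamma * rho by rewrite mulr_gt0.
have ca := coef_disagreement_x z0 rho_gt0 rho1 p10 L_gt0 nu0 m0 C2 C3.
have cb := coef_disagreement_y z0 rho_gt0 rho1 p10 L_gt0 nu0 m0 C3.
have cc := coef_message_x z0 rho_gt0 rho1 p10 L_gt0 nu0 m0 r00 C3 C4.
have ce := coef_message_y z0 rho_gt0 rho1 p10 L_gt0 nu0 m0 r00 C3 C5.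
have cg := coef_tracking z0 rho_gt0 rho1 p10 p11 L_gt0 nu0 m0 C3.
have cn := coef_noise z0 rho_gt0 rho1 p10 p11 L_gt0 nu0 m0 lam20 C3.
rewrite -gE -?eE -/lh -/s2 -/s3 in ca cb cc ce cg cn.
have s20 : 0 <= s2 by rewrite divr_ge0 ?mulr_ge0 ?exprn_ge0 // ltW.
have s30 : 0 <= s3 by rewrite divr_ge0 // ltW.
have en0 : 0 <= eta * nu by rewrite mulr_ge0 // ltW.
have dis0 b : 0 <= disagreement b k by apply: mean_ge0 => w; exact: sq_ge0.
have msg0 b : 0 <= message_sq b k by apply: mean_ge0 => w; exact: sq_ge0.
have trk0 : 0 <= tracking k by apply: mean_ge0 => w; exact: sq_ge0.
have [nx nx'] := nzb true; have [ny ny'] := nzb false.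
have qle b := quantization_le b k; rewrite -r0E in qle.
have hc : message_sq true k.+1 <= (1 - p1 / 2) * message_sq true k
  + 3 / p1 * (5 * (4 * gamma ^+ 2 * (disagreement true k + noise_sq true k
                            + quantization_sq true k)
          + eta ^+ 2 * (disagreement false k + tracking k)))
  + noise_sq true k.+1.
  apply: le_trans (message_step (b := true) k ax0 axr p1p axp) _.
  rewrite lerD2r lerD2l ler_wpM2l ?divr_ge0 ?(ltW p10) //.
  exact: drift_x_mean_le.
have he : message_sq false k.+1 <= (1 - p1 / 2) * message_sq false k
  + 3 / p1 * (4 * (4 * gamma ^+ 2 * (disagreement false k + noise_sq false k
                            + quantization_sq false k)
          + L ^+ 2 * increment_sq k))
  + noise_sq false k.+1.
  apply: le_trans (message_step (b := false) k ay0 ayr p1p ayp) _.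
  rewrite lerD2r lerD2l ler_wpM2l ?divr_ge0 ?(ltW p10) //.
  exact: drift_y_mean_le.
have hv := objective_le k; rewrite -/m in hv.
have := lyapunov_combination _ _ _ _ trk0 _ nb0 (qle true) (qle false)
  (increment_sq_le k) hv (disagreement_x_le k) (disagreement_y_le k) hc he
  ca cb cc ce cg cn.
move=> comb; apply: le_trans (comb _ _ _ _ _) _.
- split; [by rewrite /lh subr_ge0 ltW | by rewrite divr_ge0 // ltW
    | by rewrite divr_ge0 // ltW | by rewrite mulr_ge0 ?sqr_ge0
    | exact: sqr_ge0].
- by split; [exact: sqr_ge0 | exact: t0 | exact: en0 | exact: cn0].
- by split; rewrite ?invr_ge0.
- by split => //; exact: objective_ge0.
- by split.
rewrite lerD2l ler_pM2l; first exact: noise_sum_le.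
by rewrite divr_gt0.
Qed.

Lemma expected_objective k :
  ('E_P[fun w => f (average (st_x (state w k)))] - fstar%:E = (objective k)%:E)%E.
Proof.
have o1 := objective_L1 k.
have f1 : L1 P (fun w => f (mean_iterate true k w)).
  rewrite (_ : (fun w => _) = fun w =>
    (f (mean_iterate true k w) - fstar) + fstar).
    by apply: L1D => //; exact: L1_cst.
  by apply/funext => w; rewrite subrK.
by rewrite expectationE // -EFinB /objective meanB ?mean_cst //; exact: L1_cst.
Qed.

Lemma expected_Theta k (a : 'I_4) :
  ('E_P[fun w => Theta (xi_x w k) (xi_y w k) (state w k) a ord0] =
  (col4 (disagreement true k) (disagreement false k)
        (message_sq true k) (message_sq false k) a ord0)%:E)%E.
Proof.
have dis b : L1 P (fun w => sq ((1%:M - J) *m iterate b k w)).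
  by apply: L1_sq; apply: L2mx_mull; exact: iterate_L2.
have msg b : L1 P (fun w => sq (message_mx b k w)).
  by apply: L1_sq; exact: message_L2.
have msgE b w : l2norm (stack (fun i => refp b (state w k) i
    - (iter b (state w k) i + noise b w k i))) ^+ 2 = sq (message_mx b k w).
  rewrite l2normE -sqN; congr sq.
  by apply/matrixP => i j; rewrite !mxE; ring.
have disE b w : l2norm (stack (fun i => iter b (state w k) i
    - average (iter b (state w k)))) ^+ 2 = sq ((1%:M - J) *m iterate b k w).
  by rewrite l2normE stack_center.
case: a => -[|[|[|[|//]]]] i4; rewrite /Theta /col4;
  under [X in ('E_P[X])%E]eq_fun do rewrite mxE /=; rewrite mxE /=.
- by rewrite -(expectationE (dis true)); congr expectation;
    apply/funext => w; rewrite -disE.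
- by rewrite -(expectationE (dis false)); congr expectation;
    apply/funext => w; rewrite -disE.
- by rewrite -(expectationE (msg true)); congr expectation;
    apply/funext => w; rewrite -msgE.
- by rewrite -(expectationE (msg false)); congr expectation;
    apply/funext => w; rewrite -msgE.
Qed.

Lemma expected_noise_sum k :
  ('E_P[fun w => (l2norm (\sum_(t < k) stack (xi_y w t)) ^+ 2)%R] =
  (mean P (fun w => sq (noise_sum k w)))%:E)%E.
Proof.
rewrite -expectationE; last by apply: L1_sq; exact: noise_sum_L2.
by congr expectation; apply/funext => w; rewrite l2normE.
Qed.

End Process.

(** * Constants, and the passage from extended to real numbers *)

Lemma zetabar2_bounds (R : realType) (n : nat) (z nu L r0 p1 lam : R) :
  (0 < n)%N -> 0 < nu -> 0 < L -> 0 <= r0 ->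
  (z%:E <= zetabar2 n nu L r0 p1 lam)%E ->
  [/\ z * (nu / L) + 1860 * (z * (L / n%:R)) <= 1,
      z * (2 * (nu / L) + 18 * (n%:R / L) + 576) <= 1,
      z * (2 * (nu / L) + 72 * (n%:R / L) * r0 + 576 + 1024 * r0) <= 1
    & z * (2 * (nu / L) + 144 * r0) <= 1].
Proof.
move=> n0 nu0 L0 r00; have m0 : 0 < n%:R :> R by rewrite ltr0n.
rewrite /zetabar2; move: (n%:R : R) m0 => m m0.
(* For a positive denominator the extended-real quotient is the ordinary one and can be cleared. *)
have divE (a b : R) : 0 < b -> (z%:E <= a%:E / b%:E)%E -> z * b <= a.
  move=> b0; rewrite inver gt_eqF // -EFinM lee_fin => h.
  by rewrite -ler_pdivlMr.
have nL : 0 < nu / L by rewrite divr_gt0.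
have mL : 0 < m / L by rewrite divr_gt0.
have mLr : 0 <= (m / L) * r0 by rewrite mulr_ge0 // ltW.
rewrite !big_cons big_nil !le_min.
move=> /and5P[_ c2 c3 c4 /andP[c5 _]]; split.
(* The denominator is m nu / L + 1860 L; dividing the cleared bound by [m] gives the claim. *)
- have t0 : 0 < m * nu / (2 * L ^+ 2).
    by rewrite divr_gt0 ?mulr_gt0 // exprn_gt0.
  have b0 : 0 < 2 * L * (m * nu / (2 * L ^+ 2) + 930).
    by apply: mulr_gt0; [rewrite mulr_gt0|lra].
  rewrite -(ler_pM2r m0) mul1r; apply: le_trans (divE _ _ b0 c2).
  by rewrite le_eqVlt; apply/orP; left; apply/eqP; field; rewrite !gt_eqF.
- have E : (2 * nu + 18 * m) / L + 576 = 2 * (nu / L) + 18 * (m / L) + 576.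
    by field; rewrite gt_eqF.
  by rewrite -E; apply: divE c3; rewrite E; lra.
- have E : (2 * nu + 72 * m * r0) / L + 576 + 1024 * r0 =
     2 * (nu / L) + 72 * (m / L) * r0 + 576 + 1024 * r0.
    by field; rewrite gt_eqF.
  by rewrite -E; apply: divE c4; rewrite E; lra.
- have E : 2 * nu / L + 144 * r0 = 2 * (nu / L) + 144 * r0 by rewrite mulrA.
  by rewrite -E; apply: divE c5; rewrite E; lra.
Qed.

Theorem theorem2 (R : realType)
  (* dimensions, objective *)
  (n d : nat) (n_gt0 : (0 < n)%N) (d_gt0 : (0 < d)%N)
  (fi : 'I_n -> 'rV[R]_d -> R) (f : 'rV[R]_d -> R) (fstar Lf nu : R)
  (fE : forall x, f x = n%:R^-1 * \sum_(i < n) fi i x)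
  (Lf_gt0 : 0 < Lf) (fi_smooth : forall i, smooth Lf (fi i))
  (fstarE : ereal_inf [set (f x)%:E | x in [set: 'rV[R]_d]] = fstar%:E)
  (nu_gt0 : 0 < nu)
  (PL : forall x, 2^-1 * l2norm (grad f x) ^+ 2 >= nu * (f x - fstar))
  (* network *)
  (e : rel 'I_n) (W : 'M[R]_n)
  (e_sym : symmetric e) (eW : weighted_adjacency e W)
  (e_connected : forall i j, connect e i j)
  (W_ds : doubly_stochastic W)
  (* compressor *)
  (dispZ : measure_display) (Z : measurableType dispZ) (PC : probability Z R)
  (C : 'rV[R]_d -> Z -> 'rV[R]_d) (phi r : R)
  (phi_gt0 : 0 < phi) (phi_le1 : phi <= 1) (r_gt0 : 0 < r)
  (C_meas : measurable_compressor C) (C_compr : compressor PC phi r C)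
  (* randomness *)
  (disp : measure_display) (T : measurableType disp) (P : probability T R)
  (s_x s_y q : 'I_n -> R)
  (s_x_gt0 : forall i, 0 < s_x i) (s_y_gt0 : forall i, 0 < s_y i)
  (q_gt0 : forall i, 0 < q i) (q_lt1 : forall i, q i < 1)
  (xi_x xi_y : T -> nat -> 'I_n -> 'rV[R]_d)
  (z_x z_y : T -> nat -> 'I_n -> Z)
  (xi_x_lap : forall k i j,
     laplace_rv P (s_x i * q i ^+ k) (fun w => xi_x w k i 0 j))
  (xi_y_lap : forall k i j,
     laplace_rv P (s_y i * q i ^+ k) (fun w => xi_y w k i 0 j))
  (z_x_law : forall k i, has_law P PC (fun w => z_x w k i))
  (z_y_law : forall k i, has_law P PC (fun w => z_y w k i))
  (indep : mutually_independent P (source_events xi_x xi_y z_x z_y))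
  (* algorithm *)
  (eta gamma alpha_x alpha_y : R)
  (eta_gt0 : 0 < eta) (gamma_gt0 : 0 < gamma)
  (alpha_x_gt0 : 0 < alpha_x) (alpha_x_lt : alpha_x < r^-1)
  (alpha_y_gt0 : 0 < alpha_y) (alpha_y_lt : alpha_y < r^-1)
  (x0 : 'I_n -> 'rV[R]_d)
  (zeta_gamma zeta_eta : R) :
  let state w k := pgtc W fi eta gamma alpha_x alpha_y x0 (xi_x w) (xi_y w)
    (fun t i v => C v (z_x w t i)) (fun t i v => C v (z_y w t i)) k in
  let r0 : R := 2 * r ^+ 2 * (1 - phi) + 2 * (1 - r) ^+ 2 in
  let phi1 : R := Num.min (alpha_x * r * phi) (alpha_y * r * phi) in
  let rho : R := 1 - spectral_radius (W - const_mx n%:R^-1) in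
  let lamWI : R := spectral_radius (W - 1%:M) in
  let lamhat : R := 1 - gamma * rho in
  let qbar : R := \big[Num.max/0]_(i < n) q i in
  let sbar : R := \big[Num.max/0]_(i < n) Num.max (s_x i) (s_y i) in
  let zeta1 : R := n%:R / (2 * Lf) in
  let zeta2 := zeta_eta in
  let zeta3 : R := 1 in
  let zeta4 := zeta_eta in
  let s : 'cV[R]_4 := col4
    (zeta1 * Lf / n%:R) (zeta2 * rho ^+ 2 / (n%:R * Lf))
    (zeta3 * Lf / n%:R) (zeta4 * rho ^+ 2 / (n%:R * Lf)) in
  let V (k : nat) : \bar R :=
   ('E_P[fun w => f (average (st_x (state w k)))] - fstar%:E
    + \sum_(a < 4) (s a ord0)%:E
        * 'E_P[fun w => Theta (xi_x w k) (xi_y w k) (state w k) a ord0])%E in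
  let vtheta2 : 'cV[R]_4 := (2 * n%:R * d%:R) *: col4
    (9 * lamhat ^+ 2 / (gamma * rho))
    (36 * lamhat ^+ 2 * Lf ^+ 2 / (gamma * rho)
      + 9 * lamhat ^+ 2 / (gamma * rho))
    (16 * (lamhat ^+ 2 + 1) / phi1)
    ((64 * lamWI ^+ 2 + 16 * (lamWI ^+ 2 + 1)) / phi1) in
  let b1 : R := (s^T *m vtheta2) 0 0 + (eta^-1 + Lf) * n%:R in
  gamma = zeta_gamma * rho * phi1 ->
  eta = zeta_eta * gamma * rho ^+ 2 / Lf ->
  0 < zeta_gamma -> zeta_gamma = zeta_eta ->
  (zeta_eta%:E <= zetabar2 n nu Lf r0 phi1 lamWI)%E ->
  forall k : nat,
    (V k.+1 <= (1 - eta * nu / 2)%:E * V k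
               + (b1 * qbar ^+ (2 * k) * sbar ^+ 2)%:E
               + (eta / n%:R)%:E
                 * 'E_P[fun w =>
                     (l2norm (\sum_(t < k.+1) stack (xi_y w t)) ^+ 2)%R])%E.
Proof.
move=> state0 r0 phi1 rho lamWI lamhat qbar sbar zeta1 zeta2 zeta3 zeta4 s V
  vtheta2 b1 gE eE zg0 zE zle k.
pose z := zeta_eta; have z0 : 0 < z by rewrite /z -zE.
rewrite zE -/z in gE; rewrite -/z in eE.
have m0 : 0 < n%:R :> R by rewrite ltr0n.
have r00 : 0 <= r0.
  rewrite /r0; apply: addr_ge0; apply: mulr_ge0; rewrite ?sqr_ge0 ?subr_ge0 //.
  by rewrite mulr_ge0 ?sqr_ge0.
have [C2 C3 C4 C5] := zetabar2_bounds n_gt0 nu_gt0 Lf_gt0 r00 zle.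
have axr : alpha_x * r < 1 by rewrite -ltr_pdivlMr // mul1r.
have ayr : alpha_y * r < 1 by rewrite -ltr_pdivlMr // mul1r.
have ax0 : 0 < alpha_x * r by rewrite mulr_gt0.
have ay0 : 0 < alpha_y * r by rewrite mulr_gt0.
have p0 : 0 < phi1 by rewrite lt_min !mulr_gt0.
have px : phi1 <= alpha_x * r * phi by rewrite ge_min lexx.
have py : phi1 <= alpha_y * r * phi by rewrite ge_min lexx orbT.
have p1 : phi1 <= 1.
  by apply: le_trans px _; rewrite mulr_ile1 // ltW.
have zp : 0 < z * phi1 by rewrite mulr_gt0.
(* [gamma] is positive and equals [z * phi1 * rho], where [z * phi1] is positive. *)
have rho0 : 0 < rho.
  by rewrite -(pmulr_rgt0 _ zp) mulrAC -gE.
have rho1 : rho <= 1 by exact: spectral_gap_le1.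
have z1 : 576 * z <= 1.
  apply: le_trans C3; have : 0 <= z * (nu / Lf) by rewrite !mulr_ge0 ?invr_ge0 // ltW.
  have : 0 <= z * (n%:R / Lf) by rewrite !mulr_ge0 ?invr_ge0 // ltW.
  by rewrite -/z; lra.
(* [gamma] is [z] times a factor at most 1, and [z] is at most 1/576. *)
have g1 : gamma < 1.
  have rp : rho * phi1 <= 1 by rewrite mulr_ile1 // ltW.
  have : z * (rho * phi1) <= z * 1 by rewrite ler_pM2l.
  by rewrite mulrA -gE; lra.
have symW : W^T = W by case: eW.
have f_ge x : fstar <= f x.
  by rewrite -lee_fin -fstarE; apply: ereal_inf_lbound; exists x.
pose theta (b : bool) t i := (if b then s_x i else s_y i) * q i ^+ t.
have th0 b t i : 0 < theta b t i.
  by rewrite /theta; case: b; rewrite mulr_gt0 ?exprn_gt0.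
have lap (b : bool) t i j : laplace_rv P (theta b t i)
   (fun w => (if b then xi_x else xi_y) w t i 0 j).
  by case: b; [exact: xi_x_lap|exact: xi_y_lap].
have law (b : bool) t i : has_law P PC (fun w => (if b then z_x else z_y) w t i).
  by case: b; [exact: z_x_law|exact: z_y_law].
have obj t := expected_objective n_gt0 eta gamma alpha_x alpha_y x0 th0 lap law
  indep Lf_gt0 fi_smooth W_ds r_gt0 C_meas C_compr fE f_ge t.
have Thet t a := expected_Theta eta gamma alpha_x alpha_y x0 th0 lap law
  indep Lf_gt0 fi_smooth W_ds r_gt0 C_meas C_compr t a.
have nsum t := expected_noise_sum th0 lap t.
pose s2 := z * rho ^+ 2 / (n%:R * Lf).
pose s3 := Lf / n%:R.
pose lyap := lyapunov P xi_x xi_y z_x z_y W fi C eta gamma alpha_x alpha_y x0 f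
  fstar 2^-1 s2 s3.
have VE t : V t = (lyap t)%:E.
  rewrite /V obj !big_ord_recl big_ord0 adde0 !Thet !mxE /=.
  rewrite -!EFinM -!EFinD /lyap /lyapunov; congr (_%:E).
  have -> : zeta1 * Lf / n%:R = 2^-1.
    by rewrite /zeta1; field; rewrite !gt_eqF.
  by rewrite /zeta2 /zeta3 /zeta4 -/z -/s2 mul1r -/s3 !addrA.
have q01 i : 0 <= q i <= 1 by rewrite !ltW.
have qle i : q i <= qbar by exact: le_bigmax.
have qbar0 : 0 <= qbar by exact: bigmax_ge_id.
have sle (b : bool) i : (if b then s_x i else s_y i) <= sbar.
  apply: le_trans (le_bigmax _ (fun j => Num.max (s_x j) (s_y j)) i).
  by case: b; rewrite le_max lexx ?orbT.
have sbar0 : 0 <= sbar by exact: bigmax_ge_id.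
(* Used for [t] equal to 0 and 1: since the scales decay, the level of step [k] also bounds the
   noise of step [k + 1]. *)
have thle b t i : theta b (t + k)%N i <= sbar * qbar ^+ k.
  rewrite /theta; have si0 : 0 <= (if b then s_x i else s_y i).
    by case: b; exact: ltW.
  have /andP[qi0 qi1] := q01 i.
  apply: ler_pM => //; first exact: exprn_ge0.
  rewrite exprD; apply: (@le_trans _ _ (1 * q i ^+ k)).
    by rewrite ler_wpM2r ?exprn_ge0 // exprn_ile1.
  by rewrite mul1r lerXn2r // nnegrE.
(* Each of the n d components has second moment twice its squared scale; this is the factor 2 n d in
   front of [vtheta2]. *)
pose nb := 2 * n%:R * d%:R * (sbar * qbar ^+ k) ^+ 2.
have nbE b t : noise_sq P xi_x xi_y b (t + k) <= nb.
  exact: (noise_sq_le th0 lap (thle b t)).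
have nb0 : 0 <= nb by rewrite /nb mulr_ge0 ?sqr_ge0 // !mulr_ge0 ?ler0n.
have := lyapunov_step n_gt0 x0 th0 lap law indep Lf_gt0 fi_smooth W_ds r_gt0
  C_meas C_compr symW gamma_gt0 g1 rho0 fE f_ge PL eta_gt0 (k := k)
  phi_gt0 nu_gt0 z0 (introT andP (conj p0 p1)) (sqr_ge0 lamWI) nb0
  alpha_x_gt0 axr px alpha_y_gt0 ayr py erefl r00 gE eE C2 C3 C4 C5
  (fun b => conj (nbE b 0%N) (nbE b 1%N)).
rewrite -/s2 -/s3 -/lyap -/lamhat; set kap := (X in X * nb); set S := mean _ _.
move=> step; rewrite !VE nsum -!EFinM -!EFinD lee_fin.
apply: le_trans step _; rewrite lerD2r lerD2l.
(* Pulling the scalar 2 n d out of [s^T *m vtheta2] leaves exactly the noise coefficient [kap] of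
   the recursion. *)
have b1E : b1 = 2 * n%:R * d%:R * kap + (eta^-1 + Lf) * n%:R.
  rewrite /b1 /kap !mxE !big_ord_recl big_ord0 !mxE /= addr0.
  have -> : zeta1 * Lf / n%:R = 2^-1.
    by rewrite /zeta1; field; rewrite !gt_eqF.
  rewrite /zeta2 /zeta3 /zeta4 -/z -/s2 mul1r -/s3.
  by rewrite /rho; ring.
have -> : kap * nb = 2 * n%:R * d%:R * kap * (qbar ^+ (2 * k) * sbar ^+ 2).
  by rewrite /nb exprMn -exprM (mulnC k); ring.
rewrite b1E -[leRHS]mulrA; apply: ler_wpM2r.
  by rewrite mulr_ge0 ?exprn_ge0.
by rewrite lerDl mulr_ge0 // addr_ge0 ?invr_ge0 // ltW.
Qed.
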